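(* The diagonal terms of the (bi-)orthogonality relations are given as follows. For $m\in\mathbb Z_+$, $$(P_m^+,P_m^+)=\frac{2\,(q^{2m-1}abcd,\,q^{2m}abcd;q)_\infty}{(q^{m+1},q^mab,q^mac,q^mad,q^mbc,q^mbd,q^mcd,q^{m-1}abcd;q)_\infty},$$ $$\langle P_m,P_m'\rangle=\frac{(q^{2m}abcd,\,q^{2m}abcd;q)_\infty}{(q^{m+1},q^{m+1}ab,q^mac,q^mad,q^mbc,q^mbd,q^mcd,q^mabcd;q)_\infty},$$ and for $m\in\mathbb N$, $$\langle P_{-m},P_{-m}'\rangle=\frac{(q^{2m-1}abcd,\,q^{2m-1}abcd;q)_\infty}{(q^m,q^mab,q^mac,q^mad,q^mbc,q^mbd,q^{m-1}cd,q^{m-1}abcd;q)_\infty},$$ $$\langle P_m^-,P_m^{-\,\prime}\rangle=\frac{ab-1}{ab}\,\frac{(q^{2m-1}abcd,\,q^{2m}abcd;q)_\infty}{(q^m,q^{m+1}ab,q^mac,q^mad,q^mbc,q^mbd,q^{m-1}cd,q^mabcd;q)_\infty}.$$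
   Context: $\mathbb Z_+=\{0,1,2,\dots\}$, $\mathbb N=\{1,2,\dots\}$. Parameters: $q\in\mathbb C$ with $0<|q|<1$ and a fixed square root $q^{1/2}$; $\underline t=(k_0,k_1,u_0,u_1)$ nonzero complex numbers with $k_0^2,k_1^2,u_1^2\notin\{\pm q^j:j\in\mathbb Z\}$. Set $a=k_1u_1$, $b=-k_1u_1^{-1}$, $c=q^{1/2}k_0u_0$, $d=-q^{1/2}k_0u_0^{-1}$ and assume $ef\notin q^{\mathbb Z}$ for all $e,f\in\{a,b,c,d\}$. $\mathcal A=\mathbb C[x^{\pm1}]$. Define linear operators on $\mathcal A$ by $(T_1f)(x)=k_1f(x)+k_1^{-1}\frac{(1-k_1u_1x)(1+k_1u_1^{-1}x)}{1-x^2}\bigl(f(x^{-1})-f(x)\bigr)$ and $(T_0f)(x)=k_0f(x)+k_0^{-1}\frac{(1-q^{1/2}k_0u_0x^{-1})(1+q^{1/2}k_0u_0^{-1}x^{-1})}{1-qx^{-2}}\bigl(f(qx^{-1})-f(x)\bigr)$, and $Y=T_1T_0$. Let $\epsilon(m)=1$ for $m\ge0$, $\epsilon(m)=-1$ for $m<0$, $\gamma_m=(k_0k_1)^{\epsilon(m)}q^m$. Order the monomials by $1\prec x^{-1}\prec x\prec x^{-2}\prec x^2\prec\cdots$. $P_m$ ($m\in\mathbb Z$) is the unique Laurent polynomial of the form $x^m+$ lower order terms w.r.t. $\preceq$ with $YP_m=\gamma_mP_m$. $P_m^+$ ($m\in\mathbb Z_+$) is the unique element of $\mathrm{span}\{P_m,P_{-m}\}$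 of the form $x^m+$ lower order terms with $T_1P_m^+=k_1P_m^+$; $P_m^-$ ($m\in\mathbb N$) is the unique element of $\mathrm{span}\{P_m,P_{-m}\}$ of the form $x^m+$ lower order terms with $T_1P_m^-=-k_1^{-1}P_m^-$. A prime ($P_m'$, $P_m^{-\,\prime}$) denotes the polynomial obtained by the same construction with $k_0,k_1,u_0,u_1,q,q^{1/2}$ all replaced by their inverses. $(y;q)_\infty=\prod_{j\ge0}(1-yq^j)$ and $(y_1,\dots,y_r;q)_\infty=\prod_i(y_i;q)_\infty$. The bilinear forms on $\mathcal A$ are $$\langle f,g\rangle=\frac1{2\pi i}\int_{C}f(x)g(x^{-1})\Delta(x)\frac{dx}{x},\qquad (f,g)=\frac1{2\pi i}\int_{C}f(x)g(x^{-1})\Delta_+(x)\frac{dx}{x},$$ $$\Delta_+(x)=\frac{(x^2,x^{-2};q)_\infty}{(ax,ax^{-1},bx,bx^{-1},cx,cx^{-1},dx,dx^{-1};q)_\infty},\qquad \Delta(x)=\frac{(1-ax^{-1})(1-bx^{-1})}{1-x^{-2}}\Delta_+(x),$$ where $C$ is a counterclockwise continuous rectifiable Jordan curve such that $aq^k,bq^k,cq^k,dq^k$ ($k\in\mathbb Z_+$) lie in its interior and $a^{-1}q^{-k},b^{-1}q^{-k},c^{-1}q^{-k},d^{-1}q^{-k}$ ($k\in\mathbb Z_+$) lie in its exterior.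
   Formalization: The formula for (P_m^+,P_m^+) is stated except when m=0 and abcd=q, where its right-hand side is 0/0; and the curve C is required not to pass through 0, where the integrand is undefined. *)

(* Defs.v *)
From HB Require Import structures.
From mathcomp Require Import all_boot all_order all_algebra.
From mathcomp Require Import all_classical all_reals all_analysis.
From mathcomp.real_closed Require Import complex.
From mathcomp Require Import finmap ring.

Set Implicit Arguments.
Unset Strict Implicit.
Unset Printing Implicit Defensive.

Import Order.TTheory GRing.Theory Num.Theory.
Import numFieldNormedType.Exports.

Local Open Scope classical_set_scope.
Local Open Scope ring_scope.
Local Open Scope complex_scope.

(* The topology of R[i] is the one given by its modulus. *)
HB.instance Definition _ (R : realType) :=
  NormedModule.copy R[i] (R[i] : numFieldType).

(* Laurent polynomials, as finitely supported coefficient functions. *)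
Section Laurent.
Variable R : realType.

Definition fin_supp_pred : {pred (int -> R[i])} :=
  fun f => `[< finite_set [set n | f n != 0] >].

Lemma fin_supp_submod_closed : GRing.submod_closed fin_supp_pred.
Proof.
split=> [|c f g].
  rewrite unfold_in; apply/asboolP.
  suff -> : [set n : int | (0 : int -> R[i]) n != 0] = set0 by exact: finite_set0.
  by apply/seteqP; split=> n //=; rewrite eqxx.
rewrite !unfold_in => /asboolP ff /asboolP fg; apply/asboolP.
apply: (@sub_finite_set _ _ ([set n | f n != 0] `|` [set n | g n != 0])).
  move=> n /= fgn; have [fn0|] := eqVneq (f n) 0; last by left.
  right; move: fgn; apply: contraNN => /eqP gn0.
  by rewrite [X in X == 0](_ : _ = c * f n + g n)// fn0 gn0 mulr0 addr0.
by rewrite finite_setU.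
Qed.

HB.instance Definition _ :=
  GRing.isSubmodClosed.Build R[i] (int -> R[i]) fin_supp_pred
    fin_supp_submod_closed.

Record laurent := Laurent {
  lcoef :> int -> R[i];
  lcoefP : lcoef \in fin_supp_pred }.

HB.instance Definition _ := [isSub for lcoef].
HB.instance Definition _ := [Choice of laurent by <:].
HB.instance Definition _ := [SubChoice_isSubLmodule of laurent by <:].

Definition leval (p : laurent) (x : R[i]) : R[i] :=
  \sum_(n \in [set: int]) p n * x ^ n.

End Laurent.

Section Operators.
Variable R : realType.
Local Notation C := R[i].
Local Notation A := (laurent R).

(* [sq] is the chosen square root of q. *)
Record params := Params { k0 : C; k1 : C; u0 : C; u1 : C; sq : C }.

Definition inv_params (t : params) : params :=
  Params (k0 t)^-1 (k1 t)^-1 (u0 t)^-1 (u1 t)^-1 (sq t)^-1.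

Variable t : params.

Definition pq : C := sq t ^+ 2.
Definition pa : C := k1 t * u1 t.
Definition pb : C := - (k1 t / u1 t).
Definition pc : C := sq t * k0 t * u0 t.
Definition pd : C := - (sq t * k0 t / u0 t).

Definition generic_params : Prop :=
  [/\ 0 < `|pq| < 1,
      [/\ k0 t != 0, k1 t != 0, u0 t != 0 & u1 t != 0],
      (forall y, y \in [:: k0 t ^+ 2; k1 t ^+ 2; u1 t ^+ 2] ->
         forall j : int, y != pq ^ j /\ y != - pq ^ j)
    & (forall e f, e \in [:: pa; pb; pc; pd] -> f \in [:: pa; pb; pc; pd] ->
         forall j : int, e * f != pq ^ j)].

Definition T1fun (f : C -> C) (x : C) : C :=
  k1 t * f x + (k1 t)^-1 *
    (((1 - k1 t * u1 t * x) * (1 + k1 t / u1 t * x)) / (1 - x ^+ 2)) *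
    (f x^-1 - f x).

Definition T0fun (f : C -> C) (x : C) : C :=
  k0 t * f x + (k0 t)^-1 *
    (((1 - sq t * k0 t * u0 t * x^-1) * (1 + sq t * k0 t / u0 t * x^-1)) /
       (1 - pq * x ^- 2)) *
    (f (pq * x^-1) - f x).

(* The Laurent polynomials with the prescribed values away from the zeros of
   the denominators; see [T1P] and [T0P] for existence. *)
Definition T1 (p : A) : A :=
  xget 0 [set r : A | forall x, x != 0 -> x ^+ 2 != 1 ->
                        leval r x = T1fun (leval p) x].

Definition T0 (p : A) : A :=
  xget 0 [set r : A | forall x, x != 0 -> x ^+ 2 != pq ->
                        leval r x = T0fun (leval p) x].

Definition Y (p : A) : A := T1 (T0 p).

Definition gam (m : int) : C :=
  (if 0 <= m then k0 t * k1 t else (k0 t * k1 t)^-1) * pq ^ m.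

End Operators.

Section OperatorFacts.
Variable R : realType.
Local Notation C := R[i].
Local Notation A := (laurent R).

Lemma leval_fset (p : A) (B : {fset int}) (x : C) :
  (forall n, n \notin B -> p n = 0) -> leval p x = \sum_(n <- B) p n * x ^ n.
Proof. by move=> pB; apply: fsbigTE => n /pB ->; rewrite mul0r. Qed.

Lemma finite_supp (p : A) : finite_set [set n | p n != 0].
Proof. by have := lcoefP p; rewrite unfold_in => /asboolP. Qed.

Lemma levalP (p q : A) (c x : C) :
  leval (c *: p + q) x = c * leval p x + leval q x.
Proof.
set B := fset_set ([set n | p n != 0] `|` [set n | q n != 0]).
have fB : finite_set ([set n | p n != 0] `|` [set n | q n != 0]).
  by rewrite finite_setU; split; exact: finite_supp.
have Bp n : n \notin B -> p n = 0.
  by apply: contraNeq => pn; rewrite in_fset_set//; apply/mem_set; left.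
have Bq n : n \notin B -> q n = 0.
  by apply: contraNeq => qn; rewrite in_fset_set//; apply/mem_set; right.
have E n : (c *: p + q) n = c * p n + q n by [].
rewrite !(@leval_fset _ B) //; last by move=> n nB; rewrite E Bp ?Bq ?mulr0 ?addr0.
by rewrite mulr_sumr -big_split; apply: eq_bigr => n _; rewrite E mulrDl mulrA.
Qed.

Let isL (f : C -> C) := exists r : A, forall x : C, x != 0 -> leval r x = f x.

Let isL_ext (f h : C -> C) : isL f -> (forall x : C, x != 0 -> f x = h x) -> isL h.
Proof. by case=> r rf fh; exists r => x x0; rewrite rf// fh. Qed.

Let isL0 : isL (fun=> 0).
Proof.
by exists 0 => x _; rewrite (@leval_fset _ fset0) ?big_seq_fset0.
Qed.

Let isL_lin (c : C) (f h : C -> C) : isL f -> isL h -> isL (fun x => c * f x + h x).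
Proof. by case=> r rf [s sh]; exists (c *: r + s) => x x0; rewrite levalP rf// sh. Qed.

Fact lmono_subproof (m : int) :
  (fun n : int => (n == m)%:R : C) \in @fin_supp_pred R.
Proof.
rewrite unfold_in; apply/asboolP; apply: (@sub_finite_set _ _ [set m]) => // n /=.
by case: (n =P m) => // _; rewrite eqxx.
Qed.
Definition lmono (m : int) : A := Laurent (lmono_subproof m).

Let isLX m : isL (fun x => x ^ m).
Proof.
exists (lmono m) => x _; rewrite (@leval_fset _ [fset m]%fset).
  by rewrite big_seq_fset1 /= eqxx mul1r.
by move=> n; rewrite inE /= => /negPf ->.
Qed.

Let isL_sum (I : Type) (s : seq I) (c : I -> C) (F : I -> C -> C) :
  (forall i, isL (F i)) -> isL (fun x => \sum_(i <- s) c i * F i x).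
Proof.
move=> LF; elim: s => [|i s ih].
  by apply: isL_ext isL0 _ => x _; rewrite big_nil.
apply: isL_ext (isL_lin (c i) (LF i) ih) _ => x _; by rewrite big_cons.
Qed.

Let fs (p : A) := fset_set [set n | p n != 0].

Let levalE p x : leval p x = \sum_(n <- fs p) p n * x ^ n.
Proof.
apply: leval_fset => n; apply: contraNeq => pn.
by rewrite in_fset_set; [exact: mem_set | exact: finite_supp].
Qed.

Let isL_mul f h : isL f -> isL h -> isL (fun x => f x * h x).
Proof.
have XL k f' : isL f' -> isL (fun x => x ^ k * f' x).
  case=> r rf.
  apply: isL_ext (@isL_sum _ (fs r) (fun n => r n) (fun n x => x ^ (n + k)) _) _.
    by move=> n; exact: isLX.
  move=> x x0; rewrite -rf// levalE mulr_sumr; apply: eq_bigr => n _.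
  by rewrite expfzDr// [RHS]mulrCA [x ^ n * _]mulrC.
move=> [r rf] hL.
apply: isL_ext (@isL_sum _ (fs r) (fun n => r n) (fun n x => x ^ n * h x) _) _.
  by move=> n; exact: XL.
move=> x x0; rewrite -rf// levalE mulr_suml; apply: eq_bigr => n _.
by rewrite mulrA.
Qed.

Let isLC (c : C) : isL (fun=> c).
Proof.
apply: isL_ext (isL_lin c (isLX 0) isL0) _ => x x0.
by rewrite expr0z mulr1 addr0.
Qed.

Let isL_add f h : isL f -> isL h -> isL (fun x => f x + h x).
Proof.
by move=> Lf Lh; apply: isL_ext (isL_lin 1 Lf Lh) _ => x _; rewrite mul1r.
Qed.

Let isL_div_mono (s : C) (n : int) : s != 0 ->
  exists2 D, isL D & forall x : C, x != 0 -> D x * (x ^+ 2 - s) = (s / x) ^ n - x ^ n.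
Proof.
move=> s0.
have pos (k : nat) : exists2 D, isL D &
    forall x : C, x != 0 -> D x * (x ^+ 2 - s) = (s / x) ^+ k - x ^+ k.
  exists (fun x => - x^-1 * \sum_(i < k) (s / x) ^+ (k.-1 - i) * x ^+ i).
    apply: isL_mul.
      by apply: isL_ext (isL_mul (isLC (-1)) (isLX (-1))) _ => x _; rewrite mulN1r.
    apply: isL_ext (@isL_sum _ (index_enum 'I_k)
      (fun i : 'I_k => s ^+ (k.-1 - i)) (fun i x => x ^ (- (k.-1 - i)%:Z + i%:Z)) _) _.
      by move=> i; exact: isLX.
    move=> x x0; apply: eq_bigr => i _.
    by rewrite expfzDr// -exprnN -exprnP exprMn exprVn mulrA.
  move=> x x0; rewrite subrXX; set S := \sum_(_ < _) _; by field.
case: n => k.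
  by have [D LD DE] := pos k; exists D => // x x0; rewrite DE.
have [D LD DE] := pos k.+1.
exists (fun x => - (s ^- k.+1) * D x); first by apply: isL_mul => //; exact: isLC.
move=> x x0; rewrite -mulrA DE// NegzE -!exprnN expr_div_n.
move: (expf_neq0 k.+1 s0) (expf_neq0 k.+1 x0).
set u := s ^+ k.+1; set v := x ^+ k.+1 => u0 v0.
by field; rewrite u0 v0.
Qed.

Let isL_div (s : C) (p : A) : s != 0 ->
  exists2 D, isL D &
    forall x : C, x != 0 -> D x * (x ^+ 2 - s) = leval p (s / x) - leval p x.
Proof.
move=> s0; pose D n := sval (cid2 (isL_div_mono n s0)).
exists (fun x => \sum_(n <- fs p) p n * D n x).
  by apply: isL_sum => n; rewrite /D; case: cid2.
move=> x x0; rewrite !levalE mulr_suml -sumrB; apply: eq_bigr => n _.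
by rewrite -mulrA {1}/D; case: cid2 => /= D' _ ->//; rewrite mulrBr.
Qed.

Lemma T1P (t : params R) (p : A) (x : C) :
  x != 0 -> x ^+ 2 != 1 -> leval (T1 t p) x = T1fun t (leval p) x.
Proof.
suff [r rE] : exists r : A, forall x, x != 0 -> x ^+ 2 != 1 ->
    leval r x = T1fun t (leval p) x.
  move=> x0 x1; rewrite /T1; case: xgetP => [_ _ -> //|/(_ r)]; last by case.
have [D LD DE] := isL_div p (oner_neq0 C).
have Lp : isL (leval p) by exists p.
have LX : isL id by apply: isL_ext (isLX 1) _ => y _; rewrite expr1z.
have lin (c : C) : isL (fun y => 1 + c * y).
  by apply: isL_add; [exact: isLC | apply: isL_mul => //; exact: isLC].
have [r rE] := isL_lin (k1 t) Lp (isL_mul (isLC (- (k1 t)^-1)) (isL_mul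
  (isL_mul (lin (- (k1 t * u1 t))) (lin (k1 t / u1 t))) LD)).
exists r => y y0 y1; rewrite rE// /T1fun.
have y1' : 1 - y ^+ 2 != 0 by rewrite subr_eq0 eq_sym.
have -> : leval p y^-1 - leval p y = - (D y * (1 - y ^+ 2)).
  by rewrite -[y^-1]mul1r -DE// -mulrN opprB.
congr (_ + _); rewrite [in RHS]mulrN.
set u := k1 t * u1 t; set v := k1 t / u1 t; set w := (k1 t)^-1.
by field.
Qed.

Lemma T0P (t : params R) (p : A) (x : C) : sq t != 0 ->
  x != 0 -> x ^+ 2 != pq t -> leval (T0 t p) x = T0fun t (leval p) x.
Proof.
move=> sq0; have q0 : pq t != 0 by rewrite expf_neq0.
suff [r rE] : exists r : A, forall x, x != 0 -> x ^+ 2 != pq t ->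
    leval r x = T0fun t (leval p) x.
  move=> x0 x1; rewrite /T0; case: xgetP => [_ _ -> //|/(_ r)]; last by case.
have [D LD DE] := isL_div p q0.
have Lp : isL (leval p) by exists p.
have LX : isL (fun y => y^-1) by apply: isL_ext (isLX (-1)) _ => y _.
have lin (c : C) : isL (fun y => 1 + c * y^-1).
  by apply: isL_add; [exact: isLC | apply: isL_mul => //; exact: isLC].
have [r rE] := isL_lin (k0 t) Lp (isL_mul (isLC (k0 t)^-1) (isL_mul
  (isL_mul (lin (- (sq t * k0 t * u0 t))) (lin (sq t * k0 t / u0 t)))
  (isL_mul (isLX 2) LD))).
exists r => y y0 y1; rewrite rE// /T0fun -DE// -exprnP.
have y1' : y ^+ 2 - pq t != 0 by rewrite subr_eq0.
congr (_ + _).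
set u := sq t * k0 t * u0 t; set v := sq t * k0 t / u0 t; set w := (k0 t)^-1.
by field; rewrite y0 y1'.
Qed.

End OperatorFacts.

(* Position of x^n in the order 1 < x^-1 < x < x^-2 < x^2 < ... *)
Definition mono_rank (n : int) : nat :=
  match n with Posz k => k.*2 | Negz k => k.*2.+1 end.

Section Polynomials.
Variable R : realType.
Local Notation C := R[i].
Local Notation A := (laurent R).

Definition leading (m : int) (p : A) : Prop :=
  p m = 1 /\ forall n, (mono_rank m < mono_rank n)%N -> p n = 0.

Definition in_span2 (p1 p2 p : A) : Prop :=
  exists c1 c2 : C, p = c1 *: p1 + c2 *: p2.

Variable t : params R.

Definition isP (m : int) : A -> Prop :=
  unique (fun p => leading m p /\ Y t p = gam t m *: p).

Variable P : int -> A.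

Definition isPplus (m : nat) : A -> Prop :=
  unique (fun p => [/\ in_span2 (P m%:Z) (P (- m%:Z)) p, leading m%:Z p
                     & T1 t p = k1 t *: p]).

Definition isPminus (m : nat) : A -> Prop :=
  unique (fun p => [/\ in_span2 (P m%:Z) (P (- m%:Z)) p, leading m%:Z p
                     & T1 t p = - (k1 t)^-1 *: p]).

End Polynomials.

Section QPochhammer.
Variable R : realType.
Local Notation C := R[i].

Definition qpoch (y q : C) : C := limn (fun n => \prod_(j < n) (1 - y * q ^+ j)).

Definition qpochs (ys : seq C) (q : C) : C := \prod_(y <- ys) qpoch y q.

End QPochhammer.

(* Closed curves are parametrised by [0, 1]; the values of [g] outside [0, 1]
   are irrelevant. *)
Section Curves.
Variable R : realType.
Local Notation C := R[i].
Variable g : R -> C.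

Definition jordan_curve : Prop :=
  [/\ {within `[0, 1], continuous g}, g 0 = g 1
    & forall s u : R, 0 <= s < 1 -> 0 <= u < 1 -> g s = g u -> s = u].

(* A partition 0 < s_0 < ... < s_n = 1 is listed without its first point 0. *)
Definition rectifiable : Prop :=
  exists L : R, forall s : seq R, itv_partition 0 1 s ->
    \sum_(i < size s) `|g (nth 0 s i) - g (nth 0 (0 :: s) i)| <= L%:C.

(* The integral of F along g, as a limit of Riemann-Stieltjes sums. *)
Definition is_contour_integral (F : C -> C) (v : C) : Prop :=
  forall e : R, 0 < e -> exists2 d : R, 0 < d &
    forall (s : seq R) (xi : nat -> R), itv_partition 0 1 s ->
      (forall i, (i < size s)%N ->
         nth 0 s i - nth 0 (0 :: s) i < d /\
         nth 0 (0 :: s) i <= xi i <= nth 0 s i) ->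
      `|\sum_(i < size s)
          F (g (xi i)) * (g (nth 0 s i) - g (nth 0 (0 :: s) i)) - v| < e%:C.

Definition curve_image : set C := g @` `[0, 1].

Definition interior_pt (z : C) : Prop :=
  ~ curve_image z /\ bounded_set (connected_component (~` curve_image) z).

Definition exterior_pt (z : C) : Prop :=
  ~ curve_image z /\ ~ bounded_set (connected_component (~` curve_image) z).

Definition two_pi_i : C := 2 * (pi : R)%:C * 'i.

Definition counterclockwise : Prop :=
  forall z, interior_pt z -> is_contour_integral (fun x => (x - z)^-1) two_pi_i.

End Curves.

Section Forms.
Variable R : realType.
Local Notation C := R[i].
Local Notation A := (laurent R).
Variable t : params R.

Local Notation q := (pq t).
Local Notation a := (pa t).
Local Notation b := (pb t).
Local Notation c := (pc t).
Local Notation d := (pd t).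

Definition Delta_plus (x : C) : C :=
  qpochs [:: x ^+ 2; x ^- 2] q /
  qpochs [:: a * x; a / x; b * x; b / x; c * x; c / x; d * x; d / x] q.

(* At x = 1 and x = -1 both the quotient below and the removable singularity it
   stands for have value 0, since Delta_plus has a double zero there. *)
Definition Delta (x : C) : C :=
  (1 - a / x) * (1 - b / x) / (1 - x ^- 2) * Delta_plus x.

(* The integrands have an essential singularity at 0, so 0 is kept off the
   curve (and then lies inside it, as a limit of the a q^k). *)
Definition admissible (g : R -> C) : Prop :=
  [/\ jordan_curve g, rectifiable g, counterclockwise g, ~ curve_image g 0
    & forall e, e \in [:: a; b; c; d] -> forall k : nat,
        interior_pt g (e * q ^+ k) /\ exterior_pt g (e^-1 * q ^- k)].

(* [is_form W g f h v]: the integral defining the bilinear form with weight [W]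
   at [(f, h)] exists and the form has value [v]. *)
Definition is_form (W : C -> C) (g : R -> C) (f h : A) (v : C) : Prop :=
  exists2 I : C,
    is_contour_integral g (fun x => leval f x * leval h x^-1 * W x / x) I
    & v = (two_pi_i R)^-1 * I.

End Forms.

(* Main.v *)
(* Write Delta_+ = (1 - x^2) (1 - x^-2) rho. Poles occur in pairs (p, s/p), one inside
   and one outside the curve, so the integral of a function of x against a weight
   symmetric under x -> s/x may be reflected by winding numbers alone, without deforming
   the curve. For s = 1 this symmetrises the functional F |-> int rho F dx/x, and for s = q
   it gives elements of its kernel. One such element is a first-order recurrence of the
   Askey-Wilson integral in a; letting a, b, c, d tend to 0 along q^n leaves the constant
   term of a theta function.

   The moments of the products (ax, a/x)_i (bx, b/x)_j are Askey-Wilson integrals with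
   shifted parameters, and the norm of a monic orthogonal polynomial in x + 1/x follows
   by expanding in these products and using q-differences.

   T0 and T1 are isometries for the form with weight Delta, so the P_m and the P'_m are
   biorthogonal. A Laurent polynomial is p + e s with p, s symmetric and
   e = x^-1 (1 - ax) (1 - bx), which are the eigenfunctions of T1. The form is diagonal in
   this decomposition: up to constants it is the symmetric form with parameters
   (a, b, c, d) on p and the one with (aq, bq, c, d) on s. Thus P_m^+ and P_m^- are
   Askey-Wilson polynomials of degrees m and m - 1, and the norms of P_m and P_{-m} are
   rational expressions in those of P_m^+ and P_m^-. *)
Require Import Defs.
From mathcomp Require Import all_boot all_order all_algebra.
From mathcomp Require Import all_classical all_reals all_analysis.
From mathcomp.real_closed Require Import complex.
From mathcomp Require Import finmap ring lra zify.

Set Implicit Arguments.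
Unset Strict Implicit.
Unset Printing Implicit Defensive.

Import Order.TTheory GRing.Theory Num.Theory.
Import numFieldNormedType.Exports.
Import Normc.

Local Open Scope classical_set_scope.
Local Open Scope ring_scope.
Local Open Scope complex_scope.

(** The curve is an arbitrary rectifiable Jordan curve, and no residue theorem is used. Truncating
    the infinite products leaves rational functions; in their partial fractions every pole of order
    at least two contributes an exact term and every simple pole a winding number, and the limit is
    uniform on the curve. Winding numbers inside the curve are part of its orientation; those
    outside vanish by connectedness.

    The genericity conditions concern products of two parameters only. That abcd q^j differs from 1
    for j >= 0, on which the divisions by factors in abcd rest, comes from the uniqueness of the
    P_m: otherwise two eigenvalues of Y would coincide.

    P_m and P_(-m) are not eigenfunctions of T1, so each has both a symmetric and an antisymmetric
    part. The leading coefficients of these parts follow from the coefficients of x^m and x^(-m),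
    except that for P_m one equation is replaced by biorthogonality to P'_(-m). The determinant of
    the resulting system is a combination of the two norms, which is nonzero because its numerator
    factors. *)

(** * Real-valued modulus and limits of complex sequences *)

Section ComplexModulus.
Variable R : realType.
Local Notation C := R[i].
Implicit Types x y z : C.

Lemma normcE x : `|x| = (normc x)%:C.
Proof. by []. Qed.

Lemma normc_ge0 x : 0 <= normc x.
Proof. by case: x => a b; exact: sqrtr_ge0. Qed.

Lemma normc_eq0 x : (normc x == 0) = (x == 0).
Proof. by apply/eqP/eqP => [/eq0_normc|->]; rewrite ?normc0. Qed.

Lemma normc_gt0 x : (0 < normc x) = (x != 0).
Proof. by rewrite lt_def normc_ge0 andbT normc_eq0. Qed.

Lemma ler_normcD x y : normc (x + y) <= normc x + normc y.
Proof. exact: le_normcD. Qed.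

Lemma normcB x y : normc (x - y) = normc (y - x).
Proof. by rewrite -normcN opprB. Qed.

Lemma ler_normcB x y : normc (x - y) <= normc x + normc y.
Proof. by rewrite (le_trans (ler_normcD _ _))// normcN. Qed.

Lemma ler_normc_dist z x y : normc (x - y) <= normc (x - z) + normc (z - y).
Proof. by have := ler_normcD (x - z) (z - y); rewrite addrA subrK. Qed.

Lemma lerB_normc x y : normc x - normc y <= normc (x - y).
Proof. by rewrite lerBlDr -{1}(subrK y x) ler_normcD. Qed.

Lemma normcX x n : normc (x ^+ n) = normc x ^+ n.
Proof. by elim: n => [|n ih]; rewrite ?expr0 ?normc1// !exprS normcM ih. Qed.

Lemma normc_sum (I : Type) (s : seq I) (F : I -> C) :
  normc (\sum_(i <- s) F i) <= \sum_(i <- s) normc (F i).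
Proof.
elim: s => [|i s ih]; first by rewrite !big_nil normc0.
by rewrite !big_cons (le_trans (ler_normcD _ _))// lerD2l.
Qed.

Lemma normc_Re x : `|complex.Re x| <= normc x.
Proof.
case: x => a b /=; rewrite -sqrtr_sqr ler_sqrt ?addr_ge0 ?sqr_ge0//.
by rewrite lerDl sqr_ge0.
Qed.

Lemma normc_Im x : `|complex.Im x| <= normc x.
Proof.
case: x => a b /=; rewrite -sqrtr_sqr ler_sqrt ?addr_ge0 ?sqr_ge0//.
by rewrite lerDr sqr_ge0.
Qed.

Lemma normc_ReIm x : normc x <= `|complex.Re x| + `|complex.Im x|.
Proof.
have {1}-> : x = (complex.Re x)%:C + 'i%C * (complex.Im x)%:C.
  exact: complexE.
rewrite (le_trans (ler_normcD _ _))// normcM.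
have normcR (r : R) : normc r%:C = `|r| by rewrite /= expr0n addr0 sqrtr_sqr.
by rewrite !normcR /= expr0n add0r expr1n sqrtr1 mul1r.
Qed.

Lemma normcR (r : R) : normc r%:C = `|r|.
Proof. by rewrite /= expr0n addr0 sqrtr_sqr. Qed.

(** Convergence with real radii. The norm of [R[i]] takes its values in [R[i]]; with [normc] all
    estimates are inequalities in R, within reach of linear arithmetic. *)
Definition cconv (u : nat -> C) (l : C) : Prop :=
  forall e : R, 0 < e -> exists N, forall n, (N <= n)%N -> normc (u n - l) < e.

Lemma cconv_cvg u l : cconv u l -> u @ \oo --> l.
Proof.
move=> ul; apply/cvgrPdist_lt => e e0.
have eE : e = (complex.Re e)%:C.
  by apply/esym/RRe_real; rewrite realE (ltW e0).
have /ul [N uN] : 0 < complex.Re e by rewrite -ltcR -eE.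
exists N => // n /= Nn; rewrite normcE eE ltcR normcB; exact: uN.
Qed.

Lemma cconv_lim u l : cconv u l -> limn u = l.
Proof. by move=> /cconv_cvg; exact: (@cvg_lim _ (@norm_hausdorff _ _)). Qed.

Lemma cconv_uniq u l l' : cconv u l -> cconv u l' -> l = l'.
Proof. by move=> /cconv_lim <- /cconv_lim <-. Qed.

Lemma ccomplete (u : nat -> C) :
  (forall e : R, 0 < e -> exists N, forall m n, (N <= m)%N -> (N <= n)%N ->
     normc (u m - u n) < e) -> exists l, cconv u l.
Proof.
move=> uC.
(* Real and imaginary part are both additive and bounded by the modulus, so one argument serves for
   the two. *)
have real_part (f : C -> R) : (forall x y, f (x - y) = f x - f y) ->
    (forall x, `|f x| <= normc x) ->
    exists l, forall e : R, 0 < e -> exists N, forall n, (N <= n)%N ->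
      `|f (u n) - l| < e.
  move=> fB fn.
  have /cvgrPdist_lt H : cvgn (f \o u).
    apply/cauchy_cvgP/cauchy_ballP => e e0.
    have [N uN] := uC e e0.
    pose A := [set f (u n) | n in [set n | (N <= n)%N]].
    exists (A, A); first by split; exists N => // n Nn; exists n.
    by move=> [? ?] /= [[m Nm <-] [n Nn <-]]; rewrite /ball/= -fB (le_lt_trans (fn _)) ?uN.
  exists (limn (f \o u)) => e /H [N _ NH].
  by exists N => n Nn; rewrite distrC; exact: NH.
have [||r rP] := real_part (@complex.Re R); [by case=> ? ? [] | exact: normc_Re|].
have [||i iP] := real_part (@complex.Im R); [by case=> ? ? [] | exact: normc_Im|].
exists (r +i* i) => e e0.
have e20 : 0 < e / 2 by rewrite divr_gt0.
have [N1 H1] := rP _ e20; have [N2 H2] := iP _ e20.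
exists (maxn N1 N2) => n; rewrite geq_max => /andP[n1 n2].
rewrite (le_lt_trans (normc_ReIm _))// [e]splitr ltrD//.
  by have := H1 n n1; case: (u n).
by have := H2 n n2; case: (u n).
Qed.

End ComplexModulus.

(** * Uniform estimates on a continuous curve *)

Section Curve.
Variable R : realType.
Local Notation C := R[i].

(** Compactness of [0, 1], in the form needed three times below: a scale [d] that works near each
    point can be chosen independently of the point. *)
Lemma unit_itv_uniform (P : R -> R -> Prop) :
  (forall x : R, 0 <= x <= 1 -> exists2 e : R, 0 < e &
     forall d y : R, 0 < d < e -> 0 <= y <= 1 -> `|y - x| < e -> P d y) ->
  exists2 d : R, 0 < d & forall x : R, 0 <= x <= 1 -> P d x.
Proof.
move=> Ploc.
have /compact_near_coveringP := @segment_compact R 0 1.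
move=> /(_ R (0^'+) (fun d y => 0 <= y <= 1 -> P d y)) H.
have {H} : \forall d \near 0^'+, `[0, 1]%classic `<=` (fun y => 0 <= y <= 1 -> P d y).
  apply: H => x /=; rewrite in_itv/= => /Ploc[e e0 He].
  exists (ball x e, [set d | 0 < d < e]); first split.
  - exact: nbhsx_ballx.
  - by near=> d; apply/andP; split.
  - move=> [y d] /= [xy de] y01; apply: He => //.
    by rewrite distrC.
move=> H; near (0 : R)^'+ => d; exists d => // x x01.
have : `[0, 1]%classic `<=` (fun y => 0 <= y <= 1 -> P d y) by near: d.
by apply => //=; rewrite in_itv.
Unshelve. all: by end_near. Qed.

Section Continuous.
Variable g : R -> C.
Hypothesis gc : {within `[0, 1], continuous g}.

Lemma curve_cont (x e : R) : 0 <= x <= 1 -> 0 < e ->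
  exists2 d : R, 0 < d & forall y, 0 <= y <= 1 -> `|y - x| < d ->
    normc (g y - g x) < e.
Proof.
move=> x01 e0.
have /subspace_continuousP/(_ x) := gc.
rewrite /= in_itv/= => /(_ x01) /cvgrPdist_lt/(_ e%:C).
rewrite ltcR => /(_ e0); rewrite near_withinE => /nbhs_ballP[d /= d0 H].
exists d => // y y01 yx.
have := H y; rewrite /ball/= distrC => /(_ yx); rewrite in_itv/= => /(_ y01).
by rewrite normcE ltcR normcB.
Qed.

Lemma curve_unif (e : R) : 0 < e -> exists2 d : R, 0 < d &
  forall x y, 0 <= x <= 1 -> 0 <= y <= 1 -> `|y - x| < d ->
    normc (g y - g x) < e.
Proof.
move=> e0.
have [|d d0 H] := @unit_itv_uniform (fun d x => forall y, 0 <= y <= 1 ->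
  `|y - x| < d -> normc (g y - g x) < e); last by exists d => // x y x01; exact: H.
move=> x x01; have [d d0 H] := curve_cont x01 (divr_gt0 e0 (ltr0n _ 2)).
exists (d / 2) => [|r y /andP[r0 rd] y01 yx z z01 zy]; first by rewrite divr_gt0.
rewrite (le_lt_trans (ler_normc_dist (g x) _ _))// [e]splitr ltrD//.
  apply: H => //; rewrite (le_lt_trans (ler_distD y _ _))// [d]splitr ltrD//.
  exact: lt_trans rd.
by rewrite normcB H// (lt_trans yx)// ltr_pdivrMr// ltr_pMr// ltr1n.
Qed.

Lemma curve_bounded : exists2 B : R, 0 < B & forall x, 0 <= x <= 1 -> normc (g x) <= B.
Proof.
(* The bound is sought as an inverse scale, so that it weakens as [d] decreases. *)
have [|d d0 H] := @unit_itv_uniform (fun d x => normc (g x) <= d^-1); last first.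
  by exists d^-1; rewrite ?invr_gt0.
move=> x x01; have [d d0 H] := curve_cont x01 ltr01.
have B0 : 0 < normc (g x) + 1 by rewrite ltr_wpDl// normc_ge0.
exists (Num.min d (normc (g x) + 1)^-1) => [|r y /andP[r0]].
  by rewrite lt_min d0 invr_gt0.
rewrite !lt_min => /andP[rd rB] y01 /andP[yd _].
have {}rB : normc (g x) + 1 < r^-1.
  by rewrite -[ltLHS]invrK ltf_pV2 // posrE invr_gt0.
apply: (le_trans _ (ltW rB)).
by rewrite -lerBlDl (le_trans (lerB_normc _ _))// ltW// H.
Qed.

Lemma curve_dist (z : C) : ~ curve_image g z ->
  exists2 d : R, 0 < d & forall x, 0 <= x <= 1 -> d <= normc (g x - z).
Proof.
move=> zK; apply: unit_itv_uniform => x x01.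
have n0 : 0 < normc (g x - z) / 2.
  rewrite divr_gt0// normc_gt0 subr_eq0; apply/eqP => gxz; apply: zK.
  by exists x => //=; rewrite in_itv.
have [d d0 H] := curve_cont x01 n0.
exists (Num.min d (normc (g x - z) / 2)) => [|r y /andP[r0]].
  by rewrite lt_min d0.
rewrite !lt_min => /andP[rd rB] y01 /andP[yd _].
have := H y y01 yd; have := ler_normc_dist (g y) (g x) z.
rewrite (normcB (g x) (g y)); move: rB; lra.
Qed.

End Continuous.
End Curve.

(** * Contour integrals *)

Section ContourIntegral.
Variable R : realType.
Local Notation C := R[i].

Lemma itv_partition_left (s : seq R) i : itv_partition 0 1 s -> (i < size s)%N ->
  0 <= nth 0 (0 :: s) i <= 1.
Proof.
move=> sP si; have si' : (i < (size s).+1)%N by rewrite ltnS ltnW.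
rewrite (set_nth_default 1)//; apply/andP; split.
  exact: itv_partition_nth_ge sP.
exact: itv_partition_nth_le sP.
Qed.

Lemma itv_partition_right (s : seq R) i : itv_partition 0 1 s -> (i < size s)%N ->
  0 <= nth 0 s i <= 1.
Proof.
move=> sP si; rewrite -[nth 0 s i]/(nth 0 (0 :: s) i.+1).
have si' : (i.+1 < (size s).+1)%N by [].
rewrite (set_nth_default 1)//; apply/andP; split.
  exact: itv_partition_nth_ge sP.
exact: itv_partition_nth_le sP.
Qed.

(** Without partitions of arbitrarily small mesh [is_contour_integral] would hold vacuously. They
    give the bound of an integral by the length, and through it uniqueness. *)
Lemma fine_partition (d : R) : 0 < d -> exists (s : seq R) (xi : nat -> R),
  itv_partition 0 1 s /\ forall i, (i < size s)%N ->
    nth 0 s i - nth 0 (0 :: s) i < d /\ nth 0 (0 :: s) i <= xi i <= nth 0 s i.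
Proof.
move=> d0; pose n := (Num.trunc d^-1).+1.
have n0 : 0 < n%:R :> R by rewrite ltr0n.
have nd : n%:R^-1 < d.
  rewrite invf_plt ?posrE//; apply: truncnS_gt.
pose u (i : nat) : R := i%:R / n%:R.
have E i : (i < n)%N -> nth 0 (0 :: mkseq (u \o S) n) i = u i.
  by case: i => [|i] ni /=; rewrite ?/u ?mul0r// nth_mkseq// ltnW.
have E1 i : (i < n)%N -> nth 0 (mkseq (u \o S) n) i = u i.+1.
  by move=> ni; rewrite nth_mkseq.
have ud i : u i.+1 - u i = n%:R^-1 by rewrite /u -mulrBl -natrB// subSnn mul1r.
have ult i : u i < u i.+1 by rewrite -subr_gt0 ud invr_gt0.
exists (mkseq (u \o S) n), u; split; last first.
  move=> i; rewrite size_mkseq => ni; rewrite E// E1// ud; split => //.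
  by rewrite lexx ltW.
split.
  apply/(pathP 0) => i; rewrite size_mkseq => ni; rewrite E1// E//; exact: ult.
by rewrite (last_nth 0) size_mkseq -[nth _ _ n]/(nth 0 (mkseq (u \o S) n) n.-1) E1// /u divff ?lt0r_neq0//=.
Qed.

Variable g : R -> C.

Definition on_curve (P : C -> Prop) := forall t : R, 0 <= t <= 1 -> P (g t).

Definition rsum (F : C -> C) (s : seq R) (xi : nat -> R) : C :=
  \sum_(i < size s) F (g (xi i)) * (g (nth 0 s i) - g (nth 0 (0 :: s) i)).

Variable L : R.
Hypothesis gL : forall s : seq R, itv_partition 0 1 s ->
  \sum_(i < size s) normc (g (nth 0 s i) - g (nth 0 (0 :: s) i)) <= L.

Lemma length_ge0 : 0 <= L.
Proof.
have [s [xi [/gL sL _]]] := fine_partition ltr01.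
by rewrite (le_trans _ sL)// sumr_ge0// => i _; exact: normc_ge0.
Qed.

Local Notation CInt := (is_contour_integral g).

Definition tags (d : R) (s : seq R) (xi : nat -> R) := forall i, (i < size s)%N ->
    nth 0 s i - nth 0 (0 :: s) i < d /\ nth 0 (0 :: s) i <= xi i <= nth 0 s i.

Lemma CIntP F v : CInt F v <-> forall e : R, 0 < e -> exists2 d : R, 0 < d &
  forall s xi, itv_partition 0 1 s -> tags d s xi -> normc (rsum F s xi - v) < e.
Proof.
by split=> H e /H[d d0 Hd]; exists d => // s xi sp sx; have := Hd s xi sp sx;
  rewrite normcE ltcR.
Qed.

Lemma tags_in d s xi i : itv_partition 0 1 s -> tags d s xi -> (i < size s)%N ->
  0 <= xi i <= 1.
Proof.
move=> sp sx si; have [_ /andP[l r]] := sx i si.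
have /andP[l0 _] := itv_partition_left sp si.
have /andP[_ r1] := itv_partition_right sp si.
by rewrite (le_trans l0)// (le_trans r).
Qed.

Lemma rsum_bound F M d s xi : itv_partition 0 1 s -> tags d s xi -> 0 <= M ->
  on_curve (fun x => normc (F x) <= M) -> normc (rsum F s xi) <= M * L.
Proof.
move=> sp sx M0 FM; apply: (le_trans (normc_sum _ _)).
apply: (le_trans _ (ler_wpM2l M0 (gL sp))); rewrite mulr_sumr ler_sum// => i _.
by rewrite normcM ler_wpM2r ?normc_ge0// FM// (tags_in sp sx).
Qed.

Lemma CInt_ext F G v : on_curve (fun x => F x = G x) -> CInt F v -> CInt G v.
Proof.
move=> FG /CIntP FI; apply/CIntP => e /FI[d d0 Hd]; exists d => // s xi sp sx.
suff -> : rsum G s xi = rsum F s xi by exact: Hd.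
by apply: eq_bigr => i _; rewrite FG// (tags_in sp sx).
Qed.

Lemma CInt_lin c F G u v : CInt F u -> CInt G v ->
  CInt (fun x => c * F x + G x) (c * u + v).
Proof.
move=> /CIntP FI /CIntP GI; apply/CIntP => e e0.
have c0 : 0 < 2 * (normc c + 1) by rewrite mulr_gt0// ltr_wpDl ?normc_ge0.
have [d1 d10 H1] := FI _ (divr_gt0 e0 c0).
have [d2 d20 H2] := GI _ (divr_gt0 e0 (ltr0n _ 2)).
exists (Num.min d1 d2); first by rewrite lt_min d10.
move=> s xi sp sx.
have -> : rsum (fun x => c * F x + G x) s xi - (c * u + v) =
    c * (rsum F s xi - u) + (rsum G s xi - v).
  suff -> : rsum (fun x => c * F x + G x) s xi = c * rsum F s xi + rsum G s xi by ring.
  by rewrite /rsum mulr_sumr -big_split/=; apply: eq_bigr => i _; ring.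
have /H1-/(_ sp) h1 : tags d1 s xi.
  by move=> i /sx[]; rewrite lt_min => /andP[].
have /H2-/(_ sp) h2 : tags d2 s xi.
  by move=> i /sx[]; rewrite lt_min => /andP[].
rewrite (le_lt_trans (ler_normcD _ _))// [e]splitr ler_ltD// normcM.
apply: (le_trans (ler_wpM2l (normc_ge0 _) (ltW h1))).
have k0 : 0 < normc c + 1 by rewrite ltr_wpDl ?normc_ge0.
rewrite (_ : _ * _ = (e / 2) * (normc c / (normc c + 1))); last first.
  by field; rewrite lt0r_neq0.
rewrite ler_piMr//; first by rewrite ltW// divr_gt0.
by rewrite ler_pdivrMr// mul1r lerDl.
Qed.

Lemma CInt_bound F v M : 0 <= M -> CInt F v ->
  on_curve (fun x => normc (F x) <= M) -> normc v <= M * L.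
Proof.
move=> M0 /CIntP FI FM; apply/ler_addgt0Pr => e /FI[d /fine_partition[s [xi [sp sx]]] Hd].
have := Hd s xi sp sx; have := rsum_bound sp sx M0 FM.
have := ler_normcB (rsum F s xi) (rsum F s xi - v).
by rewrite (_ : _ - (_ - v) = v); [lra|ring].
Qed.

Lemma CInt0 : CInt (fun=> 0) 0.
Proof.
apply/CIntP => e e0; exists 1 => // s xi _ _.
by rewrite /rsum big1 ?subrr ?normc0// => i _; rewrite mul0r.
Qed.

Lemma CIntZ c F u : CInt F u -> CInt (fun x => c * F x) (c * u).
Proof.
move=> FI; have := CInt_lin c FI CInt0; rewrite addr0.
by apply: CInt_ext => t _; rewrite addr0.
Qed.

Lemma CIntD F G u v : CInt F u -> CInt G v -> CInt (fun x => F x + G x) (u + v).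
Proof.
move=> FI GI; have := CInt_lin 1 FI GI; rewrite mul1r.
by apply: CInt_ext => t _; rewrite mul1r.
Qed.

Lemma CInt_uniq F u v : CInt F u -> CInt F v -> u = v.
Proof.
move=> Fu Fv; have := CInt_lin (-1) Fu Fv => /(CInt_bound (lexx 0)) H.
have {H} : normc (-1 * u + v) <= 0.
  by rewrite -[leRHS](mul0r L) H// => t _; rewrite mulN1r addNr normc0.
move=> H; have := normc_ge0 (-1 * u + v) => H'.
have /eqP : normc (-1 * u + v) == 0 by rewrite eq_le H H'.
by move/eq0_normc; rewrite mulN1r addrC => /eqP; rewrite subr_eq0 => /eqP.
Qed.

Definition uconv (F : nat -> C -> C) (G : C -> C) := forall e : R, 0 < e ->
  exists N, forall n, (N <= n)%N -> on_curve (fun x => normc (F n x - G x) <= e).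

(** Integrability of the limit is a conclusion: the values [v n] are Cauchy by the length bound, and
    the Riemann sums of [G] stay close to those of [F n] uniformly over all partitions. *)
Lemma CInt_uconv F G v : (forall n, CInt (F n) (v n)) -> uconv F G ->
  exists2 w, CInt G w & cconv v w.
Proof.
move=> FI FG; have L0 := length_ge0.
have LE (e : R) : 0 < e -> 0 < e / (L + 1) by move=> e0; rewrite divr_gt0// ltr_wpDl.
have LE' (e : R) : 0 < e -> e / (L + 1) * L <= e.
  move=> e0; rewrite -mulrA ler_piMr//; first exact: ltW.
  by rewrite mulrC ler_pdivrMr ?ltr_wpDl// mul1r lerDl.
have [w vw] : exists w, cconv v w.
  apply: ccomplete => e e0; have e40 : 0 < e / 4 by rewrite divr_gt0.
  have [N HN] := FG _ (LE _ e40); exists N => m n Nm Nn.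
  have M0 : 0 <= e / 4 / (L + 1) + e / 4 / (L + 1) by rewrite addr_ge0// ltW// LE.
  have := CInt_lin (-1) (FI n) (FI m); rewrite mulN1r (addrC _ (v m)).
  move=> /(CInt_bound M0) H; apply: (le_lt_trans (H _)) => [t t01|].
    rewrite (_ : -1 * _ + _ = (F m (g t) - G (g t)) - (F n (g t) - G (g t))).
      by rewrite (le_trans (ler_normcB _ _))// lerD// HN.
    by ring.
  by rewrite mulrDl; have := LE' _ e40; lra.
exists w => //; apply/CIntP => e e0; have e40 : 0 < e / 4 by rewrite divr_gt0.
have [N1 H1] := FG _ (LE _ e40); have [N2 H2] := vw _ e40.
pose n := maxn N1 N2; have {}H1 := H1 n (leq_maxl _ _).
have {}H2 := H2 n (leq_maxr _ _).
have /CIntP/(_ _ e40)[d d0 Hd] := FI n; exists d => // s xi sp sx.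
have {}Hd := Hd s xi sp sx.
have HB := rsum_bound (F := fun x => F n x - G x) sp sx (ltW (LE _ e40)) H1.
have E : rsum (fun x => F n x - G x) s xi = rsum (F n) s xi - rsum G s xi.
  by rewrite /rsum -sumrB; apply: eq_bigr => i _; rewrite mulrBl.
rewrite E in HB.
have -> : rsum G s xi - w = (rsum (F n) s xi - v n) + (v n - w) - (rsum (F n) s xi - rsum G s xi).
  by ring.
have := ler_normcB (rsum (F n) s xi - v n + (v n - w)) (rsum (F n) s xi - rsum G s xi).
have := ler_normcD (rsum (F n) s xi - v n) (v n - w).
have := LE' _ e40; lra.
Qed.

End ContourIntegral.

(** * q-shifted factorials and Laurent polynomials *)

Section QPoch.
Variable R : realType.
Local Notation C := R[i].
Variable q : C.
Hypothesis q1 : normc q < 1.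
Local Notation r := (normc q).

Definition fpoch (n : nat) (y : C) : C := \prod_(j < n) (1 - y * q ^+ j).

Lemma fpoch0 y : fpoch 0 y = 1.
Proof. by rewrite /fpoch big_ord0. Qed.

Lemma fpochS n y : fpoch n.+1 y = fpoch n y * (1 - y * q ^+ n).
Proof. by rewrite /fpoch big_ord_recr. Qed.

Lemma fpochSl n y : fpoch n.+1 y = (1 - y) * fpoch n (y * q).
Proof.
rewrite /fpoch big_ord_recl expr0 mulr1; congr (_ * _).
by apply: eq_bigr => i _; rewrite -mulrA -exprS.
Qed.

Lemma fpochD m n y : fpoch (m + n) y = fpoch m y * fpoch n (y * q ^+ m).
Proof.
elim: m y => [|m ih] y; first by rewrite fpoch0 mul1r expr0 mulr1.
by rewrite addSn !fpochSl ih mulrA exprS mulrA.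
Qed.

Let bd (Y : R) := expR (Y / (1 - r)).

Let r1 : 0 < 1 - r. Proof. by rewrite subr_gt0. Qed.

Let r1i : 0 <= (1 - r)^-1. Proof. by rewrite invr_ge0 ltW. Qed.

Let bd0 Y : 0 <= bd Y. Proof. exact: expR_ge0. Qed.

(** Each factor is at most 1 + Y r^j <= exp(Y r^j), and the exponents form a geometric series. The
    bound is uniform in [n] and in [y]. *)
Lemma fpoch_bound Y n y : normc y <= Y -> normc (fpoch n y) <= bd Y.
Proof.
move=> yY; have Y0 : 0 <= Y by apply: le_trans yY; exact: normc_ge0.
have H : normc (fpoch n y) <= expR (Y * (\sum_(j < n) r ^+ j)).
  elim: n => [|n ih]; first by rewrite fpoch0 big_ord0 mulr0 expR0 normc1.
  rewrite fpochS big_ord_recr/= [Y * _]mulrDr expRD normcM ler_pM ?normc_ge0//.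
  apply: (@le_trans _ _ (1 + Y * r ^+ n)); last exact: expR_ge1Dx.
  rewrite (le_trans (ler_normcB _ _))// normc1 lerD2l normcM normcX.
  by rewrite ler_wpM2r// exprn_ge0// normc_ge0.
apply: (le_trans H); rewrite /bd ler_expR ler_wpM2l//.
have := subrX1 r n => E.
have -> : \sum_(j < n) r ^+ j = (1 - r ^+ n) / (1 - r).
  rewrite -opprB E; field; exact: lt0r_neq0.
rewrite -[leRHS]mul1r ler_wpM2r//.
by rewrite gerBl exprn_ge0// normc_ge0.
Qed.

Lemma fpoch_cauchy Y m n y : normc y <= Y ->
  normc (fpoch (n + m) y - fpoch n y) <= bd Y / (1 - r) * normc y * r ^+ n.
Proof.
move=> yY.
(* The stronger bound with r^n - r^(n + m) makes the induction on [m] telescope. *)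
have H : normc (fpoch (n + m) y - fpoch n y) <=
    bd Y / (1 - r) * normc y * (r ^+ n - r ^+ (n + m)).
  elim: m => [|m ih]; first by rewrite addn0 !subrr normc0 mulr0.
  apply: (le_trans (ler_normc_dist (fpoch (n + m) y) _ _)).
  apply: (le_trans (lerD (lexx _) ih)).
  rewrite addnS fpochS (_ : _ * _ - _ = - (fpoch (n + m) y * (y * q ^+ (n + m)))); last by ring.
  rewrite normcN !normcM normcX.
  apply: (@le_trans _ _ (bd Y * (normc y * r ^+ (n + m)) +
    bd Y / (1 - r) * normc y * (r ^+ n - r ^+ (n + m)))).
    by rewrite lerD2r ler_wpM2r ?fpoch_bound// mulr_ge0 ?exprn_ge0// normc_ge0.
  rewrite le_eqVlt; apply/orP; left; apply/eqP; rewrite [in RHS]exprS.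
  by field; exact: lt0r_neq0.
apply: (le_trans H); rewrite ler_wpM2l//.
  by rewrite !mulr_ge0 ?normc_ge0.
by rewrite gerBl exprn_ge0// normc_ge0.
Qed.

Lemma geometric_small (B e : R) : 0 < e -> exists N, forall n, (N <= n)%N -> B * r ^+ n <= e.
Proof.
move=> e0.
have Be0 : 0 < e / (`|B| + 1) by rewrite divr_gt0// ltr_wpDl.
have h : `|r| < 1 by rewrite ger0_norm// normc_ge0.
have /cvgrPdist_lt/(_ _ Be0)[N _ HN] := cvg_expr h.
exists N => n /HN; rewrite sub0r normrN ger0_norm ?exprn_ge0 ?normc_ge0// => H.
apply: (@le_trans _ _ (`|B| * r ^+ n)).
  by rewrite ler_wpM2r ?ler_norm// exprn_ge0 ?normc_ge0.
apply: (le_trans (ler_wpM2l (normr_ge0 B) (ltW H))).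
rewrite mulrCA ler_piMr//; first exact: ltW.
by rewrite ler_pdivrMr ?ltr_wpDl// mul1r lerDl.
Qed.

Lemma qpoch_conv y : cconv (fun n => fpoch n y) (qpoch y q).
Proof.
suff [l Hl] : exists l, cconv (fun n => fpoch n y) l.
  by rewrite /qpoch (cconv_lim Hl).
apply: ccomplete => e e0.
have e20 : 0 < e / 3 by rewrite divr_gt0.
have [N HN] := geometric_small (bd (normc y) / (1 - r) * normc y) e20.
exists N => m n Nm Nn.
have h k : (N <= k)%N -> normc (fpoch k y - fpoch N y) <= e / 3.
  move=> Nk; rewrite -(subnKC Nk); apply: le_trans (HN N (leqnn _)).
  exact: fpoch_cauchy.
have := h _ Nm; have := h _ Nn; rewrite (normcB (fpoch n y)).
have := ler_normc_dist (fpoch N y) (fpoch m y) (fpoch n y); move: e0; lra.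
Qed.

Lemma cconv_le u (l : C) z M : cconv u l -> (forall n, normc (u n - z) <= M) -> normc (l - z) <= M.
Proof.
move=> ul uM; apply/ler_addgt0Pr => e e0; have [N HN] := ul _ e0.
have := HN N (leqnn _); rewrite normcB; have := uM N; have := ler_normc_dist (u N) l z.
lra.
Qed.

Lemma qpoch_err Y n y : normc y <= Y ->
  normc (fpoch n y - qpoch y q) <= bd Y / (1 - r) * normc y * r ^+ n.
Proof.
move=> yY; rewrite normcB.
apply: (@cconv_le (fun m => fpoch (n + m) y)) => [e e0|m]; last exact: fpoch_cauchy.
have [N HN] := qpoch_conv y e0; exists N => m Nm; apply: HN.
by rewrite (leq_trans Nm)// leq_addl.
Qed.

Lemma qpochS y : qpoch y q = (1 - y) * qpoch (y * q) q.
Proof.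
apply: (@cconv_uniq _ (fun n => fpoch n.+1 y)) => e e0.
  have [N HN] := qpoch_conv y e0; exists N => n Nn; apply: HN.
  by rewrite (leq_trans Nn).
have k0 : 0 < normc (1 - y) + 1 by rewrite ltr_wpDl ?normc_ge0.
have [N HN] := qpoch_conv (y * q) (divr_gt0 e0 k0); exists N => n Nn.
rewrite fpochSl -mulrBr normcM.
apply: (@le_lt_trans _ _ ((normc (1 - y)) * (e / (normc (1 - y) + 1)))).
  by rewrite ler_wpM2l ?normc_ge0// ltW// HN.
by rewrite mulrCA gtr_pMr// ltr_pdivrMr// mul1r ltrDl.
Qed.

Lemma qpoch_fpoch n y : qpoch y q = fpoch n y * qpoch (y * q ^+ n) q.
Proof.
elim: n => [|n ih]; first by rewrite fpoch0 mul1r expr0 mulr1.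
by rewrite ih fpochS qpochS exprSr !mulrA.
Qed.

(** A lower bound uniform in [n] and over a family of points: finitely many factors are bounded
    below one by one, and the remaining product is close to 1. The index type is the parameter of
    the curve, or [unit] for a single point. *)
Lemma fpoch_below (T : Type) (y : T -> C) (D : T -> Prop) Y :
  (forall t, D t -> normc (y t) <= Y) ->
  (forall j, exists2 c : R, 0 < c & forall t, D t -> c <= normc (1 - y t * q ^+ j)) ->
  exists2 c : R, 0 < c & forall n t, D t -> c <= normc (fpoch n (y t)).
Proof.
move=> yY low.
have [J HJ] := geometric_small (bd Y / (1 - r) * Y) (divr_gt0 ltr01 (ltr0n _ 2)).
have [c c0 Hc] : exists2 c : R, 0 < c & forall n t, (n <= J)%N -> D t ->
    c <= normc (fpoch n (y t)).
  elim: {HJ} J => [|J [c c0 Hc]].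
    by exists 1 => // n t; rewrite leqn0 => /eqP -> _; rewrite fpoch0 normc1.
  have [c' c'0 Hc'] := low J.
  exists (Num.min c (c * c')) => [|n t]; first by rewrite lt_min c0 mulr_gt0.
  rewrite leq_eqVlt => /orP[/eqP -> Dt|nJ Dt].
    by rewrite ge_min; apply/orP; right; rewrite fpochS normcM ler_pM ?(ltW c0) ?(ltW c'0) ?Hc ?Hc'.
  by rewrite ge_min Hc.
exists (c / 2) => [|n t Dt]; first by rewrite divr_gt0.
have [nJ|Jn] := leqP n J.
  by rewrite (le_trans _ (Hc n t nJ Dt))// ler_pdivrMr// ler_pMr// ler1n.
rewrite -(subnKC (ltnW Jn)) fpochD normcM ler_pM ?invr_ge0 ?(ltW c0) ?Hc//.
(* The remaining product starts at y q^J, and [J] was chosen so that all its partial products stay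
   within 1/2 of 1. *)
set z := y t * q ^+ J; have nz : normc z = normc (y t) * r ^+ J by rewrite normcM normcX.
have r1' : r ^+ J <= 1 by rewrite exprn_ile1 ?normc_ge0// ltW.
have zY : normc z <= Y.
  rewrite nz (le_trans _ (yY t Dt))// ler_piMr ?normc_ge0//.
have := fpoch_cauchy (n - J) 0 zY; rewrite add0n fpoch0 expr0 mulr1 => H.
have : bd Y / (1 - r) * normc z <= 1 / 2.
  apply: le_trans (HJ J (leqnn _)); rewrite nz mulrA ler_wpM2r ?exprn_ge0 ?normc_ge0//.
  by rewrite ler_wpM2l ?yY// mulr_ge0.
have := lerB_normc 1 (1 - fpoch (n - J) z); rewrite subKr normc1 (normcB 1).
by move: H; lra.
Qed.

Lemma qpoch_neq0 y : (forall j, y * q ^+ j != 1) -> qpoch y q != 0.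
Proof.
move=> yj; have [||c c0 Hc] := @fpoch_below unit (fun=> y) (fun=> True) (normc y) => //.
  move=> j; exists (normc (1 - y * q ^+ j)) => //.
  by rewrite normc_gt0 subr_eq0 eq_sym.
have [N HN] := qpoch_conv y c0; apply/eqP => y0.
by have := HN N (leqnn _); have := Hc N tt I; rewrite y0 subr0; lra.
Qed.

End QPoch.

Section LaurentFunctions.
Variable R : realType.
Local Notation C := R[i].

(* The functions which agree on C^* with a Laurent polynomial. *)
Inductive isL : (C -> C) -> Prop :=
| isL_cst c : isL (fun=> c)
| isL_id : isL (fun x => x)
| isL_V : isL (fun x => x^-1)
| isL_add F G : isL F -> isL G -> isL (fun x => F x + G x)
| isL_mul F G : isL F -> isL G -> isL (fun x => F x * G x)
| isL_ext F G : (forall x, x != 0 -> F x = G x) -> isL F -> isL G.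

Lemma isL_eq F G : F =1 G -> isL F -> isL G.
Proof. by move=> FG; apply: isL_ext => x _. Qed.

Lemma isL_scale c F : isL F -> isL (fun x => c * F x).
Proof. exact/isL_mul/isL_cst. Qed.

Lemma isL_opp F : isL F -> isL (fun x => - F x).
Proof. by move=> /(isL_scale (-1)); apply: isL_eq => x; rewrite mulN1r. Qed.

Lemma isL_sub F G : isL F -> isL G -> isL (fun x => F x - G x).
Proof. by move=> FL GL; apply: isL_add => //; exact: isL_opp. Qed.

Lemma isL_exp F n : isL F -> isL (fun x => F x ^+ n).
Proof.
move=> FL; elim: n => [|n ih]; first by apply: isL_eq (isL_cst 1) => x; rewrite expr0.
by apply: isL_eq (isL_mul FL ih) => x; rewrite exprS.
Qed.

Lemma isL_expV F n : isL (fun x => (F x)^-1) -> isL (fun x => F x ^- n).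
Proof. by move=> /(isL_exp n); apply: isL_eq => x; rewrite exprVn. Qed.

Lemma isL_Xz (m : int) : isL (fun x => x ^ m).
Proof.
case: m => n; first by apply: isL_eq (isL_exp n isL_id) => x.
by apply: isL_eq (isL_exp n.+1 isL_V) => x; rewrite NegzE -exprnN exprVn.
Qed.

Lemma isL_sum (I : Type) (r : seq I) (F : I -> C -> C) :
  (forall i, isL (F i)) -> isL (fun x => \sum_(i <- r) F i x).
Proof.
move=> FL; elim: r => [|i r ih].
  by apply: isL_eq (isL_cst 0) => x; rewrite big_nil.
by apply: isL_eq (isL_add (FL i) ih) => x; rewrite big_cons.
Qed.

Lemma isL_prod (I : Type) (r : seq I) (F : I -> C -> C) :
  (forall i, isL (F i)) -> isL (fun x => \prod_(i <- r) F i x).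
Proof.
move=> FL; elim: r => [|i r ih].
  by apply: isL_eq (isL_cst 1) => x; rewrite big_nil.
by apply: isL_eq (isL_mul (FL i) ih) => x; rewrite big_cons.
Qed.

Lemma isL_horner (p : {poly C}) F : isL F -> isL (fun x => p.[F x]).
Proof.
move=> FL; elim/poly_ind: p => [|p c ih].
  by apply: isL_eq (isL_cst 0) => x; rewrite horner0.
apply: isL_eq (isL_add (isL_mul ih FL) (isL_cst c)) => x.
by rewrite hornerMXaddC.
Qed.

Lemma isL_comp_inv s F : s != 0 -> isL F -> isL (fun x => F (s / x)).
Proof.
move=> s0; elim=> {F} [c|||F G _ ihF _ ihG|F G _ ihF _ ihG|F G FG _ ih].
- exact: isL_cst.
- exact: isL_scale isL_V.
- by apply: isL_eq (isL_scale s^-1 isL_id) => x; rewrite invf_div mulrC.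
- exact: isL_add.
- exact: isL_mul.
- by apply: isL_ext ih => x x0; rewrite FG// mulf_neq0 ?invr_eq0.
Qed.

Lemma isL_comp_scale s F : s != 0 -> isL F -> isL (fun x => F (s * x)).
Proof.
move=> s0; elim=> {F} [c|||F G _ ihF _ ihG|F G _ ihF _ ihG|F G FG _ ih].
- exact: isL_cst.
- exact: isL_scale isL_id.
- by apply: isL_eq (isL_scale s^-1 isL_V) => x; rewrite invfM.
- exact: isL_add.
- exact: isL_mul.
- by apply: isL_ext ih => x x0; rewrite FG// mulf_neq0.
Qed.

Lemma isL_comp_V F : isL F -> isL (fun x => F x^-1).
Proof.
by move=> /(isL_comp_inv (oner_neq0 C)); apply: isL_eq => x; rewrite mul1r.
Qed.

Lemma isL_polyP F : isL F -> exists (P : {poly C}) N, forall x, x != 0 -> F x * x ^+ N = P.[x].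
Proof.
elim=> {F} [c|||F G _ [P [N FP]] _ [Q [M GQ]]|F G _ [P [N FP]] _ [Q [M GQ]]|F G FG _ [P [N FP]]].
- by exists c%:P, 0%N => x _; rewrite hornerC mulr1.
- by exists 'X, 0%N => x _; rewrite hornerX mulr1.
- by exists 1, 1%N => x x0; rewrite hornerC expr1 mulVf.
- exists (P * 'X^M + Q * 'X^N), (N + M)%N => x x0.
  by rewrite !hornerE -FP// -GQ// exprD; ring.
- exists (P * Q), (N + M)%N => x x0.
  by rewrite !hornerE -FP// -GQ// exprD; ring.
- by exists P, N => x x0; rewrite -FG// FP.
Qed.

Lemma poly_horner_eq0 (p : {poly C}) : (forall x, p.[x] = 0) -> p = 0.
Proof.
move=> p0; apply/eqP; apply/negPn/negP => pn0.
have := max_poly_roots (rs := [seq i%:R | i <- iota 0 (size p)]) pn0.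
rewrite size_map size_iota ltnn => H; suff : false by []; apply: H.
  by apply/allP => _ /mapP[i _ ->]; rewrite rootE p0.
rewrite map_inj_uniq ?iota_uniq// => i j /eqP; rewrite eqr_nat => /eqP; exact.
Qed.

(** The formulas for T1 and T0 are only known off x^2 = 1 and x^2 = q. This lemma extends identities
    across these removable points. *)
Lemma isL_eq0 s F : isL F -> (forall x, x != 0 -> x ^+ 2 != s -> F x = 0) ->
  forall x, x != 0 -> F x = 0.
Proof.
move=> /isL_polyP[P [N FP]] F0 x x0.
have : P * ('X^2 - s%:P) * 'X = 0.
  apply: poly_horner_eq0 => y; rewrite !hornerE.
  have [->|y0] := eqVneq y 0; first by rewrite mulr0.
  have [->|ys] := eqVneq (y ^+ 2) s; first by rewrite subrr mulr0 mul0r.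
  by rewrite -FP// F0// !mul0r.
move/eqP; rewrite !mulf_eq0 polyX_eq0 orbF.
have -> : ('X^2 - s%:P == 0 :> {poly C}) = false.
  by apply/negbTE; rewrite -size_poly_gt0 size_XnsubC.
rewrite orbF => /eqP P0; have := FP x x0; rewrite P0 horner0.
by move/eqP; rewrite mulf_eq0 expf_eq0 (negbTE x0) andbF orbF => /eqP.
Qed.

Lemma isL_eqP s F G : isL F -> isL G ->
  (forall x, x != 0 -> x ^+ 2 != s -> F x = G x) ->
  forall x, x != 0 -> F x = G x.
Proof.
move=> FL GL FG x x0; apply/eqP; rewrite -subr_eq0; apply/eqP.
apply: (isL_eq0 (isL_sub FL GL) (s := s)) => // y y0 ys.
by rewrite FG// subrr.
Qed.

Definition lsupp (p : laurent R) : {fset int} := fset_set [set n | p n != 0].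

Lemma lsuppP (p : laurent R) n : n \notin lsupp p -> p n = 0.
Proof.
by apply: contraNeq => pn; rewrite in_fset_set; [exact: mem_set | exact: finite_supp].
Qed.

Lemma levalE (p : laurent R) x : leval p x = \sum_(n <- lsupp p) p n * x ^ n.
Proof. by apply: leval_fset => n /lsuppP. Qed.

Lemma leval_isL (p : laurent R) : isL (leval p).
Proof.
apply: (@isL_eq (fun x => \sum_(n <- lsupp p) p n * x ^ n)) => [x|].
  by rewrite -levalE.
by apply: isL_sum => n; apply: isL_scale; exact: isL_Xz.
Qed.

Lemma leval_poly (p : laurent R) (m : nat) :
  (forall n : int, (m < `|n|)%N -> p n = 0) ->
  forall x, x != 0 -> leval p x * x ^+ m = (\poly_(i < m.*2.+1) p (i%:Z - m%:Z)).[x].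
Proof.
move=> pm x x0; rewrite horner_poly.
pose r := [seq (i%:Z - m%:Z)%R | i <- iota 0 m.*2.+1].
have rP (n : int) : (n \in r) = (`|n| <= m)%N.
  apply/mapP/idP => [ [i + ->] | nm]; first by rewrite mem_iota; lia.
  by exists (absz (n + m%:Z)%R); [rewrite mem_iota; lia|lia].
pose B := [fset n | n in r]%fset.
have BP n : (n \in B) = (n \in r).
  by apply/imfsetP/idP => [ [k kr ->] | nr] //; exists n.
rewrite (@leval_fset _ p B); last by move=> n; rewrite BP rP -ltnNge => /pm.
rewrite (perm_big r)/=; last first.
  apply: uniq_perm; [exact: fset_uniq| |exact: BP].
  by rewrite map_inj_uniq ?iota_uniq// => i j; lia.
rewrite mulr_suml big_map -[iota 0 _]/(index_iota 0 m.*2.+1) big_mkord.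
apply: eq_bigr => i _.
by rewrite expfzDr// -exprnN -exprnP -!mulrA mulVf ?mulr1// expf_neq0.
Qed.

Lemma leval_inj (p r : laurent R) : (forall x, x != 0 -> leval p x = leval r x) -> p = r.
Proof.
move=> pr; suff H n : p n = r n.
  by apply: val_inj; apply/funext.
pose m := \max_(k <- n :: lsupp p ++ lsupp r) `|k|%N.
have bnd (f : laurent R) : {subset lsupp f <= lsupp p ++ lsupp r} ->
    forall k : int, (m < `|k|)%N -> f k = 0.
  move=> sub k mk; apply: lsuppP; apply/negP => /sub kf.
  have : (`|k| <= m)%N.
    rewrite /m (big_rem k)/= ?leq_maxl//; first by rewrite inE kf orbT.
  by rewrite leqNgt mk.
have bp := bnd p _; have br := bnd r _.
have {}bp := bp (fun k => ltac:(by rewrite mem_cat => ->)).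
have {}br := br (fun k => ltac:(by rewrite mem_cat orbC => ->)).
have nm : (`|n| <= m)%N by rewrite /m big_cons leq_maxl.
have : \poly_(i < m.*2.+1) p (i%:Z - m%:Z) = \poly_(i < m.*2.+1) r (i%:Z - m%:Z).
  apply/eqP; rewrite -subr_eq0.
  (* The extra factor ['X] disposes of the point 0, where nothing is known about the values. *)
  have /eqP : (\poly_(i < m.*2.+1) p (i%:Z - m%:Z) - \poly_(i < m.*2.+1) r (i%:Z - m%:Z)) * 'X = 0.
    apply: poly_horner_eq0 => x; rewrite hornerM hornerX hornerD hornerN.
    have [->|x0] := eqVneq x 0; first by rewrite mulr0.
    by rewrite -!leval_poly// pr// subrr mul0r.
  by rewrite mulf_eq0 polyX_eq0 orbF.
move=> /(congr1 (fun P : {poly C} => P`_(absz (n + m%:Z)%R))); rewrite !coef_poly.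
have -> : (absz (n + m%:Z)%R < m.*2.+1)%N by lia.
by have -> : ((absz (n + m%:Z)%R)%:Z - m%:Z)%R = n by lia.
Qed.

End LaurentFunctions.

Section Convergence.
Variable R : realType.
Local Notation C := R[i].
Implicit Types u v : nat -> C.

Lemma cconv_cst (c : C) : cconv (fun=> c) c.
Proof. by move=> e e0; exists 0%N => n _; rewrite subrr normc0. Qed.

Lemma cconvD u v l m : cconv u l -> cconv v m -> cconv (fun n => u n + v n) (l + m).
Proof.
move=> ul vm e e0; have e20 : 0 < e / 2 by rewrite divr_gt0.
have [N1 H1] := ul _ e20; have [N2 H2] := vm _ e20.
exists (maxn N1 N2) => n; rewrite geq_max => /andP[n1 n2].
rewrite (_ : _ - _ = (u n - l) + (v n - m)); last by ring.
have := ler_normcD (u n - l) (v n - m); have := H1 n n1; have := H2 n n2; lra.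
Qed.

Lemma cconvM u v l m : cconv u l -> cconv v m -> cconv (fun n => u n * v n) (l * m).
Proof.
move=> ul vm e e0.
have k0 : 0 < normc l + normc m + 1 by rewrite ltr_wpDl// addr_ge0 ?normc_ge0.
pose e' := Num.min 1 (e / (normc l + normc m + 1)).
have e'0 : 0 < e' by rewrite lt_min ltr01 divr_gt0.
have [N1 H1] := ul _ e'0; have [N2 H2] := vm _ e'0.
exists (maxn N1 N2) => n; rewrite geq_max => /andP[n1 n2].
have {}H1 := H1 n n1; have {}H2 := H2 n n2.
rewrite (_ : _ - _ = (u n - l) * (v n - m) + (l * (v n - m) + m * (u n - l))); last by ring.
apply: (le_lt_trans (ler_normcD _ _)); apply: (le_lt_trans (lerD (lexx _) (ler_normcD _ _))).
rewrite !normcM.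
have : normc (u n - l) * normc (v n - m) < 1 * e'.
  apply: ltr_pM; rewrite ?normc_ge0//; apply: (lt_le_trans H1).
  by rewrite /e' ge_min lexx.
have : normc l * normc (v n - m) <= normc l * e' by rewrite ler_wpM2l ?normc_ge0// ltW.
have : normc m * normc (u n - l) <= normc m * e' by rewrite ler_wpM2l ?normc_ge0// ltW.
have : e' * (normc l + normc m + 1) <= e.
  by rewrite -ler_pdivlMr// /e' ge_min lexx orbT.
lra.
Qed.

Lemma cconv_sub u l (f : nat -> nat) : (forall n, (n <= f n)%N) -> cconv u l ->
  cconv (fun n => u (f n)) l.
Proof.
move=> nf ul e e0; have [N HN] := ul e e0; exists N => n Nn; apply: HN.
exact: leq_trans Nn (nf n).
Qed.

Lemma cconv_eq u v l : u =1 v -> cconv u l -> cconv v l.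
Proof. by move=> uv ul e e0; have [N HN] := ul e e0; exists N => n; rewrite -uv; exact: HN. Qed.

Lemma cconv_expr (q : C) : normc q < 1 -> cconv (fun n => q ^+ n) 0.
Proof.
move=> q1 e e0; have [N HN] := geometric_small q1 1 (divr_gt0 e0 (ltr0n _ 2)).
exists N => n /HN; rewrite mul1r subr0 normcX; move: e0; lra.
Qed.

End Convergence.

(** * The operators T0, T1 and Y *)

Section Demazure.
Variable R : realType.
Local Notation C := R[i].

(** [D] is the divided difference (F(s/x) - F(x)) / (x^2 - s). The last clause follows from the one
    before off x^2 = s; it is carried along so as to hold at every nonzero point. *)
Definition reflD (s : C) (F D : C -> C) := [/\ isL D,
  forall x, x != 0 -> F (s / x) = F x + (x ^+ 2 - s) * D x &
  forall x, x != 0 -> D (s / x) = x ^+ 2 / s * D x].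

Lemma reflD_exists s F : s != 0 -> isL F -> exists D, reflD s F D.
Proof.
move=> s0; elim=> {F} [c|||F G _ [D1 [L1 e1 f1]] _ [D2 [L2 e2 f2]]|
  F G FL [D1 [L1 e1 f1]] GL [D2 [L2 e2 f2]]|F G FG _ [D [L e f]]].
- exists (fun=> 0); split; first exact: isL_cst.
    by move=> x _; rewrite mulr0 addr0.
  by move=> x _; rewrite mulr0.
- exists (fun x => - x^-1); split; first exact/isL_opp/isL_V.
    by move=> x x0; field.
  by move=> x x0; field; rewrite s0 x0.
- exists (fun x => s^-1 * x^-1); split; first exact/isL_scale/isL_V.
    by move=> x x0; field; rewrite s0 x0.
  by move=> x x0; field; rewrite s0 x0.
- exists (fun x => D1 x + D2 x); split; first exact: isL_add.
    by move=> x x0; rewrite e1// e2//; ring.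
  by move=> x x0; rewrite f1// f2//; ring.
(* The twisted Leibniz rule for divided differences. *)
- exists (fun x => D1 x * G x + F x * D2 x + (x ^+ 2 - s) * (D1 x * D2 x)); split.
  + apply: isL_add; first by apply: isL_add; exact: isL_mul.
    apply: isL_mul; last exact: isL_mul.
    by apply: isL_sub; [exact/isL_exp/isL_id|exact: isL_cst].
  + by move=> x x0; rewrite e1// e2//; ring.
  + by move=> x x0; rewrite e1// e2// f1// f2//; field; rewrite s0 x0.
- exists D; split => // x x0.
  by rewrite -!FG ?e// mulf_neq0 ?invr_eq0.
Qed.

(* A Demazure-Lusztig operator kf + n D f / k and its adjoint (h + n D h) / k:
   the defect of isometry is n Z / k^2 with Z(s/x) = (x^2/s) Z(x). *)
Lemma demazure_isometry s k n F H D E : s != 0 -> k != 0 -> isL F -> isL H -> isL n ->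
  reflD s F D -> reflD s H E ->
  (forall x, x != 0 -> n x - x ^+ 2 / s * n (s / x) = (1 + k ^+ 2) * (x ^+ 2 - s)) ->
  exists Z, [/\ isL Z, forall x, x != 0 -> Z (s / x) = x ^+ 2 / s * Z x &
    forall x, x != 0 -> (k * F x + k^-1 * (n x * D x)) * (k^-1 * (H x + n x * E x)) =
      F x * H x + k ^- 2 * (n x * Z x)].
Proof.
move=> s0 k0 FL HL nL [DL De Df] [EL Ee Ef] nE.
exists (fun x => k ^+ 2 * F x * E x + H x * D x + n x * (D x * E x)); split.
- apply: isL_add; last by apply: isL_mul => //; exact: isL_mul.
  by apply: isL_add; apply: isL_mul => //; exact: isL_scale.
- move=> x x0; rewrite De// Ee// Df// Ef//.
  have -> : n (s / x) = s / x ^+ 2 * (n x - (1 + k ^+ 2) * (x ^+ 2 - s)).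
    by rewrite -nE//; field; rewrite s0 x0.
  by field; rewrite s0 x0.
- by move=> x x0; field.
Qed.

End Demazure.

Section OperatorValues.
Variable R : realType.
Local Notation C := R[i].
Variable t : params R.
Local Notation q := (pq t).
Hypothesis sq0 : sq t != 0.
Hypothesis tk0 : k0 t != 0.
Hypothesis tk1 : k1 t != 0.
Hypothesis tu0 : u0 t != 0.
Hypothesis tu1 : u1 t != 0.

Let q0 : q != 0. Proof. by rewrite expf_neq0. Qed.

(** In terms of divided differences the denominators of T1 and T0 cancel: T f = k f + k^-1 n D, with
    [n] the Laurent polynomial [T1num] (for s = 1) or [T0num] (for s = q). *)
Definition T1num (x : C) := - ((1 - pa t * x) * (1 - pb t * x)).
Definition T0num (x : C) := (x - pc t) * (x - pd t).

Lemma isL_T1num : isL T1num.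
Proof.
apply: isL_opp; apply: isL_mul; apply: isL_sub; try exact: isL_cst;
  by apply: isL_scale; exact: isL_id.
Qed.

Lemma isL_T0num : isL T0num.
Proof. by apply: isL_mul; apply: isL_sub; try exact: isL_cst; exact: isL_id. Qed.

Lemma T1_eval (p : laurent R) D : reflD 1 (leval p) D ->
  forall x, x != 0 -> leval (T1 t p) x = k1 t * leval p x + (k1 t)^-1 * (T1num x * D x).
Proof.
move=> [DL De _]; apply: (isL_eqP (s := 1)).
- exact: leval_isL.
- apply: isL_add; apply: isL_scale; first exact: leval_isL.
  by apply: isL_mul => //; exact: isL_T1num.
move=> x x0 x1; rewrite T1P// /T1fun.
have := De x x0; rewrite div1r => ->.
rewrite /T1num /pa /pb; have x1' : 1 - x ^+ 2 != 0 by rewrite subr_eq0 eq_sym.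
by field; rewrite ?tk1 ?tu1 ?x1'.
Qed.

(** Inverting the parameters and the argument together brings back the numerator of T1 itself, which
    is the shape of the second factor in [demazure_isometry]. *)
Lemma T1_inv_eval (p : laurent R) D : reflD 1 (fun x => leval p x^-1) D ->
  forall x, x != 0 -> leval (T1 (inv_params t) p) x^-1 =
    (k1 t)^-1 * (leval p x^-1 + T1num x * D x).
Proof.
move=> [DL De _]; have pL := isL_comp_V (leval_isL p); apply: (isL_eqP (s := 1)).
- exact/isL_comp_V/leval_isL.
- by apply: isL_scale; apply: isL_add => //; apply: isL_mul => //; exact: isL_T1num.
move=> x x0 x1; rewrite T1P ?invr_eq0//; last by rewrite exprVn invr_eq1.
rewrite /T1fun /=; have := De x x0; rewrite div1r => ->.
rewrite /T1num /pa /pb; have x1' : 1 - x ^+ 2 != 0 by rewrite subr_eq0 eq_sym.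
have x1'' : x ^+ 2 - 1 != 0 by rewrite subr_eq0.
by field; rewrite ?tk1 ?tu1 ?x0 ?x1' ?x1''.
Qed.

Lemma T0_eval (p : laurent R) D : reflD q (leval p) D ->
  forall x, x != 0 -> leval (T0 t p) x = k0 t * leval p x + (k0 t)^-1 * (T0num x * D x).
Proof.
move=> [DL De _]; apply: (isL_eqP (s := q)).
- exact: leval_isL.
- apply: isL_add; apply: isL_scale; first exact: leval_isL.
  by apply: isL_mul => //; exact: isL_T0num.
move=> x x0 x1; rewrite T0P// /T0fun De//.
rewrite /T0num /pc /pd; have x1' : x ^+ 2 - q != 0 by rewrite subr_eq0.
by field; rewrite ?tk0 ?tu0 ?x1' ?x0.
Qed.

Lemma T0_inv_eval (p : laurent R) D : reflD q (fun x => leval p x^-1) D ->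
  forall x, x != 0 -> leval (T0 (inv_params t) p) x^-1 =
    (k0 t)^-1 * (leval p x^-1 + T0num x * D x).
Proof.
move=> [DL De _]; have pL := isL_comp_V (leval_isL p); apply: (isL_eqP (s := q)).
- exact/isL_comp_V/leval_isL.
- by apply: isL_scale; apply: isL_add => //; apply: isL_mul => //; exact: isL_T0num.
have qV : pq (inv_params t) = q^-1 by rewrite /pq /= exprVn.
move=> x x0 x1; rewrite T0P ?invr_eq0//; last first.
  by rewrite qV exprVn; apply: contra x1 => /eqP/invr_inj ->.
rewrite /T0fun qV /= invrK; have := De x x0.
rewrite invf_div (_ : q^-1 / x^-1 = x / q) => [->|]; last by rewrite invrK mulrC.
rewrite /T0num /pc /pd; have x1' : x ^+ 2 - q != 0 by rewrite subr_eq0.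
move: x1'; rewrite /pq => x1'; have x1'' : sq t ^+ 2 - x ^+ 2 != 0 by rewrite -oppr_eq0 opprB.
by field; rewrite ?tk0 ?tu0 ?x1' ?x1'' ?x0 ?sq0.
Qed.

End OperatorValues.

Section OperatorsLinear.
Variable R : realType.
Local Notation C := R[i].
Variable t : params R.
Hypothesis sq0 : sq t != 0.

Lemma T1_lin (k : C) (p r : laurent R) : T1 t (k *: p + r) = k *: T1 t p + T1 t r.
Proof.
apply: leval_inj => x x0.
apply: (isL_eqP (s := 1) (leval_isL _) (leval_isL _) _ x0) => y y0 y1.
by rewrite levalP !T1P// /T1fun !levalP; ring.
Qed.

Lemma T0_lin (k : C) (p r : laurent R) : T0 t (k *: p + r) = k *: T0 t p + T0 t r.
Proof.
apply: leval_inj => x x0.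
apply: (isL_eqP (s := pq t) (leval_isL _) (leval_isL _) _ x0) => y y0 y1.
by rewrite levalP !T0P// /T0fun !levalP; ring.
Qed.

Lemma Y_lin (k : C) (p r : laurent R) : Y t (k *: p + r) = k *: Y t p + Y t r.
Proof. by rewrite /Y T0_lin T1_lin. Qed.

End OperatorsLinear.

(** * Distinct eigenvalues of Y *)

Section Spectrum.
Variable R : realType.
Local Notation C := R[i].
Local Notation A := (laurent R).

Lemma mono_rank_inj : injective mono_rank.
Proof.
by move=> [m|m] [n|n] /= /eqP; rewrite ?eqSS -?doubleS ?eqn_double => H;
  try (move: H => /eqP ->); try lia.
Qed.

Lemma mono_rank_surj r : exists n, mono_rank n = r.
Proof.
exists (if odd r then Negz r./2 else Posz r./2).
by case: ifP => or /=; rewrite -[RHS](odd_double_half r) or.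
Qed.

Lemma leading_self m (p : A) : leading m p -> p != 0.
Proof. by move=> [pm _]; apply/eqP => p0; move: pm; rewrite p0 => /esym/eqP; rewrite oner_eq0. Qed.

Variable t : params R.
Hypothesis sq0 : sq t != 0.
Variable P : int -> A.
Hypothesis hP : forall m : int, isP t m (P m).

(** If two eigenvalues agreed, adding the eigenvector of lower rank to the other one would preserve
    its leading term and contradict uniqueness. *)
Lemma gam_neq m n : m != n -> gam t m != gam t n.
Proof.
wlog mn : m n / (mono_rank n < mono_rank m)%N.
  move=> H mn; case: (ltngtP (mono_rank n) (mono_rank m)) => [h|h|/mono_rank_inj h].
  - exact: H.
  - by rewrite eq_sym; apply: H => //; rewrite eq_sym.
  - by rewrite h eqxx in mn.
move=> _; apply/eqP => gmn.
have [[[Pm Plow] PY] Puniq] := hP m.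
have [[[Pn Pnlow] PnY] _] := hP n.
have E : P m = 1 *: P n + P m.
  apply: Puniq; split; last by rewrite Y_lin// PY PnY -gmn scalerDr !scale1r.
  have co j : (1 *: P n + P m) j = 1 * P n j + P m j by [].
  split; first by rewrite co Pm Pnlow// mulr0 add0r.
  by move=> j mj; rewrite co Plow// Pnlow ?mulr0 ?addr0// (ltn_trans mn).
have : P n = 0.
  by move: E; rewrite scale1r => /(congr1 (fun z => z - P m)); rewrite addrK subrr.
by apply/eqP; apply: (@leading_self n); split.
Qed.

Hypothesis q0 : normc (pq t) < 1.
Hypothesis tk0 : k0 t != 0.
Hypothesis tk1 : k1 t != 0.
Hypothesis tu0 : u0 t != 0.
Hypothesis tu1 : u1 t != 0.

(** Since abcd = q (k0 k1)^2, equality would identify the eigenvalues for 0 and for -(j + 1). *)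
Lemma abcd_neq j : pa t * pb t * pc t * pd t * pq t ^+ j != 1.
Proof.
have : gam t 0 != gam t (Negz j) by exact: gam_neq.
apply: contra_neq; rewrite /gam /= expr0z mulr1 NegzE -exprnN exprS => H.
have k00 : k0 t * k1 t != 0 by rewrite mulf_neq0.
have qj : pq t ^+ j != 0 by rewrite !expf_neq0.
have {}H : (k0 t * k1 t) ^+ 2 * (pq t * pq t ^+ j) = 1.
  by rewrite -[RHS]H /pa /pb /pc /pd /pq; field; rewrite tu0 tu1.
have nz : k0 t * k1 t * (pq t * pq t ^+ j) != 0 by rewrite !mulf_neq0// ?expf_neq0.
by apply: (mulIf nz); rewrite -invfM mulVf// -[RHS]H; ring.
Qed.

End Spectrum.

(** * Norms of monic orthogonal symmetric polynomials *)

Section QDifference.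
Variable R : realType.
Local Notation C := R[i].
Variable q : C.
Hypothesis q0 : q != 0.

Let qn0 n : q ^+ n != 0. Proof. by rewrite expf_neq0. Qed.

(* prod_(l < m) (1 - q^-l sigma) with sigma the shift of sequences *)
Fixpoint qdiff (m : nat) (f : nat -> C) : nat -> C :=
  if m is n.+1 then fun k => qdiff n f k - q ^- n * qdiff n f k.+1 else f.

Lemma qdiff_ext m f h : f =1 h -> qdiff m f =1 qdiff m h.
Proof. by move=> fh; elim: m => [|m ih] k //=; rewrite !ih. Qed.

Lemma qdiff_lin m c f h k :
  qdiff m (fun i => c * f i + h i) k = c * qdiff m f k + qdiff m h k.
Proof. by elim: m k => [|m ih] k //=; rewrite !ih; ring. Qed.

Lemma qdiffZ m c f k : qdiff m (fun i => c * f i) k = c * qdiff m f k.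
Proof. by elim: m k => [|m ih] k //=; rewrite !ih; ring. Qed.

Lemma qdiff_expr m i k : qdiff m (fun j => (q ^+ j) ^+ i) k =
  \prod_(l < m) (1 - q ^+ i * q ^- l) * (q ^+ k) ^+ i.
Proof.
elim: m k => [|m ih] k; first by rewrite big_ord0 mul1r.
rewrite [LHS]/= !ih big_ord_recr/= exprS exprMn.
by set w := \prod_(_ < _) _; ring.
Qed.

(** The sequence of the powers q^(k i) is an eigenvector of the shift and is killed by the factor
    with l = i. *)
Lemma qdiff_horner m (Q : {poly C}) k : (size Q <= m)%N ->
  qdiff m (fun j => Q.[q ^+ j]) k = 0.
Proof.
move=> Qm.
have H n : (n <= m)%N -> qdiff m (fun j => \sum_(i < n) Q`_i * (q ^+ j) ^+ i) k = 0.
  elim: n => [_|n ih nm].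
    rewrite (@qdiff_ext m _ (fun j => 0 * q ^+ j)); last by move=> j; rewrite big_ord0 mul0r.
    by rewrite qdiffZ mul0r.
  rewrite (@qdiff_ext m _ (fun j => Q`_n * (q ^+ j) ^+ n + \sum_(i < n) Q`_i * (q ^+ j) ^+ i)).
    rewrite qdiff_lin ih ?(ltnW nm)// addr0 qdiff_expr (bigD1 (Ordinal nm))//=.
    by rewrite divff// subrr !mul0r mulr0.
  by move=> j; rewrite big_ord_recr addrC.
rewrite (@qdiff_ext m _ (fun j => \sum_(i < size Q) Q`_i * (q ^+ j) ^+ i)); first exact: H.
by move=> j; rewrite horner_coef.
Qed.

(** Induction on [m]: the denominators at [k] and [k.+1] share all but their extreme factors. *)
Lemma qdiff_geometric m u k : (forall j, 1 - u * q ^+ j != 0) ->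
  qdiff m (fun j => (1 - u * q ^+ j)^-1) k =
  u ^+ m * fpoch q m q * (q ^+ k) ^+ m / fpoch q m.+1 (u * q ^+ k).
Proof.
move=> u1; have uk j l : fpoch q l (u * q ^+ j) != 0.
  by rewrite /fpoch; apply/prodf_neq0 => i _; rewrite -mulrA -exprD.
elim: m k => [|m ih] k.
  by rewrite /= !expr0 fpochS !fpoch0 !mul1r expr0 mulr1.
rewrite [LHS]/= !ih [fpoch q m.+1 (u * q ^+ k)]fpochSl [fpoch q m.+2 _]fpochS.
rewrite [fpoch q m.+1 (u * q ^+ k)]fpochSl [fpoch q m.+1 q]fpochS.
rewrite [fpoch q m.+1 (u * q ^+ k.+1)]fpochS.
have -> : u * q ^+ k.+1 = u * q ^+ k * q by rewrite exprSr mulrA.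
have h1 : fpoch q m (u * q ^+ k * q) != 0 by rewrite -mulrA -exprSr.
have h2 : 1 - u * q ^+ k != 0 by [].
have h3 : 1 - u * q ^+ k * q * q ^+ m != 0 by rewrite -!mulrA -exprS -exprD.
have h4 : 1 - u * q ^+ k * q ^+ m.+1 != 0 by rewrite -mulrA -exprD.
move: h1 h2 h3 h4 (qn0 m); rewrite !exprS exprMn.
set F := fpoch q m _; set G := fpoch q m q; set U := u ^+ m; set Y := q ^+ k.
set M := q ^+ m; set Ym := Y ^+ m => h1 h2 h3 h4 M0.
by field; rewrite ?h1 ?h2 ?h3 ?h4 ?M0.
Qed.

(** The top coefficient (-1)^m q^(-m(m-1)/2) is recorded against a product of powers of q, the same
    product as in [coef_sympol]. *)
Lemma qdiff_coef m : exists2 cf : nat -> C,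
  forall f j, qdiff m f j = \sum_(k < m.+1) cf k * f (j + k)%N &
  cf m * \prod_(l < m) q ^+ l = (-1) ^+ m.
Proof.
elim: m => [|m [cf E cm]].
  by exists (fun=> 1); rewrite ?big_ord0 ?mulr1// => f j; rewrite big_ord1 mul1r addn0.
exists (fun k => (if (k <= m)%N then cf k else 0) - (if k is i.+1 then q ^- m * cf i else 0)).
  move=> f j /=; rewrite !E.
  under [RHS]eq_bigr do rewrite mulrBl.
  rewrite sumrB [in RHS]big_ord_recr/= ltnn mul0r addr0.
  rewrite [X in _ = _ - X]big_ord_recl/= mul0r add0r; congr (_ - _).
    by apply: eq_bigr => i _; rewrite -ltnS ltn_ord.
  rewrite mulr_sumr; apply: eq_bigr => i _; rewrite /bump/= add1n addnS addSn; ring.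
rewrite ltnn sub0r big_ord_recr/= exprS -cm; set w := \prod_(_ < _) _.
by field.
Qed.

End QDifference.

Section Norm.
Variable R : realType.
Local Notation C := R[i].
Variables (q a b c d : C) (l : {poly C} -> C) (l0 : C).
Hypothesis q0 : q != 0.
Hypothesis a0 : a != 0.
Hypothesis b0 : b != 0.
Hypothesis c0 : c != 0.
Hypothesis d0 : d != 0.
Local Notation E := (a * b * c * d).
Hypothesis E1 : forall j, E * q ^+ j != 1.
Hypothesis ab1 : forall j, a * b * q ^+ j != 1.
Hypothesis ac1 : forall j, a * c * q ^+ j != 1.
Hypothesis ad1 : forall j, a * d * q ^+ j != 1.

Hypothesis l_lin : forall k p r, l (k *: p + r) = k * l p + l r.

(** At x + 1/x the factors are (1 - e q^i x)(1 - e q^i / x): this is (ex, e/x; q)_n as a polynomial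
    in x + 1/x. *)
Definition sympol (n : nat) (e : C) : {poly C} :=
  \prod_(i < n) ((1 + (e * q ^+ i) ^+ 2)%:P - (e * q ^+ i) *: 'X).

Lemma size_sympol n e : e != 0 -> size (sympol n e) = n.+1.
Proof.
move=> e0; elim: n => [|n ih]; first by rewrite /sympol big_ord0 size_poly1.
have s2 : size ((1 + (e * q ^+ n) ^+ 2)%:P - (e * q ^+ n) *: 'X : {poly C}) = 2.
  rewrite addrC -scaleNr size_addl size_scale ?oppr_eq0 ?mulf_neq0 ?expf_neq0// size_polyX//.
  by rewrite (leq_ltn_trans (size_polyC_leq1 _)).
have n0 : sympol n e != 0 by rewrite -size_poly_gt0 ih.
rewrite /sympol big_ord_recr/= -/(sympol n e) size_mul ?ih ?s2 ?addn2//.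
by rewrite -size_poly_gt0 s2.
Qed.

Lemma coef_sympol n e : e != 0 -> (sympol n e)`_n = (- e) ^+ n * \prod_(i < n) q ^+ i.
Proof.
move=> e0; elim: n => [|n ih]; first by rewrite /sympol !big_ord0 coef1 mulr1.
rewrite /sympol !big_ord_recr/= -/(sympol n e) mulrBr coefB coefMC -scalerAr coefZ coefMX/=.
rewrite ih nth_default ?size_sympol// mul0r exprS; ring.
Qed.

Hypothesis l_mom : forall k j, l (sympol k a * sympol j b) * fpoch q (k + j) E =
  fpoch q (k + j) (a * b) * fpoch q k (a * c) * fpoch q k (a * d) *
  fpoch q j (b * c) * fpoch q j (b * d) * l0.

Lemma l_zero : l 0 = 0.
Proof. by have := l_lin (-1) 0 0; rewrite scaler0 addr0 mulN1r addNr. Qed.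

Lemma lZ k p : l (k *: p) = k * l p.
Proof. by rewrite -[k *: p]addr0 l_lin l_zero addr0. Qed.

Lemma l_sum n (f : nat -> {poly C}) : l (\sum_(i < n) f i) = \sum_(i < n) l (f i).
Proof.
elim: n => [|n ih]; first by rewrite !big_ord0 l_zero.
by rewrite !big_ord_recr/= [X in l X]addrC -[X in l (X + _)]scale1r l_lin ih mul1r addrC.
Qed.

(** [sympol j b] has degree exactly j, so top coefficients can be removed one at a time. *)
Lemma l_orth_lower (r : {poly C}) m : (forall j, (j < m)%N -> l (r * sympol j b) = 0) ->
  forall s : {poly C}, (size s <= m)%N -> l (r * s) = 0.
Proof.
move=> rj; elim: m rj => [|m ih] rj s sm.
  by move: sm; rewrite leqn0 size_poly_eq0 => /eqP ->; rewrite mulr0 l_zero.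
have lead0 : (sympol m b)`_m != 0.
  rewrite coef_sympol// mulf_neq0 ?expf_neq0 ?oppr_eq0//.
  by apply/prodf_neq0 => i _; rewrite expf_neq0.
pose k := s`_m / (sympol m b)`_m; pose s' := - k *: sympol m b + s.
have -> : s = k *: sympol m b + s' by rewrite /s' scaleNr addrA subrr add0r.
rewrite mulrDr -scalerAr l_lin rj// mulr0 add0r ih//; first by move=> j jm; rewrite rj// ltnW.
apply/leq_sizeP => j; rewrite leq_eqVlt => /orP[/eqP <-|mj].
  by rewrite coefD coefZ /k mulNr divfK// addNr.
rewrite coefD coefZ !nth_default ?mulr0 ?addr0// ?size_sympol//.
exact: leq_trans sm mj.
Qed.

(** (e y; q)_n as a polynomial in y, to be evaluated at y = q^k, where [qdiff] acts. *)
Let fp (n : nat) (e : C) : {poly C} := \prod_(i < n) (1 - (e * q ^+ i) *: 'X).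

Let fpE n e y : (fp n e).[y] = fpoch q n (e * y).
Proof.
rewrite /fp /fpoch horner_prod; apply: eq_bigr => i _.
by rewrite !hornerE; ring.
Qed.

Let size_fp n e : (size (fp n e) <= n.+1)%N.
Proof.
elim: n => [|n ih]; first by rewrite /fp big_ord0 size_poly1.
rewrite /fp big_ord_recr/=; apply: (leq_trans (size_polyMleq _ _)).
have s2 : (size (1 - (e * q ^+ n) *: 'X : {poly C})%R <= 2)%N.
  rewrite (leq_trans (size_polyD _ _))// geq_max size_poly1/= size_polyN.
  by rewrite (leq_trans (size_scale_leq _ _))// size_polyX.
by rewrite -subn1 leq_subLR add1n -addn2 leq_add.
Qed.

Let fn0 e n : (forall j, e * q ^+ j != 1) -> fpoch q n e != 0.
Proof. by move=> e1; apply/prodf_neq0 => i _; rewrite subr_eq0 eq_sym. Qed.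

(* [r] below is a multiple of the Askey-Wilson polynomial as a 4phi3 series;
   its orthogonality to [sympol j b] is the q-Saalschutz summation, read as a
   q-difference of order m of a rational function of q^k. *)
Lemma monic_orthogonal_norm n (p : {poly C}) : p \is monic -> size p = n.+2 ->
  (forall r : {poly C}, (size r <= n.+1)%N -> l (p * r) = 0) ->
  l (p * p) * (fpoch q (n.+1 + n.+1) E * fpoch q n.+1 (E * q ^+ n)) =
  l0 * (fpoch q n.+1 q * (fpoch q n.+1 (a * b) * fpoch q n.+1 (a * c) *
    fpoch q n.+1 (a * d) * fpoch q n.+1 (b * c) * fpoch q n.+1 (b * d) *
    fpoch q n.+1 (c * d))).
Proof.
move=> pm ps porth; set m := n.+1 in ps porth *; set u := E * q ^+ n.
have [cf cfE cfm] := qdiff_coef q0 m.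
pose w k := fpoch q k u / (fpoch q k (a * b) * fpoch q k (a * c) * fpoch q k (a * d)).
pose r : {poly C} := \sum_(k < m.+1) (cf k * w k) *: sympol k a.
have fE k := fn0 k E1; have fab k := fn0 k ab1; have fac k := fn0 k ac1; have fad k := fn0 k ad1.
have u1 j : u * q ^+ j != 1 by rewrite /u -mulrA -exprD.
have fu k := fn0 k u1.
have u0 : u != 0 by rewrite !mulf_neq0// expf_neq0.
have lr s : l (r * s) = qdiff q m (fun k => w k * l (sympol k a * s)) 0.
  rewrite cfE /r mulr_suml (l_sum m.+1 (fun k => (cf k * w k) *: sympol k a * s)).
  by apply: eq_bigr => k _; rewrite -scalerAl lZ add0n mulrA.
have momE k j : w k * l (sympol k a * sympol j b) =
    l0 * (fpoch q j (b * c) * fpoch q j (b * d)) *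
    (fpoch q k u / fpoch q (k + j) E * fpoch q j (a * b * q ^+ k)).
  have := l_mom k j => /(canRL (mulfK (fE _))) ->; rewrite /w (fpochD q k j (a * b)).
  by field; rewrite fE fab fac fad.
have rorth j : (j < m)%N -> l (r * sympol j b) = 0.
  move=> jm; rewrite lr.
  (* For j <= n the quotient of factorials in [momE] is a polynomial in q^k of degree at most n,
     killed by a difference of order n + 1. *)
  pose Q := fp (n - j) (E * q ^+ j) * fp j (a * b).
  rewrite (@qdiff_ext R q m _ (fun k => (l0 * (fpoch q j (b * c) * fpoch q j (b * d)) / fpoch q n E) *
     Q.[q ^+ k])).
    rewrite qdiffZ qdiff_horner ?mulr0//.
    apply: (leq_trans (size_polyMleq _ _)).
    have := size_fp (n - j) (E * q ^+ j); have := size_fp j (a * b); rewrite /m; lia.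
  move=> k; rewrite momE /Q hornerM !fpE.
  have : fpoch q (k + j) E * fpoch q (n - j) (E * q ^+ j * q ^+ k) = fpoch q n E * fpoch q k u.
    rewrite /u -(mulrA E) -exprD (addnC j k) -!fpochD; congr fpoch; rewrite /m in jm; lia.
  move=> H; rewrite -[X in X / _](mulKf (fE n)) -H.
  by field; rewrite !fE.
have lower := l_orth_lower rorth.
have pcoef : p`_m = 1 by have /monicP := pm; rewrite lead_coefE ps.
have T0 : \prod_(i < m) q ^+ i != 0 by apply/prodf_neq0 => i _; rewrite expf_neq0.
pose T := \prod_(i < m) q ^+ i.
have rcoef : r`_m = w m * a ^+ m.
  rewrite /r coef_sum big_ord_recr/= big1 ?add0r => [|i _]; last first.
    by rewrite coefZ nth_default ?mulr0// size_sympol.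
  rewrite coefZ coef_sympol// exprNn.
  transitivity (w m * a ^+ m * ((-1) ^+ m * (cf m * T))); first by rewrite /T; ring.
  by rewrite /T cfm -exprMn mulrNN mulr1 expr1n mulr1.
have rsize : (size r <= m.+1)%N.
  apply/leq_sizeP => j mj; rewrite /r coef_sum big1// => i _.
  by rewrite coefZ nth_default ?mulr0// size_sympol// (leq_trans (ltn_ord i)).
(* [p] and [r] are both orthogonal to lower degrees, so up to leading coefficients the norm of [p]
   is the single value l(r (bx, b/x)_m), computed in [e3]. *)
have e1 : l (r * p) = w m * a ^+ m * l (p * p).
  have -> : r = (w m * a ^+ m) *: p + (- (w m * a ^+ m) *: p + r).
    by rewrite scaleNr addrA subrr add0r.
  rewrite mulrDl -scalerAl l_lin [(_ + r) * p]mulrC (porth (- (w m * a ^+ m) *: p + r)) ?addr0//.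
  apply/leq_sizeP => j; rewrite leq_eqVlt => /orP[/eqP <-|mj].
    by rewrite coefD coefZ pcoef rcoef mulr1 addNr.
  rewrite coefD coefZ !nth_default ?mulr0 ?addr0// ?ps//.
  exact: leq_trans rsize mj.
have e2 : l (r * sympol m b) = (- b) ^+ m * T * l (r * p).
  have -> : sympol m b = ((- b) ^+ m * T) *: p + (- ((- b) ^+ m * T) *: p + sympol m b).
    by rewrite scaleNr addrA subrr add0r.
  rewrite mulrDr -scalerAr l_lin lower ?addr0//.
  apply/leq_sizeP => j; rewrite leq_eqVlt => /orP[/eqP <-|mj].
    by rewrite coefD coefZ pcoef coef_sympol// mulr1 addNr.
  by rewrite coefD coefZ !nth_default ?mulr0 ?addr0// ?ps ?size_sympol.
have e3 : l (r * sympol m b) = l0 * (fpoch q m (b * c) * fpoch q m (b * d)) / fpoch q n E *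
    (((- (a * b)) ^+ m * T * fpoch q m (c * d)) * fpoch q m q / fpoch q m.+1 u).
  (* For j = m one denominator 1 - u q^k survives. Division by y - 1/u leaves a quotient of degree
     below m, which the difference kills, and the constant Q(1/u) times a simple fraction. *)
  pose Q := fp m (a * b).
  have [Q2 HQ2] : exists Q2, Q - (Q.[u^-1])%:P = Q2 * ('X - (u^-1)%:P).
    by apply/factor_theorem; rewrite rootE !hornerE subrr.
  have Qsz : (size Q2 <= m)%N.
    have [->|Q20] := eqVneq Q2 0; first by rewrite size_poly0.
    have : (size (Q2 * ('X - (u^-1)%:P))%R <= m.+1)%N.
      rewrite -HQ2 (leq_trans (size_polyD _ _))// geq_max size_fp size_polyN.
      by rewrite (leq_trans (size_polyC_leq1 _)).
    by rewrite size_Mmonic ?monicXsubC// size_XsubC addn2.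
  have u1' j : 1 - u * q ^+ j != 0 by rewrite subr_eq0 eq_sym.
  rewrite lr (@qdiff_ext R q m _ (fun k => (l0 * (fpoch q m (b * c) * fpoch q m (b * d)) / fpoch q n E) *
     (Q.[u^-1] * (1 - u * q ^+ k)^-1 + (- u^-1 *: Q2).[q ^+ k]))); last first.
    move=> k; rewrite momE.
    have H1 : fpoch q m (a * b * q ^+ k) = Q.[u^-1] + Q2.[q ^+ k] * (q ^+ k - u^-1).
      by have := congr1 (fun z : {poly C} => z.[q ^+ k]) HQ2; rewrite !hornerE fpE => <-; ring.
    have H2 : fpoch q (k + m) E = fpoch q n E * fpoch q k u * (1 - u * q ^+ k).
      by rewrite -(mulrA (fpoch q n E)) -fpochS /u -fpochD; congr fpoch; rewrite /m; lia.
    by rewrite H1 H2 hornerZ; field; rewrite u0 u1' fE fu.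
  rewrite qdiffZ qdiff_lin qdiff_horner ?(leq_trans (size_scale_leq _ _))// addr0.
  rewrite qdiff_geometric// expr0 expr1n !mulr1 fpE; congr (_ * _).
  (* Since ab/u = q^(-n)/(cd), reversing the order of the factors of (ab/u; q)_m gives (cd; q)_m. *)
  have -> : (- (a * b)) ^+ m * T * fpoch q m (c * d) = fpoch q m (a * b * u^-1) * u ^+ m.
    have powE (x : C) : x ^+ m = \prod_(i < m) x by rewrite prodr_const card_ord.
    rewrite /T /fpoch (powE (- (a * b))) (powE u).
    rewrite [X in _ * X](reindex_inj rev_ord_inj)/= -!big_split/=; apply: eq_bigr => i _.
    rewrite /u; have -> : q ^+ n = q ^+ i * q ^+ (m - i.+1).
      by rewrite -exprD; congr (_ ^+ _); have := ltn_ord i; rewrite /m; lia.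
    by field; rewrite a0 b0 c0 d0 !expf_neq0.
  by ring.
move: e3; rewrite e2 e1.
have -> : fpoch q (m + m) E = fpoch q n E * fpoch q m.+1 u.
  by rewrite /u -fpochD; congr fpoch; rewrite /m; lia.
rewrite /w exprNn [(- (a * b)) ^+ m]exprNn exprMn.
move=> H.
have nz : (-1) ^+ m * b ^+ m * T * a ^+ m != 0.
  by rewrite !mulf_neq0 ?expf_neq0// oppr_eq0 oner_eq0.
apply: (mulfI nz).
move: H (fE n) (fu m.+1) (fu m) (fab m) (fac m) (fad m).
set x1 := fpoch q n E; set x2 := fpoch q m.+1 u; set x3 := fpoch q m u.
set y1 := fpoch q m (a * b); set y2 := fpoch q m (a * c); set y3 := fpoch q m (a * d).
set s1 := (-1) ^+ m; set bm := b ^+ m; set am := a ^+ m.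
move=> H n1 n2 n3 n4 n5 n6.
transitivity ((s1 * bm * T * (x3 / (y1 * y2 * y3) * am * l (p * p))) *
  (y1 * y2 * y3) * (x1 * x2)); first by field; rewrite n4 n5 n6.
by rewrite H; field; rewrite ?n1 ?n2.
Qed.

End Norm.

(** * Symmetric and antisymmetric parts *)

Section SymmetricLaurent.
Variable R : realType.
Local Notation C := R[i].

Lemma sympoly_eq0 (r : {poly C}) : (forall x, x != 0 -> r.[x + x^-1] = 0) -> r = 0.
Proof.
move=> r0; apply/eqP; apply/negPn/negP => rn0.
(* These values are distinct: x + 1/x = y + 1/y forces x = y or xy = 1, and for positive integers
   the latter means x = y = 1. *)
pose z (i : nat) : C := i.+1%:R + (i.+1%:R)^-1.
have := max_poly_roots (rs := [seq z i | i <- iota 0 (size r)]) rn0.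
rewrite size_map size_iota ltnn => H; suff : false by []; apply: H.
  by apply/allP => _ /mapP[i _ ->]; rewrite rootE r0// pnatr_eq0.
rewrite map_inj_uniq ?iota_uniq// => i j; rewrite /z => zij.
have i0 : i.+1%:R != 0 :> C by rewrite pnatr_eq0.
have j0 : j.+1%:R != 0 :> C by rewrite pnatr_eq0.
have : (i.+1%:R - j.+1%:R) * (i.+1%:R * j.+1%:R - 1) = 0 :> C.
  transitivity (i.+1%:R * j.+1%:R * ((i.+1%:R + i.+1%:R^-1) - (j.+1%:R + j.+1%:R^-1)) : C).
    by move: i0 j0; move: (i.+1%:R : C) (j.+1%:R : C) => u v u0 v0; field; rewrite u0 v0.
  by rewrite zij subrr mulr0.
move/eqP; rewrite mulf_eq0 !subr_eq0 eqr_nat -natrM -[1 in X in _ || X]/(1%:R) eqr_nat.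
by case/orP => /eqP; nia.
Qed.

Lemma sympoly_clear (r : {poly C}) N : (size r <= N.+1)%N ->
  exists2 Q : {poly C}, (size Q <= N.*2.+1)%N &
    forall x, x != 0 -> r.[x + x^-1] * x ^+ N = Q.[x].
Proof.
elim: N r => [|N ih] r rN.
  exists r => // x _; rewrite mulr1.
  by have /size1_polyC -> := rN; rewrite !hornerC.
have [|Q QN QE] := ih (\poly_(i < N.+1) r`_i); first exact: size_poly.
exists (r`_N.+1 *: ('X^2 + 1) ^+ N.+1 + Q * 'X).
  rewrite (leq_trans (size_polyD _ _))// geq_max; apply/andP; split.
    rewrite (leq_trans (size_scale_leq _ _))// (leq_trans (size_exp_leq _ _))//.
    by rewrite size_XnaddC// /=; lia.
  by rewrite (leq_trans (size_polyMleq _ _))// size_polyX; lia.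
move=> x x0; rewrite hornerD hornerZ hornerM hornerX -QE// horner_exp !hornerE.
have Er : r = \poly_(i < N.+1) r`_i + r`_N.+1 *: 'X^(N.+1).
  apply/polyP => i; rewrite coefD coef_poly coefZ coefXn.
  case: (ltngtP i N.+1) => [iN|iN|->]; rewrite ?mulr0 ?addr0 ?mulr1 ?add0r//.
  by rewrite nth_default// (leq_trans rN).
rewrite [X in X.[_] * _ = _]Er hornerD hornerZ hornerXn.
have -> : x ^+ 2 + 1 = (x + x^-1) * x by rewrite mulrDl mulVf// expr2.
by rewrite exprMn [x ^+ N.+1]exprS; ring.
Qed.

(** Q(x)/x^m is a general Laurent polynomial with exponents between -m and m. Each induction step
    removes its two extreme coefficients with one symmetric and one antisymmetric term; the last
    clause records them for later normalisations. *)
Lemma sym_decomp (a b : C) m (Q : {poly C}) : a * b != 1 -> (size Q <= m.*2.+1)%N ->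
  exists p s : {poly C}, [/\ (size p <= m.+1)%N, (size s <= m)%N,
    (forall x, x != 0 -> Q.[x] = x ^+ m * (p.[x + x^-1] +
       x^-1 * ((1 - a * x) * (1 - b * x)) * s.[x + x^-1])) &
    (0 < m)%N -> p`_m + a * b * s`_m.-1 = Q`_m.*2 /\ p`_m + s`_m.-1 = Q`_0].
Proof.
move=> ab1; have ab0 : 1 - a * b != 0 by rewrite subr_eq0 eq_sym.
elim: m Q => [|m ih] Q Qm.
  exists Q, 0; split => //; first by rewrite size_poly0.
  by move=> x x0; have /size1_polyC -> := Qm; rewrite !hornerC mulr0 addr0 mul1r.
(* Solves ph + sh = Q_0 and ph + ab sh = Q_(2m+2), which makes both end coefficients of [Q'] vanish.
   Below, [F] is (1 - aX)(1 - bX), and [M] evaluates to x^m (x + 1/x)^m. *)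
pose sh := (Q`_0 - Q`_m.+1.*2) / (1 - a * b); pose ph := Q`_0 - sh.
pose M : {poly C} := ('X^2 + 1) ^+ m.
pose F : {poly C} := (a * b) *: 'X^2 - (a + b) *: 'X + 1.
pose Q' := Q - (ph *: (M * ('X^2 + 1)) + sh *: (M * F)).
have X21 : ('X^2 + 1 : {poly C}) \is monic by rewrite monicE lead_coefDl ?lead_coefXn// size_polyXn size_poly1.
have sX21 : size ('X^2 + 1 : {poly C}) = 3 by rewrite size_XnaddC.
have Mm : M \is monic by exact: monic_exp.
have sM : size M = m.*2.+1.
  rewrite /M; elim: (m) => [|k ihk]; first by rewrite expr0 size_poly1.
  by rewrite exprS size_monicM ?sX21 ?ihk ?monic_neq0 ?monic_exp// doubleS.
have M1 : M`_m.*2 = 1 by have /monicP := Mm; rewrite lead_coefE sM.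
have M00 : M`_0 = 1 by rewrite -horner_coef0 horner_exp !hornerE expr0n add0r expr1n.
have MX k : (M * ('X^2 + 1))`_k.+2 = M`_k + M`_k.+2.
  by rewrite mulrDr mulr1 coefD coefMXn/= !subSS subn0.
have MF k : (M * F)`_k.+2 = a * b * M`_k - (a + b) * M`_k.+1 + M`_k.+2.
  by rewrite /F mulrDr mulr1 mulrBr -!scalerAr coefD coefB !coefZ coefMXn coefMX/= !subSS subn0.
have MX0 : (M * ('X^2 + 1))`_0 = 1.
  by rewrite mulrDr mulr1 coefD coefMXn/= add0r.
have MF0 : (M * F)`_0 = 1.
  by rewrite /F mulrDr mulr1 mulrBr -!scalerAr coefD coefB !coefZ coefMXn coefMX/= !mulr0 subr0 add0r.
have Q'0 : Q'`_0 = 0.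
  by rewrite /Q' coefB coefD !coefZ MX0 MF0 !mulr1 /ph subrK subrr.
have Q'h k : (m.*2.+1 < k)%N -> Q'`_k = 0.
  case: k => [//|[//|k]]; rewrite !ltnS /Q' coefB coefD !coefZ MX MF leq_eqVlt => /orP[/eqP <-|mk].
    rewrite M1 !(nth_default 0 (s := M)) ?sM// mulr0 subr0 !addr0 !mulr1.
    rewrite -doubleS /ph /sh; set u := Q`_0; set v := Q`_ _.
    by field.
  rewrite !(nth_default 0 (s := M)) ?sM ?mulr0 ?subr0 ?addr0 ?mulr0 ?subr0; try lia.
  by rewrite addr0 subr0 nth_default// (leq_trans Qm)// doubleS !ltnS.
pose Q2 := \poly_(i < m.*2.+1) Q'`_i.+1.
have Q'E : Q' = Q2 * 'X.
  apply/polyP => -[|k]; first by rewrite coefMX.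
  by rewrite coefMX/= coef_poly; case: ltnP => // mk; rewrite Q'h.
have [|p [s [ps ss E _]]] := ih Q2; first exact: size_poly.
exists (ph *: 'X^(m.+1) + p), (sh *: 'X^m + s); split.
- rewrite (leq_trans (size_polyD _ _))// geq_max (leq_trans (size_scale_leq _ _)) ?size_polyXn//.
  exact: leqW.
- rewrite (leq_trans (size_polyD _ _))// geq_max (leq_trans (size_scale_leq _ _)) ?size_polyXn//.
  exact: leqW.
- move=> x x0.
  have -> : Q = Q2 * 'X + (ph *: (M * ('X^2 + 1)) + sh *: (M * F)) by rewrite -Q'E subrK.
  rewrite !(hornerD, hornerZ, hornerM, hornerX, hornerXn) E// /M horner_exp /F.
  rewrite !(hornerD, hornerZ, hornerM, hornerX, hornerXn, hornerN, hornerC).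
  have -> : x ^+ 2 + 1 = (x + x^-1) * x by rewrite mulrDl mulVf// expr2.
  rewrite exprMn !exprS; set zm := (x + x^-1) ^+ m; set xm := x ^+ m.
  set u := p.[_]; set v := s.[_]; by field.
- move=> _ /=; rewrite !coefD !coefZ !coefXn !eqxx !mulr1.
  rewrite [p`_m.+1]nth_default// [s`_m]nth_default// !addr0 /ph /sh.
  by split; field.
Qed.

Lemma leval_lmono m x : leval (lmono R m) x = x ^ m.
Proof.
rewrite (@leval_fset _ _ [fset m]%fset).
  by rewrite big_seq_fset1 /= eqxx mul1r.
by move=> n; rewrite inE /= => /negPf ->.
Qed.

Lemma laurent_of_poly (Q : {poly C}) m : (size Q <= m.*2.+1)%N -> exists2 f : laurent R,
  (forall x, x != 0 -> leval f x * x ^+ m = Q.[x]) &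
  forall n : int, (m < `|n|)%N -> f n = 0.
Proof.
move=> Qm.
have H N : (N <= m.*2.+1)%N -> exists2 f : laurent R,
  (forall x, x != 0 -> leval f x * x ^+ m = \sum_(i < N) Q`_i * x ^+ i) &
  forall n : int, (m < `|n|)%N -> f n = 0.
  elim: N => [_|N ih Nm].
    exists 0 => // x x0; rewrite big_ord0.
    by have := @leval_fset _ (0 : laurent R) fset0 x => ->; rewrite ?big_seq_fset0 ?mul0r.
  have [f fE f0] := ih (ltnW Nm).
  exists (Q`_N *: lmono R (N%:Z - m%:Z) + f) => [x x0|n mn].
    rewrite levalP mulrDl fE// big_ord_recr/= addrC leval_lmono; congr (_ + _).
    by rewrite -mulrA expfzDr// -exprnN -mulrA mulVf ?mulr1// expf_neq0.
  change (Q`_N * (n == N%:Z - m%:Z)%:R + f n = 0); rewrite f0// addr0.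
  by case: eqP => [nE|_]; rewrite ?mulr0//; exfalso; lia.
have [//|f fE f0] := H (size Q); exists f => // x x0.
by rewrite fE// horner_coef.
Qed.

End SymmetricLaurent.

Section SymmetricFactors.
Variable R : realType.
Local Notation C := R[i].
Variable q : C.

Lemma isL_fpoch n F : isL F -> isL (fun x => fpoch q n (F x)).
Proof.
move=> FL; rewrite /fpoch; apply: isL_prod => j.
by apply: isL_sub; [exact: isL_cst|apply: isL_mul => //; exact: isL_cst].
Qed.

Definition symfac n a x := fpoch q n (a * x) * fpoch q n (a / x).

Lemma isL_symfac n a : isL (symfac n a).
Proof.
apply: isL_mul; apply: isL_fpoch; apply: isL_scale; [exact: isL_id|exact: isL_V].
Qed.

Lemma sympolE n e x : x != 0 -> (sympol q n e).[x + x^-1] = symfac n e x.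
Proof.
move=> x0; rewrite /sympol /symfac /fpoch horner_prod -big_split/=.
apply: eq_bigr => i _; rewrite !hornerE; set y := q ^+ i.
by field.
Qed.

Definition Wsym (x : C) := (1 - x ^+ 2) * (1 - x ^- 2).

Lemma isL_Wsym : isL Wsym.
Proof.
apply: isL_mul; apply: isL_sub; try exact: isL_cst.
  exact/isL_exp/isL_id.
exact/isL_expV/isL_V.
Qed.

Lemma isL_sympoly (r : {poly C}) : isL (fun x : C => r.[x + x^-1]).
Proof. by apply: isL_horner; apply: isL_add; [exact: isL_id|exact: isL_V]. Qed.

Lemma isL_Wsympoly (r : {poly C}) : isL (fun x : C => Wsym x * r.[x + x^-1]).
Proof. by apply: isL_mul; [exact: isL_Wsym|exact: isL_sympoly]. Qed.

End SymmetricFactors.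

Arguments Wsym {R} x.

Section Decomposition.
Variable R : realType.
Local Notation C := R[i].
Local Notation A := (laurent R).

Lemma leval0 x : leval (0 : laurent R) x = 0.
Proof.
have := levalP (0 : laurent R) 0 1 x; rewrite scale1r add0r mul1r => /esym/eqP.
by rewrite -subr_eq0 addrK => /eqP.
Qed.

Lemma levalZ (k : C) (f : A) x : leval (k *: f) x = k * leval f x.
Proof. by rewrite -[k *: f]addr0 levalP leval0 addr0. Qed.

(** Its products with symmetric Laurent polynomials are eigenfunctions of T1 for the eigenvalue
    -1/k1. *)
Definition antifac (a b x : C) := x^-1 * ((1 - a * x) * (1 - b * x)).

Lemma laurent_decomp (a b : C) (f : A) m : a * b != 1 ->
  (forall n : int, (m < `|n|)%N -> f n = 0) ->
  exists p s : {poly C}, [/\ (size p <= m.+1)%N, (size s <= m)%N,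
    (forall x, x != 0 -> leval f x = p.[x + x^-1] + antifac a b x * s.[x + x^-1]) &
    (0 < m)%N -> p`_m + a * b * s`_m.-1 = f m%:Z /\ p`_m + s`_m.-1 = f (- m%:Z)].
Proof.
move=> ab1 fm; have [//||p [s [ps ss E co]]] := @sym_decomp _ a b m (\poly_(i < m.*2.+1) f (i%:Z - m%:Z)).
  exact: size_poly.
exists p, s; split => // [x x0|m0].
  by apply: (mulIf (expf_neq0 m x0)); rewrite leval_poly// E// mulrC.
have [-> ->] := co m0; rewrite !coef_poly ltnS leqnn /=; split; congr (lcoef f _); lia.
Qed.

Lemma factors_sympoly_eq0 (a b : C) (s : {poly C}) : a != 0 -> b != 0 ->
  (forall x, x != 0 -> antifac a b x * s.[x + x^-1] = 0) -> s = 0.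
Proof.
move=> a0 b0 es0.
(* Multiplying by x (1 - a/x)(1 - b/x) makes the factor symmetric. With a single factor in each
   [sympol] the base does not matter and is set to 1. *)
have : sympol 1 1 a * sympol 1 1 b * s = 0.
  apply: sympoly_eq0 => x x0; rewrite !hornerM !sympolE// /symfac /fpoch !big_ord1 !expr0 !mulr1.
  transitivity ((1 - a / x) * (1 - b / x) * x * (antifac a b x * s.[x + x^-1])).
    by rewrite /antifac; field.
  by rewrite es0// mulr0.
move/eqP; rewrite !mulf_eq0 => /orP[/orP[]|/eqP//].
  by rewrite -size_poly_eq0 size_sympol ?oner_eq0.
by rewrite -size_poly_eq0 size_sympol ?oner_eq0.
Qed.

Variable t : params R.
Hypothesis tk1 : k1 t != 0.
Hypothesis tu1 : u1 t != 0.
Local Notation a := (pa t).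
Local Notation b := (pb t).
Hypothesis ab1 : a * b != 1.

Let a0 : a != 0. Proof. by rewrite mulf_neq0. Qed.
Let b0 : b != 0. Proof. by rewrite oppr_eq0 mulf_neq0 ?invr_eq0. Qed.
Let k1E : k1 t ^+ 2 = - (a * b). Proof. by rewrite /pa /pb; field. Qed.
Let k1k : k1 t + (k1 t)^-1 != 0.
Proof.
have -> : k1 t + (k1 t)^-1 = (k1 t ^+ 2 + 1) / k1 t by field.
by rewrite mulf_neq0 ?invr_eq0// k1E addrC subr_eq0 eq_sym.
Qed.

Lemma T1_decomp (f : A) p s :
  (forall x, x != 0 -> leval f x = p.[x + x^-1] + antifac a b x * s.[x + x^-1]) ->
  forall x, x != 0 ->
    leval (T1 t f) x = k1 t * p.[x + x^-1] - (k1 t)^-1 * (antifac a b x * s.[x + x^-1]).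
Proof.
move=> fE x x0.
(* The symmetric part has divided difference 0, and [antifac] at 1/y minus [antifac] at y equals (1
   - ab)(y - 1/y). *)
rewrite (@T1_eval _ _ tk1 tu1 f (fun y => (1 - a * b) * (s.[y + y^-1] * y^-1)))//; last split.
- rewrite fE// /T1num /antifac; have -> : a * b = - k1 t ^+ 2 by rewrite k1E opprK.
  by set u := p.[_]; set v := s.[_]; field; rewrite x0 tk1.
- by apply: isL_scale; apply: isL_mul; [exact: isL_sympoly|exact: isL_V].
- move=> y y0; have y0' : 1 / y != 0 by rewrite mulf_neq0 ?invr_eq0.
  rewrite !fE// div1r invrK (addrC y^-1) /antifac.
  by set u := p.[_]; set v := s.[_]; field.
- move=> y y0; rewrite div1r invrK (addrC y^-1) divr1.
  by set v := s.[_]; field.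
Qed.

(** The two eigenvalues of T1 differ: k1 + 1/k1 is nonzero because k1^2 = -ab and ab is not 1. *)
Lemma T1_plus (f : A) p s :
  (forall x, x != 0 -> leval f x = p.[x + x^-1] + antifac a b x * s.[x + x^-1]) ->
  T1 t f = k1 t *: f -> s = 0.
Proof.
move=> fE Tf; apply: (factors_sympoly_eq0 a0 b0) => x x0.
have := T1_decomp fE x0; rewrite Tf levalZ fE// mulrDr => /eqP.
rewrite -subr_eq0 => /eqP H.
have {}H : (k1 t + (k1 t)^-1) * (antifac a b x * s.[x + x^-1]) = 0 by rewrite -[RHS]H; ring.
by move/eqP: H; rewrite mulf_eq0 (negbTE k1k) => /eqP.
Qed.

Lemma T1_minus (f : A) p s :
  (forall x, x != 0 -> leval f x = p.[x + x^-1] + antifac a b x * s.[x + x^-1]) ->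
  T1 t f = - (k1 t)^-1 *: f -> p = 0.
Proof.
move=> fE Tf; apply: sympoly_eq0 => x x0.
have := T1_decomp fE x0; rewrite Tf levalZ fE// mulrDr => /eqP.
rewrite -subr_eq0 => /eqP H.
have {}H : (k1 t + (k1 t)^-1) * p.[x + x^-1] = 0 by rewrite -[RHS]oppr0 -[in RHS]H; ring.
by move/eqP: H; rewrite mulf_eq0 (negbTE k1k) => /eqP.
Qed.

End Decomposition.

(** Orthogonality to lower degrees lets p', and then p itself, be replaced by its top coefficient
    times the monic q. No orthogonality of p' is required, and p may have lower degree. *)
Lemma orth_expand (F : fieldType) (l : {poly F} -> F) n (q p p' : {poly F}) :
  (forall k p r, l (k *: p + r) = k * l p + l r) ->
  (size p <= n.+1)%N -> (size p' <= n.+1)%N -> (size q <= n.+1)%N -> q`_n = 1 ->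
  (forall r : {poly F}, (size r <= n)%N -> l (p * r) = 0) ->
  (forall r : {poly F}, (size r <= n)%N -> l (q * r) = 0) ->
  l (p * p') = p`_n * p'`_n * l (q * q).
Proof.
move=> l_lin sp sp' sq qn po qo.
have low (r : {poly F}) : (size r <= n.+1)%N -> (size (- r`_n *: q + r)%R <= n)%N.
  move=> sr; apply/leq_sizeP => j; rewrite leq_eqVlt => /orP[/eqP <-|nj].
    by rewrite coefD coefZ qn mulr1 addNr.
  by rewrite coefD coefZ (nth_default 0 (leq_trans sq nj)) (nth_default 0 (leq_trans sr nj)) mulr0 addr0.
have dec (r : {poly F}) : r = r`_n *: q + (- r`_n *: q + r).
  by rewrite scaleNr addrA subrr add0r.
rewrite {1}[p']dec mulrDr -scalerAr l_lin (po _ (low _ sp')) addr0.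
have e : l (q * p) = p`_n * l (q * q).
  by rewrite {1}(dec p) mulrDr -scalerAr l_lin (qo _ (low _ sp)) addr0.
by rewrite [p * q]mulrC e mulrCA mulrA.
Qed.

Lemma mono_rank_abs_lt (m : nat) (n : int) : (m < `|n|)%N -> (mono_rank m%:Z < mono_rank n)%N.
Proof. by case: n => n mn /=; [rewrite ltn_double | rewrite ltnS leq_double]. Qed.

Lemma mono_rank_le_abs (j n : int) : (mono_rank j <= mono_rank n)%N -> (`|j| <= `|n|)%N.
Proof. by case: j n => j [n|n] /=; lia. Qed.

Section LeadingSupport.
Variable R : realType.
Implicit Type f : laurent R.

Lemma leading_supp m f : leading m%:Z f -> forall n : int, (m < `|n|)%N -> f n = 0.
Proof. by move=> [_ fl] n /mono_rank_abs_lt; exact: fl. Qed.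

(** In the monomial order x^m comes after x^(-m), so its coefficient in P_(-m) is 0; this is the
    second equation for the leading coefficients. *)
Lemma leadingN_supp m f : (0 < m)%N -> leading (- m%:Z) f ->
  f m%:Z = 0 /\ forall n : int, (m < `|n|)%N -> f n = 0.
Proof.
case: m => // m _ [_ fl]; split; first by apply: fl; rewrite /= doubleS.
move=> n mn; apply: fl; case: n mn => n mn /=; last by rewrite ltnS ltn_double.
by rewrite ltn_Sdouble ltnW.
Qed.

Lemma size_polyM_double (F Q : {poly R[i]}) m : (size F <= 3)%N -> (size Q <= m.*2.+1)%N ->
  (size (F * Q)%R <= m.+1.*2.+1)%N.
Proof. by have := size_polyMleq F Q; lia. Qed.

End LeadingSupport.

(** * Linear algebra in the span of P_m and P_(-m) *)

Section Pairing.
(** Here e = ab, [H] and [H1] are the norms of the monic symmetric and antisymmetric polynomials,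
    and (x1, y1), (x2, y2) are the top coefficients of the two parts of P_m and P_(-m), with primes
    for the dual polynomials. The hypotheses [c1] to [c3'] read off the coefficients of x^m and
    x^(-m). *)
Variables (F : fieldType) (e H H1 x1 y1 x1' y1' x2 y2 x2' y2' : F).
Hypothesis two0 : 2 != 0 :> F.
Hypothesis e0 : e != 0.
Hypothesis e1 : 1 - e != 0.
Hypothesis c1 : x1 + e * y1 = 1.
Hypothesis c2 : x2 + e * y2 = 0.
Hypothesis c3 : x2 + y2 = 1.
Hypothesis c1' : x1' + e^-1 * y1' = 1.
Hypothesis c2' : x2' + e^-1 * y2' = 0.
Hypothesis c3' : x2' + y2' = 1.
Local Notation pairing x x' y y' :=
  ((1 - e) / 2 * (x * x' * H) - (1 - e) / (2 * e) * (y * y' * H1)).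
Hypothesis D0 : H1 - e * H != 0.

Let y2E : y2 = (1 - e)^-1.
Proof.
apply: (mulfI e1); transitivity ((x2 + y2) - (x2 + e * y2)); first by ring.
by rewrite c3 c2 mulfV// subr0.
Qed.

Let x2E : x2 = - (e / (1 - e)).
Proof. by rewrite -[x2](addrK y2) c3 y2E; field; rewrite e1. Qed.

Let y2E' : y2' = - (e / (1 - e)).
Proof.
apply: (mulfI e1); transitivity (- (e * ((x2' + y2') - (x2' + e^-1 * y2')))).
  by field.
by rewrite c3' c2'; field.
Qed.

Let x2E' : x2' = (1 - e)^-1.
Proof. by rewrite -[x2'](addrK y2') c3' y2E'; field; rewrite e1. Qed.

Lemma pairing_bottom : pairing x2 x2' y2 y2' = (H1 - e * H) / (2 * (1 - e)).
Proof. by rewrite x2E x2E' y2E y2E'; field; rewrite e1 two0. Qed.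

(** The coefficient of x^(-m) in P_m is not prescribed; the vanishing pairings with the polynomials
    of index -m supply the missing equations. Both systems have determinant H1 - e H. *)
Lemma pairing_top : pairing x1 x2' y1 y2' = 0 -> pairing x2 x1' y2 y1' = 0 ->
  pairing x1 x1' y1 y1' = (1 - e) / 2 * (H * H1 / (H1 - e * H)).
Proof.
move=> f12 f21; have e1' : e - 1 != 0 by rewrite -opprB oppr_eq0.
have g12 : x1 * H + y1 * H1 = 0.
  rewrite -[RHS](mulr0 2) -f12 x2E' y2E'; field; rewrite ?e1 ?e0 ?two0//.
have g21 : e * x1' * H + y1' / e * H1 = 0.
  rewrite -[RHS](mulr0 (- 2)) -f21 x2E y2E; field; rewrite ?e1 ?e0 ?two0//.
have x1E : x1 = H1 / (H1 - e * H).
  apply: (mulIf D0); rewrite divfK//.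
  transitivity ((x1 + e * y1) * H1 - e * (x1 * H + y1 * H1)); first by ring.
  by rewrite c1 g12; ring.
have y1E : y1 = - H / (H1 - e * H).
  apply: (mulIf D0); rewrite divfK//.
  transitivity ((x1 * H + y1 * H1) - H * (x1 + e * y1)); first by ring.
  by rewrite c1 g12; ring.
have x1E' : x1' = H1 / (H1 - e * H).
  apply: (mulIf D0); rewrite divfK//.
  transitivity ((x1' + e^-1 * y1') * H1 - (e * x1' * H + y1' / e * H1)).
    by field.
  by rewrite c1' g21; ring.
have y1E' : y1' = - (e ^+ 2 * H) / (H1 - e * H).
  apply: (mulIf D0); rewrite divfK//.
  transitivity (e * (e * x1' * H + y1' / e * H1) - e ^+ 2 * H * (x1' + e^-1 * y1')).
    by field.
  by rewrite c1' g21; ring.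
by rewrite x1E x1E' y1E y1E'; field; rewrite ?D0 ?two0 ?e0.
Qed.

End Pairing.

(** * Rational identities between the norms *)

Section NormRatio.
(** Dictionary: e = ab, f = cd, r = q^m, w = q^(m-1), K = 2 pi i; the capitals [X] to [V] are
    infinite products, [h] and [h1] the two norms, [phi] and [phi1] the finite factorials in their
    formulas. Everything after this is field arithmetic. *)
Variables (F : fieldType) (e f r w K X B S Cd Ee V h h1 phi phi1 : F).
Hypothesis two0 : 2 != 0 :> F.
Hypothesis K0 : K != 0.
Hypothesis X0 : X != 0.
Hypothesis B0 : B != 0.
Hypothesis S0 : S != 0.
Hypothesis Cd0 : Cd != 0.
Hypothesis Ee0 : Ee != 0.
Hypothesis V0 : V != 0.
Hypothesis r1 : 1 - r != 0.
Hypothesis e1 : 1 - e != 0.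
Hypothesis er1 : 1 - e * r != 0.
Hypothesis fw1 : 1 - f * w != 0.
Hypothesis efw1 : 1 - e * f * w != 0.
Hypothesis efrw1 : 1 - e * f * r * w != 0.
Hypothesis phiE : phi * ((1 - e * f * r * w) * V) = (1 - e * f * w) * Ee.
Hypothesis phi1E : phi1 * ((1 - e * f * r * w) * V) = Ee.
Hypothesis hE : h * (X * ((1 - e * r) * B * S * Cd) * phi) = 2 * K * V.
Hypothesis h1E : h1 * ((1 - r) * X * (B * S * ((1 - f * w) * Cd)) * phi1) = 2 * K * V.

Lemma norm_ratio_plus :
  h = 2 * K * (1 - e * f * r * w) * V ^+ 2 / (X * ((1 - e * r) * B * S * Cd) * ((1 - e * f * w) * Ee)).
Proof.
have d0 : X * ((1 - e * r) * B * S * Cd) * ((1 - e * f * w) * Ee) != 0 by rewrite !mulf_neq0.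
apply: (mulIf d0); rewrite divfK// -phiE.
transitivity (h * (X * ((1 - e * r) * B * S * Cd) * phi) * ((1 - e * f * r * w) * V)); first by ring.
by rewrite hE; ring.
Qed.

Lemma norm_ratio_plusK :
  K^-1 * h = 2 * (1 - e * f * r * w) * V ^+ 2 /
    (X * ((1 - e * r) * B * S * Cd) * ((1 - e * f * w) * Ee)).
Proof. by rewrite norm_ratio_plus [2 * K]mulrC -!mulrA mulKf. Qed.

Lemma norm_ratio_minus :
  h1 = 2 * K * (1 - e * f * r * w) * V ^+ 2 / ((1 - r) * X * (B * S * ((1 - f * w) * Cd)) * Ee).
Proof.
have d0 : (1 - r) * X * (B * S * ((1 - f * w) * Cd)) * Ee != 0 by rewrite !mulf_neq0.
apply: (mulIf d0); rewrite divfK// -phi1E.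
transitivity (h1 * ((1 - r) * X * (B * S * ((1 - f * w) * Cd)) * phi1) * ((1 - e * f * r * w) * V)).
  by ring.
by rewrite h1E; ring.
Qed.

Lemma norm_ratio_minusK : e != 0 -> K^-1 * ((e - 1) / (2 * e) * h1) =
  (e - 1) / e * ((1 - e * f * r * w) * V ^+ 2 /
    ((1 - r) * X * (B * S * ((1 - f * w) * Cd)) * Ee)).
Proof.
move=> e0; rewrite norm_ratio_minus.
by field; rewrite X0 B0 S0 Cd0 Ee0 r1 fw1 two0 K0 e0.
Qed.

(* The numerator of [h1 - e * h] over the common denominator factors as
   [(1 - e * r) * (1 - e * f * w) - e * (1 - r) * (1 - f * w) = (1 - e) * (1 - e * f * r * w)]. *)
Lemma norm_ratio_diff :
  h1 - e * h = 2 * K * (1 - e) * ((1 - e * f * r * w) * V) ^+ 2 /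
    ((1 - r) * X * ((1 - e * r) * B * S * ((1 - f * w) * Cd)) * ((1 - e * f * w) * Ee)).
Proof.
rewrite norm_ratio_plus norm_ratio_minus.
by field; rewrite X0 B0 S0 Cd0 Ee0 r1 er1 fw1 efw1.
Qed.

Lemma norm_ratio_diff_neq0 : h1 - e * h != 0.
Proof. by rewrite norm_ratio_diff !(mulf_neq0, invr_eq0, expf_neq0). Qed.

Lemma norm_ratio_bottom : K^-1 * ((h1 - e * h) / (2 * (1 - e))) =
  ((1 - e * f * r * w) * V) ^+ 2 /
    ((1 - r) * X * ((1 - e * r) * B * S * ((1 - f * w) * Cd)) * ((1 - e * f * w) * Ee)).
Proof.
rewrite norm_ratio_diff.
by field; rewrite X0 B0 S0 Cd0 Ee0 r1 er1 fw1 efw1 two0 e1 K0.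
Qed.

Lemma norm_ratio_top : K^-1 * ((1 - e) / 2 * (h * h1 / (h1 - e * h))) =
  V ^+ 2 / (X * (B * S * Cd) * Ee).
Proof.
rewrite norm_ratio_diff norm_ratio_plus norm_ratio_minus.
by field; rewrite X0 B0 S0 Cd0 Ee0 r1 er1 fw1 efw1 two0 e1 K0 V0 efrw1.
Qed.

End NormRatio.

Section IntegerExponents.
Variables (F : fieldType) (q : F) (n : nat).

Lemma exprz_double_pred : q ^ (2 * n.+1%:Z - 1) = q ^+ n * q ^+ n.+1.
Proof. by rewrite -exprD exprnP; congr (_ ^ _); lia. Qed.

Lemma exprz_double : q ^ (2 * n%:Z) = q ^+ (n + n).
Proof. by rewrite exprnP; congr (_ ^ _); lia. Qed.

Lemma exprz_succ : q ^ (n%:Z + 1) = q ^+ n.+1.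
Proof. by rewrite exprnP; congr (_ ^ _); lia. Qed.

Lemma exprz_pred : q ^ (n.+1%:Z - 1) = q ^+ n.
Proof. by rewrite exprnP; congr (_ ^ _); lia. Qed.

End IntegerExponents.

(** * Winding numbers and reflection of integrals *)

Section CurveIntegral.
Variable R : realType.
Local Notation C := R[i].
Variables (g : R -> C) (L : R).
Hypothesis gc : {within `[0, 1], continuous g}.
Hypothesis g01 : g 0 = g 1.
Hypothesis gL : forall s : seq R, itv_partition 0 1 s ->
  \sum_(i < size s) normc (g (nth 0 s i) - g (nth 0 (0 :: s) i)) <= L.
Local Notation CInt := (is_contour_integral g).
Local Notation K := (curve_image g).
Local Notation on_curve := (on_curve g).
Hypothesis K0 : ~ K 0.
Hypothesis wind0 : CInt (fun x => x^-1) (two_pi_i R).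

Section Exact.

(* [G] has derivative [H] on the curve, in a strict sense and uniformly. *)
Definition primitive (G H : C -> C) := exists2 M : R, 0 <= M &
  on_curve (fun x => on_curve (fun y => on_curve (fun z =>
   [/\ normc (G y - G x - H z * (y - x)) <=
         M * (normc (x - z) + normc (y - z)) * normc (y - x),
       normc (G x) <= M, normc (H z) <= M &
       normc (G y - G x) <= M * normc (y - x)]))).

(** The increments of [G] along a partition telescope to 0 on a closed curve. The error of each
    segment is its length times a quantity that is small for fine partitions, and the lengths add up
    to at most [L]. *)
Lemma primitive_exact G H : primitive G H -> CInt H 0.
Proof.
move=> [M M0 GH]; have L0 := length_ge0 gL.
apply/CIntP => e e0.
have k0 : 0 < 2 * M * L + 1 by rewrite ltr_wpDl// !mulr_ge0.
have eta0 : 0 < e / (2 * M * L + 1) by rewrite divr_gt0.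
have [d d0 Hd] := curve_unif gc eta0; exists d => // s xi sp sx.
have tele (h : R -> C) (a : R) (r : seq R) :
    \sum_(i < size r) (h (nth 0 r i) - h (nth 0 (a :: r) i)) = h (last a r) - h a.
  elim: r a => [|b r ih] a; first by rewrite big_ord0 subrr.
  rewrite [size _]/= big_ord_recl /= ih; ring.
have E : 0 = \sum_(i < size s) (G (g (nth 0 s i)) - G (g (nth 0 (0 :: s) i))).
  rewrite (tele (G \o g)); case: sp => _ /eqP ->.
  by rewrite /= g01 subrr.
rewrite E /rsum -sumrB (le_lt_trans (normc_sum _ _))//.
apply: (@le_lt_trans _ _ (M * (2 * (e / (2 * M * L + 1))) * L)); last first.
  rewrite (_ : M * _ * _ = e * (2 * M * L / (2 * M * L + 1))); last first.
    by field; rewrite lt0r_neq0.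
  by rewrite gtr_pMr// ltr_pdivrMr// mul1r ltrDl.
have M20 : 0 <= M * (2 * (e / (2 * M * L + 1))).
  by apply: mulr_ge0 => //; apply: mulr_ge0 => //; exact: ltW.
apply: (le_trans _ (ler_wpM2l M20 (gL sp))).
rewrite mulr_sumr ler_sum// => i _.
have l01 := itv_partition_left sp (ltn_ord i).
have r01 := itv_partition_right sp (ltn_ord i).
have x01 := tags_in sp sx (ltn_ord i).
have [sd /andP[lx xr]] := sx i (ltn_ord i).
have [h _ _ _] := GH _ l01 _ r01 _ x01.
rewrite [leLHS]normcB; apply: le_trans h _; rewrite ler_wpM2r ?normc_ge0//.
rewrite ler_wpM2l// mulr_natl mulr2n lerD//; apply/ltW/Hd => //;
  rewrite ltr_norml; apply/andP; split; move: sd lx xr d0; lra.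
Qed.

Lemma primitive_le G H M : 0 <= M ->
  on_curve (fun x => on_curve (fun y => on_curve (fun z =>
   [/\ normc (G y - G x - H z * (y - x)) <=
         M * (normc (x - z) + normc (y - z)) * normc (y - x),
       normc (G x) <= M, normc (H z) <= M &
       normc (G y - G x) <= M * normc (y - x)]))) ->
  forall M', M <= M' ->
  on_curve (fun x => on_curve (fun y => on_curve (fun z =>
   [/\ normc (G y - G x - H z * (y - x)) <=
         M' * (normc (x - z) + normc (y - z)) * normc (y - x),
       normc (G x) <= M', normc (H z) <= M' &
       normc (G y - G x) <= M' * normc (y - x)]))).
Proof.
move=> M0 GH M' MM' x x01 y y01 z z01; have [h1 h2 h3 h4] := GH x x01 y y01 z z01.
split; [apply: (le_trans h1)|exact: le_trans h2 _|exact: le_trans h3 _|apply: (le_trans h4)].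
  by rewrite -!mulrA ler_wpM2r// mulr_ge0 ?addr_ge0 ?normc_ge0.
by rewrite ler_wpM2r ?normc_ge0.
Qed.

Lemma primitive_ext G H G' H' : on_curve (fun x => G x = G' x) ->
  on_curve (fun x => H x = H' x) -> primitive G H -> primitive G' H'.
Proof.
move=> GG HH [M M0 GH]; exists M => // x x01 y y01 z z01.
by rewrite -!GG// -HH//; exact: GH.
Qed.

Lemma primitiveM G1 H1 G2 H2 : primitive G1 H1 -> primitive G2 H2 ->
  primitive (fun x => G1 x * G2 x) (fun x => H1 x * G2 x + G1 x * H2 x).
Proof.
move=> [M1 M10 P1] [M2 M20 P2].
pose M := M1 + M2 + 1.
have {P1} P1 := primitive_le M10 P1 (M' := M) _.
have {P2} P2 := primitive_le M20 P2 (M' := M) _.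
have {}P1 := P1 ltac:(rewrite /M; lra); have {}P2 := P2 ltac:(rewrite /M; lra).
have M1' : 1 <= M by rewrite /M; lra.
have M0 : 0 <= M by lra.
have MM : M * M <= 3 * M * M by rewrite -mulrA ler_peMl ?mulr_ge0//; lra.
(* The four error terms of the product rule add up to exactly 3 M^2 (X + Y) D. *)
exists (3 * M * M); first by rewrite !mulr_ge0.
move=> x x01 y y01 z z01.
have [a1 b1 c1 d1] := P1 x x01 y y01 z z01.
have [a2 b2 c2 d2] := P2 x x01 y y01 z z01.
have [_ b1' _ d1'] := P1 z z01 x x01 z z01.
have [_ b2' _ d2'] := P2 z z01 y y01 z z01.
have [_ b2'' _ _] := P2 y y01 y y01 z z01.
move: (g x) (g y) (g z) a1 b1 c1 d1 a2 b2 c2 d2 b1' d1' b2' d2' b2''.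
move=> {x x01 y y01 z z01 P1 P2} x y z a1 b1 c1 d1 a2 b2 c2 d2 b1' d1' b2' d2' b2''.
set X := normc (x - z); set Y := normc (y - z); set D := normc (y - x).
have X0 : 0 <= X by exact: normc_ge0.
have Y0 : 0 <= Y by exact: normc_ge0.
have D0 : 0 <= D by exact: normc_ge0.
have lem (a b : C) (A B : R) : normc a <= A -> normc b <= B -> normc (a * b) <= A * B.
  by move=> aA bB; rewrite normcM; apply: ler_pM => //; exact: normc_ge0.
split.
- rewrite (_ : _ - _ - _ = (G1 y - G1 x - H1 z * (y - x)) * G2 y
    + (H1 z * (y - x)) * (G2 y - G2 z) + G1 x * (G2 y - G2 x - H2 z * (y - x))
    + (H2 z * (y - x)) * (G1 x - G1 z)); last by ring.
  have e1 := lem _ _ _ _ a1 b2''.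
  have e2 := lem _ _ _ _ (lem _ _ _ _ c1 (lexx D)) d2'.
  have e3 := lem _ _ _ _ b1 a2.
  have e4 := lem _ _ _ _ (lem _ _ _ _ c2 (lexx D)) d1'.
  apply: (le_trans (ler_normcD _ _)); rewrite (le_trans (lerD (ler_normcD _ _) e4))//.
  apply: (le_trans (lerD (lerD (ler_normcD _ _) e3) (lexx _))).
  apply: (le_trans (lerD (lerD (lerD e1 e2) (lexx _)) (lexx _))).
  by rewrite -/X -/Y -/D le_eqVlt; apply/orP; left; apply/eqP; ring.
- exact: le_trans (lem _ _ _ _ b1 b2) _.
- apply: (le_trans (ler_normcD _ _)).
  apply: (le_trans (lerD (lem _ _ _ _ c1 b2') (lem _ _ _ _ b1' c2))).
  by have := mulr_ge0 M0 M0; lra.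
- rewrite (_ : _ - _ = (G1 y - G1 x) * G2 y + G1 x * (G2 y - G2 x)); last by ring.
  apply: (le_trans (ler_normcD _ _)).
  apply: (le_trans (lerD (lem _ _ _ _ d1 b2'') (lem _ _ _ _ b1 d2))).
  rewrite -/D; have := mulr_ge0 (mulr_ge0 M0 M0) D0; lra.
Qed.

Lemma primitive_id : primitive id (fun=> 1).
Proof.
have [B B0 HB] := curve_bounded gc.
exists (B + 1); first by rewrite addr_ge0// ltW.
move=> x x01 y y01 z z01; split => //.
- by rewrite mul1r subrr normc0 !mulr_ge0 ?addr_ge0 ?normc_ge0// ltW.
- by rewrite (le_trans (HB _ x01))// lerDl.
- by rewrite normc1 lerDr ltW.
- by rewrite ler_peMl ?normc_ge0// lerDr ltW.
Qed.

Lemma primitive_inv p : ~ curve_image g p ->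
  primitive (fun x => (x - p)^-1) (fun x => - (x - p) ^- 2).
Proof.
move=> /(curve_dist gc)[d d0 Hd].
have nz t : 0 <= t <= 1 -> g t - p != 0.
  by move=> /Hd; rewrite -normc_gt0; exact: lt_le_trans.
pose D := d^-1 + 1; have D1 : 1 <= D by rewrite lerDr invr_ge0 ltW.
have D0 : 0 <= D by lra.
have iD t : 0 <= t <= 1 -> normc (g t - p)^-1 <= D.
  move=> t01; rewrite normcV (@le_trans _ _ d^-1)//; last by rewrite lerDl.
  by rewrite lef_pV2 ?posrE ?Hd// (lt_le_trans d0)// Hd.
have D12 : D * D <= D ^+ 3 by rewrite -expr2 ler_weXn2l.
have D13 : D <= D ^+ 3 by rewrite ler_eXnr.
exists (D ^+ 3); first by rewrite exprn_ge0.
have lem (a b : C) (A B : R) : normc a <= A -> normc b <= B -> normc (a * b) <= A * B.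
  by move=> aA bB; rewrite normcM; apply: ler_pM => //; exact: normc_ge0.
move=> x x01 y y01 z z01; have := nz x x01; have := nz y y01; have := nz z z01.
set X := normc (g x - g z); set Y := normc (g y - g z).
have X0 : 0 <= X by exact: normc_ge0. have Y0 : 0 <= Y by exact: normc_ge0.
move=> nzz nzy nzx; split.
- rewrite (_ : _ - _ = ((g x - g z) * ((g y - p)^-1 * (g z - p)^-1 * (g x - p)^-1) +
    (g y - g z) * ((g z - p)^-1 * (g z - p)^-1 * (g y - p)^-1)) * (g y - g x)); last first.
    by field; rewrite nzx nzy nzz.
  have D3 : D ^+ 3 = D * D * D by rewrite !exprS expr0 mulr1 mulrA.
  apply: (lem) => //; apply: (le_trans (ler_normcD _ _)); rewrite mulrDr.
  have lem3 u v w : 0 <= u <= 1 -> 0 <= v <= 1 -> 0 <= w <= 1 ->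
      normc ((g u - p)^-1 * (g v - p)^-1 * (g w - p)^-1) <= D ^+ 3.
    move=> u01 v01 w01; rewrite D3.
    exact (lem _ _ _ _ (lem _ _ _ _ (iD _ u01) (iD _ v01)) (iD _ w01)).
  by rewrite lerD// [leRHS]mulrC normcM ler_wpM2l// lem3.
- exact: le_trans (iD _ x01) _.
- rewrite normcN -exprVn expr2; exact: le_trans (lem _ _ _ _ (iD _ z01) (iD _ z01)) _.
- rewrite (_ : _ - _ = - ((g y - p)^-1 * (g x - p)^-1 * (g y - g x))); last first.
    by field; rewrite nzx nzy.
  rewrite normcN; apply: (le_trans (lem _ _ _ _ (lem _ _ _ _ (iD _ y01) (iD _ x01)) (lexx _))).
  by rewrite ler_wpM2r ?normc_ge0.
Qed.

Lemma primitiveX G H n : primitive G H ->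
  primitive (fun x => G x ^+ n.+1) (fun x => n.+1%:R * G x ^+ n * H x).
Proof.
move=> GH; elim: n => [|n ih].
  apply: primitive_ext GH => t _; first by rewrite expr1.
  by rewrite expr0 !mul1r.
apply: primitive_ext (primitiveM GH ih) => t _; first by rewrite [RHS]exprS.
by rewrite -[n.+2%:R]natr1 !exprS; ring.
Qed.

Lemma CInt_X n : CInt (fun x => x ^+ n) 0.
Proof.
have := CIntZ n.+1%:R^-1 (primitive_exact (primitiveX n primitive_id)).
rewrite mulr0; apply: CInt_ext => t _; rewrite mulr1 mulrA mulVf ?mul1r//.
Qed.

Lemma CInt_pole p n : ~ curve_image g p -> CInt (fun x => (x - p) ^- n.+2) 0.
Proof.
move=> /primitive_inv/(primitiveX n)/primitive_exact/(CIntZ (- n.+1%:R^-1)).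
rewrite mulr0; apply: CInt_ext => t _.
rewrite mulrN mulNr mulrN opprK !mulrA mulVf ?mul1r ?pnatr_eq0//.
by rewrite -exprVn -!exprVn -exprD addn2.
Qed.

(** The primitive is a multiple of (x / (x - p))^(n+1). Such integrands arise when a multiple pole
    is reflected by x -> s/x. *)
Lemma CInt_Xpole p n : p != 0 -> ~ curve_image g p ->
  CInt (fun x => x ^+ n * (x - p) ^- n.+2) 0.
Proof.
move=> p0 pK; have := primitive_exact (primitiveX n (primitiveM primitive_id (primitive_inv pK))).
move=> /(CIntZ (- (p * n.+1%:R)^-1)); rewrite mulr0; apply: CInt_ext => t t01.
have nz : g t - p != 0.
  by apply/eqP => /eqP; rewrite subr_eq0 => /eqP gtp; apply: pK; exists t => //=; rewrite in_itv.
have n0 : n.+1%:R != 0 :> C by rewrite pnatr_eq0.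
rewrite exprMn -!exprVn !exprS expr0 mulr1; set u := (_ ^+ n) ; set v := (_ ^+ n).
by field; rewrite nz p0 /= addrC natr1 n0.
Qed.

End Exact.

Section Winding.

Lemma half_expn_small (B e : R) : 0 < e -> exists N, forall n, (N <= n)%N -> B * 2^-1 ^+ n <= e.
Proof.
move=> e0.
have Be0 : 0 < e / (`|B| + 1) by rewrite divr_gt0// ltr_wpDl.
have h : `|2^-1 : R| < 1 by rewrite ger0_norm ?invr_ge0// invf_lt1 ?ltr1n.
have /cvgrPdist_lt/(_ _ Be0)[N _ HN] := cvg_expr h.
exists N => n /HN; rewrite sub0r normrN ger0_norm ?exprn_ge0 ?invr_ge0// => H.
apply: (@le_trans _ _ (`|B| * 2^-1 ^+ n)).
  by rewrite ler_wpM2r ?ler_norm// exprn_ge0 ?invr_ge0.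
apply: (le_trans (ler_wpM2l (normr_ge0 B) (ltW H))).
rewrite mulrCA ler_piMr//; first exact: ltW.
by rewrite ler_pdivrMr ?ltr_wpDl// mul1r lerDl.
Qed.

Lemma CInt_sum (n : nat) (F : nat -> C -> C) (v : nat -> C) :
  (forall i, (i < n)%N -> CInt (F i) (v i)) ->
  CInt (fun x => \sum_(i < n) F i x) (\sum_(i < n) v i).
Proof.
elim: n => [|n ih] H.
  by rewrite big_ord0; apply: CInt_ext (CInt0 g) => t _; rewrite big_ord0.
rewrite big_ord_recr/=; apply: CInt_ext (CIntD (ih _) (H n _)) => //.
  by move=> t _; rewrite big_ord_recr.
by move=> i ni; apply: H; rewrite ltnW.
Qed.

Lemma normc_expr_half (u : C) n : normc u <= 2^-1 -> normc (u ^+ n) <= 2^-1 ^+ n.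
Proof. by move=> u2; rewrite normcX lerXn2r ?nnegrE ?normc_ge0. Qed.

(* Winding numbers are locally constant: expand 1/(x - z) in powers of z - z0;
   all terms but the first one are exact. *)
Lemma CInt_inv_near z0 z d v : 0 < d -> on_curve (fun x => d <= normc (x - z0)) ->
  normc (z - z0) <= d / 2 -> CInt (fun x => (x - z0)^-1) v ->
  CInt (fun x => (x - z)^-1) v.
Proof.
move=> d0 Kd zz0 Iv.
have nz t : 0 <= t <= 1 -> g t - z0 != 0.
  by move=> /Kd; rewrite -normc_gt0; exact: lt_le_trans.
have dz t : 0 <= t <= 1 -> d / 2 <= normc (g t - z).
  move=> t01; have := Kd t t01; have := ler_normc_dist z (g t) z0; lra.
have nz' t : 0 <= t <= 1 -> g t - z != 0.
  by move=> /dz; rewrite -normc_gt0; apply: lt_le_trans; rewrite divr_gt0.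
have z0K : ~ curve_image g z0.
  by move=> [t /=]; rewrite in_itv/= => /nz + gt; rewrite gt subrr eqxx.
pose F n x := \sum_(i < n.+1) ((z - z0) ^+ i * (x - z0) ^- i.+1).
have FI n : CInt (F n) v.
  rewrite (_ : v = \sum_(i < n.+1) (if i == 0 :> nat then v else 0)); last first.
    by rewrite big_ord_recl/= big1 ?addr0.
  apply: (@CInt_sum n.+1 (fun i x => (z - z0) ^+ i * (x - z0) ^- i.+1)
    (fun i => if i == 0 :> nat then v else 0)) => -[|i] _ /=.
    by apply: CInt_ext Iv => t _; rewrite expr0 mul1r expr1.
  by rewrite -(mulr0 ((z - z0) ^+ i.+1)); apply: CIntZ; exact: CInt_pole.
have [|w Iw vw] := CInt_uconv gL FI (G := fun x => (x - z)^-1).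
  move=> e e0; have [N HN] := half_expn_small (2 / d) e0; exists N => n Nn t t01.
  rewrite (_ : F n (g t) - _ = - ((g t - z)^-1 * ((z - z0) / (g t - z0)) ^+ n.+1)); last first.
    have n1 := nz t t01; have n2 := nz' t t01.
    rewrite /F; set u := (z - z0) / (g t - z0).
    have -> : \sum_(i < n.+1) (z - z0) ^+ i / (g t - z0) ^+ i.+1 =
        (g t - z0)^-1 * \sum_(i < n.+1) u ^+ i.
      rewrite mulr_sumr; apply: eq_bigr => i _; rewrite exprMn exprVn exprS invfM; ring.
    have u1 : (g t - z0)^-1 = (g t - z)^-1 * (1 - u).
      by rewrite /u; field; rewrite n1 n2.
    have S : (1 - u) * \sum_(i < n.+1) u ^+ i = 1 - u ^+ n.+1.
      by rewrite -opprB mulNr -subrX1 opprB.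
    by rewrite u1 -mulrA S; ring.
  rewrite normcN normcM normcV; apply: le_trans (HN _ (leqW Nn)).
  apply: ler_pM; rewrite ?invr_ge0 ?normc_ge0//.
    by rewrite -invf_div lef_pV2 ?posrE ?divr_gt0// ?dz// (lt_le_trans _ (dz _ t01))// divr_gt0.
  apply: normc_expr_half; rewrite normcM normcV ler_pdivrMr.
    by rewrite (le_trans zz0)// mulrC ler_wpM2l ?Kd// invr_ge0.
  exact: lt_le_trans (Kd t t01).
by rewrite (cconv_uniq (l := v) (l' := w) _ vw) // => e e0; exists 0%N => n _; rewrite subrr normc0.
Qed.

(** Here 1/(x - z) is on the curve a uniform limit of polynomials in x, all of which are exact. *)
Lemma CInt_inv_far z B : 0 < B -> on_curve (fun x => normc x <= B) ->
  2 * B <= normc z -> CInt (fun x => (x - z)^-1) 0.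
Proof.
move=> B0 KB zB.
have z0 : z != 0.
  by rewrite -normc_gt0 (lt_le_trans _ zB)// mulr_gt0.
have dz t : 0 <= t <= 1 -> B <= normc (g t - z).
  move=> t01; rewrite normcB; have := lerB_normc z (g t); have := KB _ t01; lra.
have nz t : 0 <= t <= 1 -> g t - z != 0.
  by move=> /dz; rewrite -normc_gt0; exact: lt_le_trans.
pose F n x := \sum_(i < n) (- z ^- i.+1 * x ^+ i).
have FI n : CInt (F n) 0.
  rewrite [0](_ : _ = \sum_(i < n) 0); last by rewrite big1.
  apply: (@CInt_sum n (fun i x => - z ^- i.+1 * x ^+ i) (fun=> 0)) => i _.
  by rewrite -[0](mulr0 (- z ^- i.+1)); apply: CIntZ; exact: CInt_X.
have [|w Iw vw] := CInt_uconv gL FI (G := fun x => (x - z)^-1).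
  move=> e e0; have [N HN] := half_expn_small B^-1 e0; exists N => n Nn t t01.
  rewrite (_ : F n (g t) - _ = - ((g t - z)^-1 * (g t / z) ^+ n)); last first.
    have n2 := nz t t01.
    rewrite /F; set u := g t / z.
    have -> : \sum_(i < n) - z ^- i.+1 * g t ^+ i = - z^-1 * \sum_(i < n) u ^+ i.
      rewrite mulr_sumr; apply: eq_bigr => i _; rewrite exprMn exprVn exprS invfM; ring.
    have u1 : - z^-1 = (g t - z)^-1 * (1 - u).
      by rewrite /u; field; rewrite z0 n2.
    have S : (1 - u) * \sum_(i < n) u ^+ i = 1 - u ^+ n.
      by rewrite -opprB mulNr -subrX1 opprB.
    by rewrite u1 -mulrA S; ring.
  rewrite normcN normcM normcV; apply: le_trans (HN _ Nn).
  apply: ler_pM; rewrite ?invr_ge0 ?normc_ge0//.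
    by rewrite lef_pV2 ?posrE ?dz// (lt_le_trans _ (dz _ t01)).
  apply: normc_expr_half; rewrite normcM normcV ler_pdivrMr ?normc_gt0//.
  by rewrite mulrC ler_pdivlMr// mulrC (le_trans _ zB)// ler_wpM2l ?KB.
by rewrite (cconv_uniq (l := 0) (l' := w) _ vw) // => e e0; exists 0%N => n _; rewrite subrr normc0.
Qed.

End Winding.

Section WindingExterior.

Lemma open_normcP (A : set C) :
  (forall z, A z -> exists2 d : R, 0 < d & forall y, normc (y - z) < d -> A y) ->
  open A.
Proof.
move=> H; rewrite openE => z /H[d d0 Hd]; apply/nbhs_ballP; exists d%:C => /=.
  by rewrite ltcR.
by move=> y; rewrite /ball/= normcE ltcR normcB => /Hd.
Qed.

(** An unbounded component contains points far from the curve, where the winding number is 0; being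
    locally constant, it is 0 on the whole component. *)
Lemma CInt_inv_exterior z : exterior_pt g z -> CInt (fun x => (x - z)^-1) 0.
Proof.
move=> [zK unb].
have [B B0 HB] := curve_bounded gc.
have [y [Ay By]] : exists y, connected_component (~` curve_image g) z y /\ 2 * B <= normc y.
  apply: contrapT => H; apply: unb.
  exists (2 * B)%:C; split; first by apply/complex_realP; exists (2 * B).
  move=> M BM y Ay; apply: (le_trans _ (ltW BM)); rewrite /= normcE lecR leNgt.
  by apply/negP => /ltW By; apply: H; exists y.
have [A [Az AK Ac] {}Ay] := Ay.
have loc z0 : ~ curve_image g z0 -> exists2 d : R, 0 < d &
    forall y, normc (y - z0) < d -> ~ curve_image g y /\
      (CInt (fun x => (x - y)^-1) 0 <-> CInt (fun x => (x - z0)^-1) 0).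
  move=> /(curve_dist gc)[d d0 Hd]; exists (d / 4); first by rewrite divr_gt0.
  move=> w wz; have dw t : 0 <= t <= 1 -> d / 2 <= normc (g t - w).
    move=> t01; have := Hd t t01; have := ler_normc_dist w (g t) z0; lra.
  split.
    move=> [t /=]; rewrite in_itv/= => /dw + gt; rewrite gt subrr normc0; lra.
  split.
  - apply: (CInt_inv_near (d := d / 2)) dw _.
      by rewrite divr_gt0.
    by rewrite normcB; lra.
  - by apply: (CInt_inv_near (d := d)) Hd _ => //; lra.
(* Existence of the integral is not presupposed: [W] also contains the points where it might fail,
   and [loc] shows that this set is open too. *)
pose V := [set w | ~ curve_image g w /\ CInt (fun x => (x - w)^-1) 0].
pose W := [set w | ~ curve_image g w /\ ~ CInt (fun x => (x - w)^-1) 0].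
have oV : open V.
  apply: open_normcP => w [wK wI]; have [d d0 Hd] := loc w wK.
  by exists d => // x /Hd[xK [_ h]]; split => //; exact: h.
have oW : open W.
  apply: open_normcP => w [wK wI]; have [d d0 Hd] := loc w wK.
  by exists d => // x /Hd[xK [h _]]; split => // /h.
have : A `&` V = A.
  apply: Ac.
  - exists y; split => //; split; first exact: AK.
    exact: (CInt_inv_far B0 HB).
  - by exists V.
  - exists (~` W); first exact: open_closedC.
    apply/seteqP; split => [w [Aw [wK wI]]|w [Aw nW]]; split => //.
      by case=> _; apply.
    split; first exact: AK.
    by apply: contrapT => nI; apply: nW; split => //; exact: AK.
by move=> AV; have [_ [_ ]] : (A `&` V) z by rewrite AV.
Qed.

End WindingExterior.

(** * Reflection of integrals of rational functions *)

Section RationalReflection.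

Lemma curve_neq t z : 0 <= t <= 1 -> ~ K z -> g t - z != 0.
Proof.
move=> t01 zK; apply/eqP => /eqP; rewrite subr_eq0 => /eqP gtz.
by apply: zK; exists t => //=; rewrite in_itv.
Qed.

Lemma curve_neq0 t : 0 <= t <= 1 -> g t != 0.
Proof. by move=> /curve_neq/(_ K0); rewrite subr0. Qed.

Lemma CInt_Xz (m : int) : CInt (fun x => x ^ m) (if m == -1 then two_pi_i R else 0).
Proof.
case: m => [n|[|n]] /=; first exact: CInt_X.
  by apply: CInt_ext wind0 => t _; rewrite NegzE exprN1.
apply: CInt_ext (CInt_pole n K0) => t _.
by rewrite subr0 NegzE.
Qed.

Variables (s : C) (S : set C).
Hypothesis s0 : s != 0.
Hypothesis S0 : forall p, S p -> [/\ p != 0, ~ K p, ~ K (s / p) &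
  exists2 w, CInt (fun x => (x - p)^-1) w &
             CInt (fun x => (x - s / p)^-1) (two_pi_i R - w)].

(** Rational functions with poles in [S] and at 0, generated by partial fractions, so that a
    statement linear in the function need only be checked on powers and on single poles. *)
Inductive rat : (C -> C) -> Prop :=
| rat_X (n : int) : rat (fun x => x ^ n)
| rat_pole p n : S p -> rat (fun x => (x - p) ^- n.+1)
| rat_lin c F G : rat F -> rat G -> rat (fun x => c * F x + G x)
| rat_ext F G : (forall x, x != 0 -> ~ S x -> F x = G x) -> rat F -> rat G.

(** For a simple pole at p both integrals equal (w - 2 pi i)/p, precisely because the integrals of
    1/(x - p) and 1/(x - s/p) add up to 2 pi i. Passing to a higher power adds only exact terms. *)
Lemma rat_reflect F : rat F ->
  exists2 v, CInt (fun x => F x / x) v & CInt (fun x => F (s / x) / x) v.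
Proof.
elim=> {F} [n|p n Sp|c F G _ [u Fu Fu'] _ [v Gv Gv']|F G FG _ [v Fv Fv']].
- pose v := if n == 0 then two_pi_i R else 0; exists v.
    have -> : v = if n - 1 == -1 then two_pi_i R else 0.
      by rewrite /v -[n - 1 == -1]subr_eq0 opprK subrK.
    apply: CInt_ext (CInt_Xz (n - 1)) => t t01.
    by rewrite expfzDr ?curve_neq0// exprN1.
  have -> : v = s ^ n * if - n - 1 == -1 then two_pi_i R else 0.
    rewrite -[- n - 1 == -1]subr_eq0 opprK subrK oppr_eq0 /v.
    by case: eqP => [->|]; rewrite ?mulr0// expr0z mul1r.
  apply: CInt_ext (CIntZ (s ^ n) (CInt_Xz (- n - 1))) => t t01.
  have t0 := curve_neq0 t01.
  by rewrite expfzDr// exprN1 mulrA expfzMl exprz_inv.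
- have [p0 pK yK [w wp wy]] := S0 Sp.
  set y := s / p in yK wy.
  have y0 : y != 0 by rewrite mulf_neq0 ?invr_eq0.
  elim: n => [|n [v IA IB]].
    exists (p^-1 * (w - two_pi_i R)).
      have := CIntZ p^-1 (CInt_lin (-1) wind0 wp); rewrite mulN1r addrC.
      apply: CInt_ext => t t01; have := curve_neq0 t01; have := curve_neq t01 pK.
      by move=> n1 n2; rewrite expr1; field; rewrite n1 n2.
    have := CIntZ (- p^-1) wy; rewrite mulNr -mulrN opprB.
    apply: CInt_ext => t t01; have := curve_neq0 t01; have := curve_neq t01 yK.
    rewrite expr1 /y => n1 n2.
    have n3 : g t * p - s != 0.
      by rewrite (_ : _ - _ = p * (g t - s / p)) ?mulf_neq0//; field.
    have n4 : s - p * g t != 0 by rewrite -oppr_eq0 opprB mulrC.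
    by field; rewrite n2 p0 n3 mulNr n4.
  exists (p^-1 * (-1 * v + 0)).
    apply: CInt_ext (CIntZ p^-1 (CInt_lin (-1) IA (CInt_pole n pK))) => t t01.
    have := curve_neq0 t01; have := curve_neq t01 pK => n1 n2.
    rewrite -!exprVn !exprS; set u := _ ^+ n; by field; rewrite n1 n2.
  rewrite addr0 mulN1r mulrN -mulNr -[_ * v]addr0.
  rewrite -(mulr0 (- p^-1 * y * (- p^-1) ^+ n.+1)).
  apply: CInt_ext (CInt_lin (- p^-1) IB (CIntZ (- p^-1 * y * (- p^-1) ^+ n.+1)
    (CInt_Xpole n y0 yK))) => t t01.
  have := curve_neq0 t01; have := curve_neq t01 yK => n1 n2.
  have E : (s / g t - p)^-1 = - p^-1 * (g t / (g t - y)).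
    move: n1; rewrite /y => n1.
    have n3 : g t * p - s != 0.
      by rewrite (_ : _ - _ = p * (g t - s / p)) ?mulf_neq0//; field.
    have n4 : s - p * g t != 0 by rewrite -oppr_eq0 opprB mulrC.
    by field; rewrite n3 mulNr n4 p0 n2.
  rewrite -!exprVn E !exprMn !exprS.
  set u := (- p^-1) ^+ n; set a := g t ^+ n; set b := _ ^+ n.
  by field; rewrite n1 n2 p0.
- exists (c * u + v).
    by apply: CInt_ext (CInt_lin c Fu Gv) => t _; ring.
  by apply: CInt_ext (CInt_lin c Fu' Gv') => t _; ring.
- have nS t : 0 <= t <= 1 -> ~ S (g t) /\ ~ S (s / g t).
    move=> t01; have Kt : K (g t) by exists t => //=; rewrite in_itv.
    split=> [/S0[]//|/S0[_ _ + _]]; apply.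
    by rewrite invf_div mulrCA divff ?mulr1.
  exists v; [apply: CInt_ext Fv|apply: CInt_ext Fv'] => t t01.
    by have [h _] := nS t t01; rewrite FG// curve_neq0.
  by have [_ h] := nS t t01; rewrite FG// mulf_neq0 ?invr_eq0 ?curve_neq0.
Qed.

Lemma rat_eq F G : F =1 G -> rat F -> rat G.
Proof. by move=> FG; apply: rat_ext => x _ _. Qed.

Lemma rat_add F G : rat F -> rat G -> rat (fun x => F x + G x).
Proof. by move=> rF rG; apply: rat_eq (rat_lin 1 rF rG) => x; rewrite mul1r. Qed.

Lemma rat_0 : rat (fun=> 0).
Proof.
by apply: rat_eq (rat_lin (-1) (rat_X 0) (rat_X 0)) => x; rewrite mulN1r addNr.
Qed.

Lemma rat_scale c F : rat F -> rat (fun x => c * F x).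
Proof. by move=> rF; apply: rat_eq (rat_lin c rF rat_0) => x; rewrite addr0. Qed.

Lemma rat_1 : rat (fun=> 1).
Proof. by apply: rat_eq (rat_X 0) => x; rewrite expr0z. Qed.

Lemma rat_mulX F : rat F -> rat (fun x => x * F x).
Proof.
elim=> {F} [n|p n Sp|c F G _ ih1 _ ih2|F G FG _ ih].
- by apply: rat_ext (rat_X (n + 1)) => x x0 _; rewrite expfzDr// expr1z mulrC.
- case: n => [|n].
    apply: rat_ext (rat_lin p (rat_pole 0 Sp) rat_1) => x x0 Sx.
    have xp : x - p != 0 by rewrite subr_eq0; apply/eqP => xp; apply: Sx; rewrite xp.
    by rewrite expr1; field.
  apply: rat_ext (rat_lin p (rat_pole n.+1 Sp) (rat_pole n Sp)) => x x0 Sx.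
  have xp : x - p != 0 by rewrite subr_eq0; apply/eqP => xp; apply: Sx; rewrite xp.
  by rewrite !exprS; field; rewrite ?xp ?expf_neq0.
- by apply: rat_eq (rat_lin c ih1 ih2) => x; ring.
- by apply: rat_ext ih => x x0 Sx; rewrite FG.
Qed.

Lemma rat_mulV F : rat F -> rat (fun x => x^-1 * F x).
Proof.
elim=> {F} [n|p n Sp|c F G _ ih1 _ ih2|F G FG _ ih].
- by apply: rat_ext (rat_X (n - 1)) => x x0 _; rewrite expfzDr// exprN1 mulrC.
- have [p0 _ _ _] := S0 Sp; elim: n => [|n ih].
    apply: rat_ext (rat_scale p^-1 (rat_lin (-1) (rat_X (-1)) (rat_pole 0 Sp))) => x x0 Sx.
    have xp : x - p != 0 by rewrite subr_eq0; apply/eqP => xp; apply: Sx; rewrite xp.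
    by rewrite exprN1 expr1; field; rewrite xp x0.
  apply: rat_ext (rat_scale p^-1 (rat_lin (-1) ih (rat_pole n.+1 Sp))) => x x0 Sx.
  have xp : x - p != 0 by rewrite subr_eq0; apply/eqP => xp; apply: Sx; rewrite xp.
  by rewrite !exprS; field; rewrite ?xp ?x0 ?p0 ?expf_neq0.
- by apply: rat_eq (rat_lin c ih1 ih2) => x; ring.
- by apply: rat_ext ih => x x0 Sx; rewrite FG.
Qed.

(** For a second pole r distinct from p this is the partial fraction of 1/((x - p)(x - r)), iterated
    in the order of r. *)
Lemma rat_mul_pole p F : S p -> rat F -> rat (fun x => (x - p)^-1 * F x).
Proof.
move=> Sp; have xp x : ~ S x -> x - p != 0.
  by move=> Sx; rewrite subr_eq0; apply/eqP => xp; apply: Sx; rewrite xp.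
have r1 : rat (fun x => (x - p)^-1) by apply: rat_eq (rat_pole 0 Sp) => x; rewrite expr1.
elim=> {F} [n|r n Sr|c F G _ ih1 _ ih2|F G FG _ ih].
- case: n => n.
    elim: n => [|n ih]; first by apply: rat_eq r1 => x; rewrite expr0z mulr1.
    by apply: rat_eq (rat_mulX ih) => x; rewrite -!exprnP exprS; ring.
  elim: n => [|n ih]; first by apply: rat_eq (rat_mulV r1) => x; rewrite NegzE exprN1 mulrC.
  by apply: rat_eq (rat_mulV ih) => x; rewrite !NegzE -!exprnN -!exprVn !exprS; ring.
- have [<-|rp] := eqVneq p r.
    by apply: rat_eq (rat_pole n.+1 Sp) => x; rewrite [in LHS]exprS invfM.
  have rp0 : r - p != 0 by rewrite subr_eq0 eq_sym.
  have xr x : ~ S x -> x - r != 0.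
    by move=> Sx; rewrite subr_eq0; apply/eqP => xr; apply: Sx; rewrite xr.
  elim: n => [|n ih].
    apply: rat_ext (rat_scale (r - p)^-1 (rat_lin (-1) r1 (rat_pole 0 Sr))) => x x0 Sx.
    have := xp x Sx; have := xr x Sx => n1 n2.
    by rewrite expr1; field; rewrite n1 n2 rp0.
  apply: rat_ext (rat_scale (r - p)^-1 (rat_lin (-1) ih (rat_pole n.+1 Sr))) => x x0 Sx.
  have := xp x Sx; have := xr x Sx => n1 n2.
  by rewrite !exprS; field; rewrite ?n1 ?n2 ?rp0 ?expf_neq0.
- by apply: rat_eq (rat_lin c ih1 ih2) => x; ring.
- by apply: rat_ext ih => x x0 Sx; rewrite FG.
Qed.

End RationalReflection.

(** * Reflection against infinite products *)

Section WeightReflection.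
Variable q : C.
Hypothesis q1 : normc q < 1.
Hypothesis q0 : q != 0.

(** The common bound makes uniform convergence stable under products. *)
Definition ucb (F : nat -> C -> C) (G : C -> C) := uconv g F G /\
  exists2 B : R, 0 <= B & forall n, on_curve (fun x => normc (F n x) <= B).

Lemma ucb_limit_bound (F : nat -> C -> C) G B : uconv g F G ->
  (forall n, on_curve (fun x => normc (F n x) <= B)) -> on_curve (fun x => normc (G x) <= B).
Proof.
move=> FG FB t t01; apply/ler_addgt0Pr => e e0; have [N HN] := FG e e0.
have := HN N (leqnn _) t t01; rewrite /= normcB; have := FB N t t01.
have := ler_normc_dist (F N (g t)) (G (g t)) 0; rewrite !subr0; lra.
Qed.

Lemma ucbM F G F' G' : ucb F G -> ucb F' G' ->
  ucb (fun n x => F n x * F' n x) (fun x => G x * G' x).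
Proof.
move=> [FG [B B0 FB]] [FG' [B' B'0 FB']].
have GB' := ucb_limit_bound FG' FB'.
split; last first.
  exists (B * B'); first exact: mulr_ge0.
  by move=> n t t01; rewrite normcM ler_pM ?normc_ge0 ?FB ?FB'.
move=> e e0.
have k0 : 0 < B + B' + 1 by rewrite ltr_wpDl// addr_ge0.
have e'0 : 0 < e / (B + B' + 1) by rewrite divr_gt0.
have [N1 H1] := FG _ e'0; have [N2 H2] := FG' _ e'0.
exists (maxn N1 N2) => n; rewrite geq_max => /andP[n1 n2] t t01.
rewrite /= (_ : _ - _ = F n (g t) * (F' n (g t) - G' (g t)) + G' (g t) * (F n (g t) - G (g t))); last by ring.
apply: (le_trans (ler_normcD _ _)); rewrite !normcM.
apply: (@le_trans _ _ (B * (e / (B + B' + 1)) + B' * (e / (B + B' + 1)))).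
  by rewrite lerD// ler_pM ?normc_ge0 ?FB ?GB' ?H1 ?H2.
rewrite -mulrDl mulrCA ler_piMr//; first exact: ltW.
by rewrite ler_pdivrMr// mul1r lerDl.
Qed.

Lemma ucbV F G c : 0 < c -> (forall n, on_curve (fun x => c <= normc (F n x))) -> ucb F G ->
  ucb (fun n x => (F n x)^-1) (fun x => (G x)^-1).
Proof.
move=> c0 Fc [FG _].
have Gc : on_curve (fun x => c <= normc (G x)).
  move=> t t01; apply/ler_addgt0Pr => e e0; have [N HN] := FG e e0.
  have := HN N (leqnn _) t t01; have := Fc N t t01.
  have := ler_normc_dist (G (g t)) (F N (g t)) 0; rewrite !subr0 /=; lra.
have ge t x : c <= normc x -> x != 0 :> C.
  by rewrite -normc_gt0; exact: lt_le_trans.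
split; last first.
  exists c^-1; rewrite ?invr_ge0 ?(ltW c0)// => n t t01.
  by rewrite normcV lef_pV2 ?posrE ?Fc// (lt_le_trans c0)// Fc.
move=> e e0; have cc : 0 < e * (c * c) by rewrite !mulr_gt0.
have [N HN] := FG _ cc; exists N => n Nn t t01 /=.
have F0 : F n (g t) != 0 by rewrite -normc_gt0 (lt_le_trans c0)// Fc.
have G0 : G (g t) != 0 by rewrite -normc_gt0 (lt_le_trans c0)// Gc.
rewrite (_ : _ - _ = - ((F n (g t) - G (g t)) * ((F n (g t))^-1 * (G (g t))^-1))); last first.
  by field; rewrite F0 G0.
rewrite normcN !normcM !normcV.
apply: (@le_trans _ _ (e * (c * c) * (c^-1 * c^-1))).
  rewrite ler_pM ?mulr_ge0 ?invr_ge0 ?normc_ge0 ?HN// ler_pM ?invr_ge0 ?normc_ge0//.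
    by rewrite lef_pV2 ?posrE ?Fc// (lt_le_trans c0)// Fc.
  by rewrite lef_pV2 ?posrE ?Gc// (lt_le_trans c0)// Gc.
by rewrite le_eqVlt; apply/orP; left; apply/eqP; field; exact: lt0r_neq0.
Qed.

Lemma ucb_cst (G : C -> C) B : on_curve (fun x => normc (G x) <= B) -> ucb (fun=> G) G.
Proof.
move=> GB; have B0 : 0 <= B.
  by apply: le_trans (GB 0 _); rewrite ?normc_ge0// lexx ler01.
by split=> [e e0|]; [exists 0%N => n _ t _; rewrite subrr normc0 ltW|exists B].
Qed.

Lemma ucb_eq F G F' G' : (forall n, on_curve (fun x => F n x = F' n x)) ->
  on_curve (fun x => G x = G' x) -> ucb F G -> ucb F' G'.
Proof.
move=> FF GG [FG [B B0 FB]]; split.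
  move=> e /FG[N HN]; exists N => n Nn t t01; rewrite /= -FF// -GG//; exact: HN.
by exists B => // n t t01; rewrite /= -FF//; exact: FB.
Qed.

Lemma ucb_fpoch (y : C -> C) Y : on_curve (fun x => normc (y x) <= Y) ->
  ucb (fun n x => fpoch q n (y x)) (fun x => qpoch (y x) q).
Proof.
move=> yY; split; last first.
  exists (expR (Y / (1 - normc q))); first exact: expR_ge0.
  by move=> n t t01; apply: fpoch_bound => //; exact: yY.
move=> e e0.
have [N HN] := geometric_small q1 (expR (Y / (1 - normc q)) / (1 - normc q) * Y) e0.
exists N => n Nn t t01; apply: le_trans (HN n Nn).
apply: (le_trans (qpoch_err q1 n (yY t t01))).
rewrite ler_wpM2r ?exprn_ge0 ?normc_ge0// ler_wpM2l ?yY//.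
by rewrite mulr_ge0 ?expR_ge0// invr_ge0 ltW// subr_gt0.
Qed.

Lemma ucb_fpochV (y : C -> C) Y : on_curve (fun x => normc (y x) <= Y) ->
  (forall j, exists2 c : R, 0 < c & on_curve (fun x => c <= normc (1 - y x * q ^+ j))) ->
  ucb (fun n x => (fpoch q n (y x))^-1) (fun x => (qpoch (y x) q)^-1).
Proof.
move=> yY yj.
have [||c c0 Hc] := @fpoch_below _ _ q1 R (fun t => y (g t)) (fun t => 0 <= t <= 1) Y.
- by move=> t; exact: yY.
- by move=> j; have [c c0 Hc] := yj j; exists c.
- by apply: ucbV c0 _ (ucb_fpoch yY) => n t t01; exact: Hc.
Qed.

Lemma isL_bounded F : isL F -> exists2 B : R, 0 <= B & on_curve (fun x => normc (F x) <= B).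
Proof.
elim=> {F} [c|||F G _ [B B0 FB] _ [B' B0' GB]|F G _ [B B0 FB] _ [B' B0' GB]|F G FG _ [B B0 FB]].
- by exists (normc c); rewrite ?normc_ge0.
- by have [B B0 HB] := curve_bounded gc; exists B; rewrite ?ltW.
- have [d d0 Hd] := curve_dist gc K0; exists d^-1; first by rewrite invr_ge0 ltW.
  move=> t t01; have := Hd t t01; rewrite subr0 => dt.
  by rewrite normcV lef_pV2 ?posrE// (lt_le_trans d0).
- exists (B + B'); first exact: addr_ge0.
  by move=> t t01; rewrite (le_trans (ler_normcD _ _))// lerD ?FB ?GB.
- exists (B * B'); first exact: mulr_ge0.
  by move=> t t01; rewrite normcM ler_pM ?normc_ge0 ?FB ?GB.
- by exists B => // t t01; rewrite /= -FG ?FB// curve_neq0.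
Qed.

Lemma ucb_isL F : isL F -> ucb (fun=> F) F.
Proof. by move=> /isL_bounded[B B0]; exact: ucb_cst. Qed.

(* Lying inside or outside the curve is expressed by winding numbers. *)
Definition separated (es : seq C) := forall e, e \in es -> e != 0 /\ forall k : nat,
  [/\ ~ K (e * q ^+ k), ~ K (e^-1 * q ^- k),
      CInt (fun x => (x - e * q ^+ k)^-1) (two_pi_i R) &
      CInt (fun x => (x - e^-1 * q ^- k)^-1) 0].

(** Truncation of [psi], a weight invariant under x -> s/x. The case s = 1, nu = q is [rho]; the
    case s = q, nu = 1 serves in [wint_zero]. *)
Definition psiN (s nu : C) (es : seq C) n (x : C) :=
  fpoch q n (nu * x ^+ 2) * fpoch q n (nu * s ^+ 2 * x ^- 2) *
  \prod_(e <- es) ((fpoch q n (e * x))^-1 * (fpoch q n (e * s / x))^-1).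

Definition psi (s nu : C) (es : seq C) (x : C) :=
  qpoch (nu * x ^+ 2) q * qpoch (nu * s ^+ 2 * x ^- 2) q *
  \prod_(e <- es) ((qpoch (e * x) q)^-1 * (qpoch (e * s / x) q)^-1).

Lemma psiN_sym s nu es n x : s != 0 -> x != 0 -> psiN s nu es n (s / x) = psiN s nu es n x.
Proof.
move=> s0 x0; rewrite /psiN [fpoch q n (nu * (s / x) ^+ 2) * _]mulrC; congr (_ * _).
  by congr (fpoch q n _ * fpoch q n _); rewrite ?expr_div_n; field; rewrite ?s0 ?x0.
apply: eq_bigr => e _; rewrite mulrC.
by congr ((fpoch q n _)^-1 * (fpoch q n _)^-1); field; rewrite ?s0 ?x0.
Qed.

Variables (i : nat) (es : seq C).
Hypothesis esP : separated es.
Local Notation s := (q ^+ i).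

Lemma ucb_psi nu : ucb (psiN s nu es) (psi s nu es).
Proof.
have bnd F : isL F -> exists Y, on_curve (fun x => normc (F x) <= Y).
  by move=> /isL_bounded[B _]; exists B.
have sqL : isL (fun x : C => x ^- 2) by exact/isL_expV/isL_V.
apply: ucbM.
  apply: ucbM.
    have [Y HY] := bnd _ (isL_scale nu (isL_exp 2 (isL_id R))); exact: ucb_fpoch HY.
  have [Y HY] := bnd _ (isL_scale (nu * s ^+ 2) sqL); exact: ucb_fpoch HY.
elim: es esP => [|e es' ih] esP'.
  apply: ucb_eq (ucb_isL (isL_cst 1)) => [n t _|t _]; by rewrite big_nil.
have {}ih := ih (fun e' h => esP' e' ltac:(by rewrite inE h orbT)).
have [e0 ek] := esP' e (mem_head _ _).
have h1 : ucb (fun n x => (fpoch q n (e * x))^-1) (fun x => (qpoch (e * x) q)^-1).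
  have [Y HY] := bnd _ (isL_scale e (isL_id R)); apply: ucb_fpochV HY _ => j.
  have [_ /(curve_dist gc)[d d0 Hd] _ _] := ek j.
  have eq0 : e * q ^+ j != 0 by rewrite mulf_neq0// expf_neq0.
  exists (normc (e * q ^+ j) * d); first by rewrite mulr_gt0// normc_gt0.
  move=> t t01; rewrite (_ : 1 - _ = - (e * q ^+ j * (g t - e^-1 * q ^- j))).
    by rewrite normcN (normcM (e * q ^+ j)) ler_wpM2l ?normc_ge0// Hd.
  by field; rewrite expf_neq0 ?e0.
have h2 : ucb (fun n x => (fpoch q n (e * s / x))^-1) (fun x => (qpoch (e * s / x) q)^-1).
  have [Y HY] := bnd _ (isL_scale (e * s) (isL_V R)); apply: ucb_fpochV HY _ => j.
  have [/(curve_dist gc)[d d0 Hd] _ _ _] := ek (i + j)%N.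
  have [B B0 HB] := curve_bounded gc.
  exists (d / B); first by rewrite divr_gt0.
  move=> t t01; have t0 := curve_neq0 t01.
  rewrite (_ : 1 - _ = (g t - e * q ^+ (i + j)) / g t).
    rewrite normcM normcV ler_pM ?invr_ge0 ?(ltW d0) ?(ltW B0) ?Hd//.
    by rewrite lef_pV2 ?posrE ?HB// normc_gt0.
  by rewrite exprD; field.
apply: ucb_eq (ucbM (ucbM h1 h2) ih) => [n t _|t _]; by rewrite big_cons.
Qed.

(** The two families are exchanged by x -> q^i / x. The first consists of points with winding number
    0, the second of points with winding number 1. *)
Definition poles : set C := [set p | exists2 e, e \in es &
  exists j : nat, p = e^-1 * q ^- j \/ p = e * q ^+ (i + j)].

Lemma poles_reflect p : poles p -> [/\ p != 0, ~ K p, ~ K (s / p) &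
  exists2 w, CInt (fun x => (x - p)^-1) w &
             CInt (fun x => (x - s / p)^-1) (two_pi_i R - w)].
Proof.
move=> [e ees [j pE]]; have [e0 ek] := esP ees.
have [k1 _ c1 _] := ek (i + j)%N; have [_ k2 _ c2] := ek j.
have q0' n : q ^+ n != 0 by rewrite expf_neq0.
case: pE => ->.
  have -> : s / (e^-1 * q ^- j) = e * q ^+ (i + j).
    by rewrite exprD; field; rewrite q0' e0.
  split => //; first by rewrite mulf_neq0 ?invr_eq0.
  by exists 0 => //; rewrite subr0.
have -> : s / (e * q ^+ (i + j)) = e^-1 * q ^- j.
  by rewrite exprD; field; rewrite !q0' e0.
split => //; first by rewrite mulf_neq0.
by exists (two_pi_i R) => //; rewrite subrr.
Qed.

Local Notation rat := (rat poles).

Lemma rat_psiN nu F n : rat F -> rat (fun x => psiN s nu es n x * F x).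
Proof.
have q0' m : q ^+ m != 0 by rewrite expf_neq0.
have num1 c k G : rat G -> rat (fun x => (1 - c * x ^+ 2 * q ^+ k) * G x).
  move=> rG; apply: rat_eq (rat_lin (- (c * q ^+ k)) (rat_mulX (rat_mulX rG)) rG) => x.
  by rewrite expr2; ring.
have num2 c k G : rat G -> rat (fun x => (1 - c * x ^- 2 * q ^+ k) * G x).
  move=> rG; apply: rat_eq (rat_lin (- (c * q ^+ k)) (rat_mulV poles_reflect (rat_mulV poles_reflect rG)) rG) => x.
  by rewrite expr2 invfM; ring.
have Num1 c m G : rat G -> rat (fun x => fpoch q m (c * x ^+ 2) * G x).
  move=> rG; elim: m => [|m ih]; first by apply: rat_eq rG => x; rewrite fpoch0 mul1r.
  by apply: rat_eq (num1 c m _ ih) => x; rewrite fpochS; ring.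
have Num2 c m G : rat G -> rat (fun x => fpoch q m (c * x ^- 2) * G x).
  move=> rG; elim: m => [|m ih]; first by apply: rat_eq rG => x; rewrite fpoch0 mul1r.
  by apply: rat_eq (num2 c m _ ih) => x; rewrite fpochS; ring.
have pole_neq p x : poles p -> ~ poles x -> x - p != 0.
  by move=> Sp Sx; rewrite subr_eq0; apply/eqP => xp; apply: Sx; rewrite xp.
have Den1 e m G : e \in es -> rat G -> rat (fun x => (fpoch q m (e * x))^-1 * G x).
  move=> ees rG; have [e0 _] := esP ees.
  elim: m => [|m ih]; first by apply: rat_eq rG => x; rewrite fpoch0 invr1 mul1r.
  have Sp : poles (e^-1 * q ^- m) by exists e => //; exists m; left.
  apply: rat_ext (rat_scale (- (e * q ^+ m)^-1) (rat_mul_pole poles_reflect Sp ih)) => x x0 /(pole_neq _ _ Sp) xp.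
  rewrite fpochS [(fpoch q m _ * _)^-1]invfM.
  rewrite (_ : (1 - e * x * q ^+ m)^-1 = - (e * q ^+ m)^-1 * (x - e^-1 * q ^- m)^-1); first ring.
  rewrite (_ : 1 - _ = - (e * q ^+ m) * (x - e^-1 * q ^- m)); last first.
    by field; rewrite q0' e0.
  by rewrite invfM invrN.
have Den2 e m G : e \in es -> rat G -> rat (fun x => (fpoch q m (e * s / x))^-1 * G x).
  move=> ees rG; have [e0 _] := esP ees.
  elim: m => [|m ih]; first by apply: rat_eq rG => x; rewrite fpoch0 invr1 mul1r.
  have Sp : poles (e * q ^+ (i + m)) by exists e => //; exists m; right.
  apply: rat_ext (rat_mulX (rat_mul_pole poles_reflect Sp ih)) => x x0 /(pole_neq _ _ Sp) xp.
  rewrite fpochS [(fpoch q m _ * _)^-1]invfM.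
  rewrite (_ : (1 - e * s / x * q ^+ m)^-1 = x * (x - e * q ^+ (i + m))^-1); first ring.
  rewrite (_ : 1 - _ = (x - e * q ^+ (i + m)) / x); last by rewrite exprD; field.
  by rewrite invf_div.
move=> rF.
suff H es' : {subset es' <= es} -> rat (fun x => \prod_(e <- es')
    ((fpoch q n (e * x))^-1 * (fpoch q n (e * s / x))^-1) * F x).
  apply: rat_eq (Num1 nu n _ (Num2 (nu * s ^+ 2) n _ (H es (fun _ => id)))) => x.
  by rewrite /psiN; ring.
elim: es' => [_|e es' ih sub]; first by apply: rat_eq rF => x; rewrite big_nil mul1r.
have ees : e \in es by apply: sub; rewrite mem_head.
apply: rat_eq (Den1 e n _ ees (Den2 e n _ ees (ih _))) => [x|e' e'es].
  by rewrite big_cons; ring.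
by apply: sub; rewrite inE e'es orbT.
Qed.

Lemma rat_isL F G : isL F -> rat G -> rat (fun x => F x * G x).
Proof.
move=> FL; elim: FL G => {F} [c|||F F' _ ih _ ih'|F F' _ ih _ ih'|F F' FF _ ih] G rG.
- exact: rat_scale.
- exact: rat_mulX.
- exact: (rat_mulV poles_reflect).
- by apply: rat_eq (rat_add (ih _ rG) (ih' _ rG)) => x; rewrite mulrDl.
- by apply: rat_eq (ih _ (ih' _ rG)) => x; rewrite mulrA.
- by apply: rat_ext (ih _ rG) => x x0 _; rewrite FF.
Qed.

Lemma psi_reflect nu F : isL F ->
  exists2 v, CInt (fun x => psi s nu es x * F x / x) v &
             CInt (fun x => psi s nu es x * F (s / x) / x) v.
Proof.
move=> FL; have s0 : s != 0 by rewrite expf_neq0.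
have rF n : rat (fun x => psiN s nu es n x * F x).
  by apply: rat_psiN; apply: rat_eq (rat_isL FL (rat_1 _)) => x; rewrite mulr1.
have H n := rat_reflect s0 poles_reflect (rF n).
pose v n := s2val (cid2 (H n)).
have v1 n : CInt (fun x => psiN s nu es n x * F x / x) (v n) by exact: s2valP (cid2 (H n)).
have v2 n : CInt (fun x => psiN s nu es n x * F (s / x) / x) (v n).
  apply: CInt_ext (s2valP' (cid2 (H n))) => t t01.
  by rewrite psiN_sym// curve_neq0.
have U1 F' : isL F' -> uconv g (fun n x => psiN s nu es n x * F' x / x) (fun x => psi s nu es x * F' x / x).
  move=> FL'; have [] // := ucbM (ucbM (ucb_psi nu) (ucb_isL FL')) (ucb_isL (isL_V R)).
have [w w1 vw] := CInt_uconv gL v1 (U1 _ FL).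
have [w' w1' vw'] := CInt_uconv gL v2 (U1 _ (isL_comp_inv s0 FL)).
by exists w => //; rewrite (cconv_uniq vw vw').
Qed.

End WeightReflection.

(** * The Askey-Wilson integral *)

Section Functional.

(** The integral of F dx/x as a total functional; the default 0 is never met where existence has
    been shown, as in [lintP] and [wintI]. *)
Definition lint (F : C -> C) : C := xget 0 [set v | CInt (fun x => F x / x) v].

Lemma lint_unique F v : CInt (fun x => F x / x) v -> lint F = v.
Proof.
move=> Fv; rewrite /lint; case: xgetP => [w _ Fw|/(_ v)//].
exact: (CInt_uniq gL Fw Fv).
Qed.

(** With 0 as the only pole there is no pairing condition to meet, so the reflection is available
    for every nonzero s. *)
Lemma lintP s F : s != 0 -> isL F ->
  CInt (fun x => F x / x) (lint F) /\ CInt (fun x => F (s / x) / x) (lint F).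
Proof.
move=> s0 FL.
have S0 (p : C) : set0 p -> [/\ p != 0, ~ K p, ~ K (s / p) &
  exists2 w, CInt (fun x => (x - p)^-1) w &
             CInt (fun x => (x - s / p)^-1) (two_pi_i R - w)] by [].
have rF : rat set0 F.
  suff H : forall G, rat set0 G -> rat set0 (fun x => F x * G x).
    by apply: rat_eq (H _ (rat_1 _)) => x; rewrite mulr1.
  elim: FL => {F} [c|||F F' _ ih _ ih'|F F' _ ih _ ih'|F F' FF _ ih] G rG.
  - exact: rat_scale.
  - exact: rat_mulX.
  - exact: (rat_mulV S0).
  - by apply: rat_eq (rat_add (ih _ rG) (ih' _ rG)) => x; rewrite mulrDl.
  - by apply: rat_eq (ih _ (ih' _ rG)) => x; rewrite mulrA.
  - by apply: rat_ext (ih _ rG) => x x0 _; rewrite FF.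
by have [v v1 v2] := rat_reflect s0 S0 rF; rewrite (lint_unique v1).
Qed.

Lemma lintI F : isL F -> CInt (fun x => F x / x) (lint F).
Proof. by move=> FL; have [] := lintP (oner_neq0 _) FL. Qed.

Lemma lint_reflect s F : s != 0 -> isL F -> lint (fun x => F (s / x)) = lint F.
Proof. by move=> s0 FL; apply: lint_unique; have [] := lintP s0 FL. Qed.

Lemma lint_ext F G : isL F -> (forall x, x != 0 -> F x = G x) -> lint F = lint G.
Proof.
move=> FL FG; apply/esym/lint_unique.
by apply: CInt_ext (lintI FL) => t t01; rewrite FG// curve_neq0.
Qed.

(** A scaling is the composite of two reflections. *)
Lemma lint_shift s F : s != 0 -> isL F -> lint (fun x => F (s * x)) = lint F.
Proof.
move=> s0 FL; rewrite -[RHS](lint_reflect s0)//.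
rewrite -[LHS](lint_reflect (oner_neq0 C)); last exact: isL_comp_scale.
apply: lint_ext => [|x x0]; last by rewrite mul1r.
by have /(isL_comp_inv (oner_neq0 C)) := isL_comp_scale s0 FL.
Qed.

Lemma lint_lin c F G : isL F -> isL G -> lint (fun x => c * F x + G x) = c * lint F + lint G.
Proof.
move=> FL GL; apply: lint_unique.
by apply: CInt_ext (CInt_lin c (lintI FL) (lintI GL)) => t _; ring.
Qed.

Lemma lintZ c F : isL F -> lint (fun x => c * F x) = c * lint F.
Proof.
move=> FL; apply: lint_unique.
by apply: CInt_ext (CIntZ c (lintI FL)) => t _; ring.
Qed.

Lemma lint1 : lint (fun=> 1) = two_pi_i R.
Proof. by apply: lint_unique; apply: CInt_ext wind0 => t _; rewrite mul1r. Qed.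

Variables (q k : C).
Hypothesis q1 : normc q < 1.
Hypothesis q0 : q != 0.
Hypothesis kq : k ^+ 2 = q.

Let k0 : k != 0. Proof. by apply: contra_neq q0 => k0; rewrite -kq k0 expr0n. Qed.

Definition theta n (y : C) : C := fpoch q n y * fpoch q n (q / y).

Lemma thetaS n y : theta n.+1 y = theta n y * ((1 - q ^+ n * y) * (1 - q ^+ n.+1 / y)).
Proof. by rewrite /theta !fpochS exprSr; ring. Qed.

Lemma theta_shift n y : y != 0 ->
  (y - q ^+ n) * theta n (q * y) = - (1 - q ^+ n * y) * theta n y.
Proof.
move=> y0; elim: n => [|n ih]; first by rewrite /theta !fpoch0 expr0; ring.
rewrite !thetaS.
rewrite (_ : _ * _ = ((y - q ^+ n) * theta n (q * y)) *
  ((1 - q ^+ n.+1 * y) * (1 - q ^+ n.+1 / y))); last first.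
  by rewrite exprS; field; rewrite q0 y0.
by rewrite ih; ring.
Qed.

Lemma theta_isL n : isL (fun x => theta n (x ^+ 2)).
Proof.
elim: n => [|n ih].
  by apply: isL_eq (isL_cst 1) => x; rewrite /theta !fpoch0 mulr1.
apply: (@isL_eq _ (fun x => theta n (x ^+ 2) * ((1 - q ^+ n * x ^+ 2) * (1 - q ^+ n.+1 * x ^- 2)))).
  by move=> x; rewrite thetaS.
apply: isL_mul => //; apply: isL_mul; apply: isL_sub; try exact: isL_cst; apply: isL_scale.
  exact/isL_exp/isL_id.
exact/isL_expV/isL_V.
Qed.

(** Up to 2 pi i, [cf] and [cf1] are the coefficients of 1 and of x^2 in the truncated theta
    function of x^2. *)
Let cf n := lint (fun x => theta n (x ^+ 2)).
Let cf1 n := lint (fun x => x ^- 2 * theta n (x ^+ 2)).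

Let tL n := theta_isL n.
Let sqL : isL (fun x : C => x ^+ 2). Proof. exact/isL_exp/isL_id. Qed.
Let sqVL : isL (fun x : C => x ^- 2). Proof. exact/isL_expV/isL_V. Qed.

(** The integral of [F] is computed twice: directly by [theta_shift], and after the scaling x ->
    x/k, which turns q x^2 into x^2. This is where a square root of q is needed. *)
Lemma theta_coef1 n : (1 - q ^+ n.+1) * cf1 n = (q ^+ n - 1) * cf n.
Proof.
pose F x := x ^- 2 * ((x ^+ 2 - q ^+ n) * theta n (q * x ^+ 2)).
have FE x : x != 0 -> F x = - x ^- 2 * theta n (x ^+ 2) + q ^+ n * theta n (x ^+ 2).
  move=> x0; rewrite /F theta_shift ?expf_neq0//.
  by set th := theta n _; set qn := q ^+ n; field.
have FL : isL F.
  apply: (@isL_ext _ (fun x => - x ^- 2 * theta n (x ^+ 2) + q ^+ n * theta n (x ^+ 2))).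
    by move=> x x0; rewrite FE.
  by apply: isL_add; [apply: isL_mul => //; exact: isL_opp|exact: isL_scale].
have e1 : lint F = - cf1 n + q ^+ n * cf n.
  rewrite (lint_ext (G := fun x => -1 * (x ^- 2 * theta n (x ^+ 2)) + q ^+ n * theta n (x ^+ 2)) FL).
    rewrite lint_lin ?lintZ ?mulN1r//; first exact: isL_mul.
    exact: isL_scale.
  by move=> x x0; rewrite FE//; ring.
have : lint F = cf n - q ^+ n.+1 * cf1 n.
  rewrite -(lint_shift (s := k^-1)) ?invr_eq0//.
  rewrite (lint_ext (G := fun x => - q ^+ n.+1 * (x ^- 2 * theta n (x ^+ 2)) + theta n (x ^+ 2))).
  - by rewrite lint_lin//; [rewrite mulNr addrC|exact: isL_mul].
  - by apply: isL_comp_scale; rewrite ?invr_eq0.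
  - move=> x x0; rewrite /F exprMn exprVn kq mulVKf//.
    rewrite [q ^+ n.+1]exprS; set th := theta n _; set qn := q ^+ n.
    by field; rewrite x0 q0.
rewrite e1 => /eqP; rewrite -subr_eq0 => /eqP H; apply/eqP; rewrite -subr_eq0.
by apply/eqP; rewrite -[RHS]oppr0 -H; ring.
Qed.

(** The reflection x -> k/x sends x^2 to q/x^2, and theta is invariant under y -> q/y. *)
Lemma theta_coefN n : lint (fun x => x ^+ 2 * theta n (x ^+ 2)) = q * cf1 n.
Proof.
rewrite -(lint_reflect k0); last exact: isL_mul.
rewrite -lintZ; last exact: isL_mul.
apply: lint_ext => [|x x0].
  by apply: (isL_comp_inv k0 (F := fun x => x ^+ 2 * theta n (x ^+ 2))); exact: isL_mul.
rewrite expr_div_n kq -mulrA; congr (_ * (_ * _)).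
rewrite /theta [RHS]mulrC; congr (_ * fpoch q n _).
by field; rewrite q0 x0.
Qed.

Lemma theta_coef0S n : (1 - q ^+ n.+1) ^+ 2 * cf n.+1 =
  (1 - q ^+ n.*2.+1) * (1 - q ^+ n.*2.+2) * cf n.
Proof.
have E : cf n.+1 = (1 + q ^+ n.*2.+1) * cf n - 2 * q ^+ n.+1 * cf1 n.
  rewrite /cf (lint_ext (G := fun x => - q ^+ n.+1 * (x ^- 2 * theta n (x ^+ 2)) +
    (- q ^+ n * (x ^+ 2 * theta n (x ^+ 2)) + (1 + q ^+ n.*2.+1) * theta n (x ^+ 2)))) //.
    have L1 : isL (fun x => x ^- 2 * theta n (x ^+ 2)) by exact: isL_mul.
    have L2 : isL (fun x => x ^+ 2 * theta n (x ^+ 2)) by exact: isL_mul.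
    have L3 : isL (fun x => (1 + q ^+ n.*2.+1) * theta n (x ^+ 2)) by exact: isL_scale.
    rewrite lint_lin//; last by apply: isL_add => //; exact: isL_scale.
    rewrite lint_lin// lintZ// theta_coefN -/(cf n) -/(cf1 n) exprS; ring.
  move=> x x0; rewrite thetaS -addnn -addnS exprD exprS.
  set th := theta n _; set qn := q ^+ n; by field.
have := theta_coef1 n; rewrite E.
have -> : q ^+ n.*2.+2 = q ^+ n.+1 * q ^+ n.+1 by rewrite -exprD addSn addnS addnn.
have -> : q ^+ n.*2.+1 = q ^+ n * q ^+ n.+1 by rewrite -exprD addnS addnn.
rewrite exprS; set qn := q ^+ n => H.
rewrite (_ : _ * (_ - _) = (1 - q * qn) * ((1 - q * qn) * (1 + qn * (q * qn)) * cf n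
  - 2 * (q * qn) * ((1 - q * qn) * cf1 n))); last by ring.
by rewrite H; ring.
Qed.

(** The constant term is the central q-binomial coefficient, as in the finite form of the Jacobi
    triple product. *)
Lemma theta_coef0 n : fpoch q n q ^+ 2 * cf n = fpoch q n.*2 q * two_pi_i R.
Proof.
elim: n => [|n ih].
  rewrite double0 fpoch0 expr1n !mul1r /cf -lint1.
  by apply: lint_ext => [|x _] //; rewrite /theta !fpoch0 mulr1.
have fS m : fpoch q m.+1 q = fpoch q m q * (1 - q ^+ m.+1) by rewrite fpochS exprS.
rewrite doubleS !fS.
rewrite (_ : _ ^+ 2 * _ = fpoch q n q ^+ 2 * ((1 - q ^+ n.+1) ^+ 2 * cf n.+1)); last by ring.
rewrite theta_coef0S.
transitivity ((1 - q ^+ n.*2.+1) * (1 - q ^+ n.*2.+2) * (fpoch q n q ^+ 2 * cf n)).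
  by ring.
by rewrite ih; ring.
Qed.

(* the constant term of (x^2, x^-2; q)_oo *)
Lemma CInt_base : exists2 w, CInt (fun x => qpoch (x ^+ 2) q * qpoch (q * x ^- 2) q *
  (1 - x ^- 2) / x) w & w * qpoch q q = 2 * two_pi_i R.
Proof.
have WL : isL (fun x : C => 1 - x ^- 2) by apply: isL_sub => //; exact: isL_cst.
have L1 n : isL (fun x => theta n (x ^+ 2) * (1 - x ^- 2)) by exact: isL_mul.
have [|w Iw vw] := CInt_uconv gL (fun n => lintI (L1 n))
    (G := fun x => qpoch (x ^+ 2) q * qpoch (q * x ^- 2) q * (1 - x ^- 2) / x).
  have [Y1 _ H1] := isL_bounded sqL.
  have [Y2 _ H2] := isL_bounded (isL_scale q sqVL).
  by have [] := ucbM (ucbM (ucbM (ucb_fpoch q1 H1) (ucb_fpoch q1 H2))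
    (ucb_isL WL)) (ucb_isL (isL_V R)).
exists w => //.
(* By [theta_coef1], [cf1 n] approaches -[cf n] as n grows; hence the factor 2 in the limit. *)
have V n : lint (fun x => theta n (x ^+ 2) * (1 - x ^- 2)) = cf n - cf1 n.
  rewrite -mulN1r -/(cf n) addrC -lint_lin//; last exact: isL_mul.
  by apply: lint_ext => // x _; ring.
have E n : lint (fun x => theta n (x ^+ 2) * (1 - x ^- 2)) *
    (fpoch q n q * fpoch q n q * (1 - q * q ^+ n)) =
    (2 + - q ^+ n + - q * q ^+ n) * (fpoch q n.*2 q * two_pi_i R).
  rewrite V -theta_coef0; have := theta_coef1 n; rewrite [q ^+ n.+1]exprS => H.
  transitivity (fpoch q n q ^+ 2 * ((1 - q * q ^+ n) * cf n - (1 - q * q ^+ n) * cf1 n)).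
    by ring.
  by rewrite H; ring.
have c0 := cconv_expr q1.
have cq := qpoch_conv q1 q.
have cqn : cconv (fun n => q * q ^+ n) 0 by rewrite -(mulr0 q); exact/cconvM/c0/cconv_cst.
have cNqn : cconv (fun n => - q * q ^+ n) 0 by rewrite -(mulr0 (- q)); exact/cconvM/c0/cconv_cst.
have cNn : cconv (fun n => - q ^+ n) 0.
  by rewrite -(mulr0 (-1)); apply: cconv_eq (cconvM (cconv_cst (-1)) c0) => n; rewrite mulN1r.
have cN1 : cconv (fun n => 1 - q * q ^+ n) 1.
  rewrite -[1 in X in cconv _ X]subr0 -mulN1r; apply: cconvD; first exact: cconv_cst.
  by rewrite mulr0; apply: cconv_eq cNqn => n; rewrite mulNr.
have lhs := cconvM vw (cconvM (cconvM cq cq) cN1).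
have rhs := cconvM (cconvD (cconvD (cconv_cst 2) cNn) cNqn)
  (cconvM (cconv_sub (f := double) (fun n => ltac:(by rewrite -addnn leq_addr)) cq) (cconv_cst (two_pi_i R))).
have {lhs} lhs := cconv_eq E lhs.
have := cconv_uniq lhs rhs; rewrite mulr1 !addr0.
have qn0 : qpoch q q != 0.
  apply: qpoch_neq0 => // j; rewrite -exprS; apply/eqP => /(congr1 (@normc R)).
  rewrite normcX normc1; apply/eqP; rewrite lt_eqF// exprn_ilt1 ?normc_ge0//.
by move=> H; apply: (mulIf qn0); rewrite -mulrA H; ring.
Qed.

End Functional.

Section AskeyWilsonIntegral.
Variables (q k : C).
Hypothesis q1 : normc q < 1.
Hypothesis q0 : q != 0.
Hypothesis kq : k ^+ 2 = q.
Local Notation separated := (separated q).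

(* [rho * (1 - x^2) * (1 - x^-2)] is [Delta_plus]. *)
Definition rho := psi q 1 q.

Definition wint (es : seq C) (F : C -> C) : C := lint (fun x => rho es x * F x).

Lemma wint_reflect es F : separated es -> isL F ->
  CInt (fun x => rho es x * F x / x) (wint es F) /\
  CInt (fun x => rho es x * F x^-1 / x) (wint es F).
Proof.
move=> esP FL.
have [v v1 v2] := psi_reflect q1 q0 0 esP q FL.
rewrite /wint (lint_unique v1); split => //.
by apply: CInt_ext v2 => t _; rewrite div1r.
Qed.

Lemma wintI es F : separated es -> isL F -> CInt (fun x => rho es x * F x / x) (wint es F).
Proof. by move=> esP /(wint_reflect esP)[]. Qed.

Lemma wintV es F : separated es -> isL F -> wint es (fun x => F x^-1) = wint es F.
Proof. by move=> esP /(wint_reflect esP)[_ H]; exact: (lint_unique H). Qed.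

Lemma wint_curve_ext es es' F G : separated es -> isL F ->
  on_curve (fun x => rho es x * F x = rho es' x * G x) -> wint es F = wint es' G.
Proof.
move=> esP FL FG; apply/esym/lint_unique.
by apply: CInt_ext (wintI esP FL) => t t01; rewrite FG.
Qed.

Lemma wint_ext es F G : separated es -> isL F -> (forall x, x != 0 -> F x = G x) ->
  wint es F = wint es G.
Proof.
move=> esP FL FG; apply: wint_curve_ext => // t t01.
by rewrite FG// curve_neq0.
Qed.

Lemma wint_lin es c F G : separated es -> isL F -> isL G ->
  wint es (fun x => c * F x + G x) = c * wint es F + wint es G.
Proof.
move=> esP FL GL; apply: lint_unique.
by apply: CInt_ext (CInt_lin c (wintI esP FL) (wintI esP GL)) => t _; ring.
Qed.

Lemma wintZ es c F : separated es -> isL F -> wint es (fun x => c * F x) = c * wint es F.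
Proof.
move=> esP FL; apply: lint_unique.
by apply: CInt_ext (CIntZ c (wintI esP FL)) => t _; ring.
Qed.

Lemma wintD es F G : separated es -> isL F -> isL G ->
  wint es (fun x => F x + G x) = wint es F + wint es G.
Proof.
move=> esP FL GL; apply: lint_unique.
by apply: CInt_ext (CIntD (wintI esP FL) (wintI esP GL)) => t _; ring.
Qed.

Lemma wint_antisym es F : separated es -> isL F ->
  (forall x, x != 0 -> F x^-1 = - F x) -> wint es F = 0.
Proof.
move=> esP FL Fa; have := wintV esP FL.
rewrite (wint_ext (G := fun x => -1 * F x) esP (isL_comp_V FL)); last first.
  by move=> x x0; rewrite Fa// mulN1r.
by rewrite wintZ// mulN1r => /esym/eqP; rewrite -addr_eq0 -mulr2n mulrn_eq0/= => /eqP.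
Qed.

Lemma wint_perm es es' F : perm_eq es es' -> wint es F = wint es' F.
Proof.
move=> ee; rewrite /wint; congr lint; apply/funext => x.
rewrite /rho /psi.
by rewrite (perm_big _ ee).
Qed.

Lemma separated_perm es es' : perm_eq es es' -> separated es -> separated es'.
Proof. by move=> ee esP e; rewrite -(perm_mem ee); exact: esP. Qed.

Lemma separated_shift a n es : separated (a :: es) -> separated (a * q ^+ n :: es).
Proof.
move=> esP e; rewrite inE => /orP[/eqP ->|ees]; last by apply: esP; rewrite inE ees orbT.
have [a0 aP] := esP a (mem_head _ _).
split; first by rewrite mulf_neq0// expf_neq0.
move=> j; have := aP (n + j)%N.
rewrite exprD mulrA (_ : a^-1 / _ = (a * q ^+ n)^-1 / q ^+ j)//.
by field; rewrite !expf_neq0// a0.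
Qed.

Lemma separated_neq1 es e t j : separated es -> e \in es -> 0 <= t <= 1 ->
  1 - e * g t * q ^+ j != 0 /\ 1 - e / g t * q ^+ j != 0.
Proof.
move=> esP ees t01; have [e0 /(_ j)[k1 k2 _ _]] := esP e ees.
have t0 := curve_neq0 t01.
have h1 := curve_neq t01 k1; have h2 := curve_neq t01 k2.
have qj : q ^+ j != 0 by rewrite expf_neq0.
split.
  rewrite (_ : 1 - _ = - (e * q ^+ j) * (g t - e^-1 * q ^- j)).
    by rewrite mulf_neq0// oppr_eq0 mulf_neq0.
  by field; rewrite qj e0.
rewrite (_ : 1 - _ = (g t - e * q ^+ j) / g t); last by field.
by rewrite mulf_neq0// invr_eq0.
Qed.

Lemma curve_fpoch_neq0 es e t n : separated es -> e \in es -> 0 <= t <= 1 ->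
  fpoch q n (e * g t) != 0 /\ fpoch q n (e / g t) != 0.
Proof.
move=> esP ees t01; rewrite /fpoch.
by split; apply/prodf_neq0 => j _; have [] := separated_neq1 j esP ees t01.
Qed.

Lemma curve_qpoch_neq0 es e t : separated es -> e \in es -> 0 <= t <= 1 ->
  qpoch (e * g t) q != 0 /\ qpoch (e / g t) q != 0.
Proof.
move=> esP ees t01.
by split; apply: qpoch_neq0 => // j; rewrite eq_sym -subr_eq0;
  have [] := separated_neq1 j esP ees t01.
Qed.

(** Since (y; q)_oo = (y; q)_n (y q^n; q)_oo, shifting a parameter amounts to inserting a Laurent
    polynomial factor. *)
Lemma wint_shift n a es F : separated (a :: es) -> isL F ->
  wint (a * q ^+ n :: es) F = wint (a :: es) (fun x => symfac q n a x * F x).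
Proof.
move=> esP FL; apply: wint_curve_ext => //; first exact: separated_shift.
move=> t t01; have [f1 f2] := curve_fpoch_neq0 n esP (mem_head _ _) t01.
rewrite /rho /psi !big_cons !mulr1 /symfac.
rewrite (qpoch_fpoch q1 n (a * g t)) (qpoch_fpoch q1 n (a / g t)) !invfM.
rewrite [a * g t * q ^+ n]mulrAC [a / g t * q ^+ n]mulrAC.
set u := (qpoch _ _)^-1; set v := (qpoch _ _)^-1.
by field; rewrite f1 f2.
Qed.

(* The kernel of the functional: the weight of [T0], a reflection-invariant
   multiple of [rho], kills functions which are odd under x -> q/x. *)
Lemma wint_zero es Z : separated es -> isL Z ->
  (forall x, x != 0 -> Z (q / x) * (q / x ^+ 2) = Z x) ->
  wint es (fun x => (1 - x ^+ 2) * (\prod_(e <- es) (1 - e / x)) * x ^+ 2 * Z x) = 0.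
Proof.
move=> esP ZL Zq; apply: lint_unique.
have FL : isL (fun x => (x ^+ 2 - q) * Z x).
  by apply: isL_mul => //; apply: isL_sub; [exact/isL_exp/isL_id|exact: isL_cst].
have [v v1 v2] := psi_reflect q1 q0 1 esP 1 FL.
have v0 : v = 0.
  suff /(CInt_uniq gL v2)/eqP : CInt (fun x => psi q (q ^+ 1) 1 es x *
      (((q ^+ 1 / x) ^+ 2 - q) * Z (q ^+ 1 / x)) / x) (-1 * v).
    by rewrite mulN1r -addr_eq0 -mulr2n mulrn_eq0/= => /eqP.
  apply: CInt_ext (CIntZ (-1) v1) => t t01; have t0 := curve_neq0 t01.
  rewrite -[Z (g t)]Zq// !expr1 expr_div_n.
  by set w := psi _ _ _ _ _; set z := Z _; field.
rewrite v0 in v1; apply: CInt_ext v1 => t t01; have t0 := curve_neq0 t01.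
rewrite /rho /psi expr1 !expr1n !mulr1 !mul1r.
rewrite (qpochS q1 (g t ^+ 2)) (qpochS q1 (q * g t ^- 2)).
rewrite [q * g t ^+ 2]mulrC.
have -> : q ^+ 2 * g t ^- 2 = q * g t ^- 2 * q by rewrite expr2; ring.
rewrite (_ : \prod_(e <- es) ((qpoch (e * g t) q)^-1 * (qpoch (e * 1 / g t) q)^-1) =
  (\prod_(e <- es) ((qpoch (e * g t) q)^-1 * (qpoch (e * q / g t) q)^-1)) *
  (\prod_(e <- es) (1 - e / g t))^-1).
  have nz : \prod_(e <- es) (1 - e / g t) != 0.
    rewrite prodf_seq_neq0; apply/allP => e ees.
    by have [_ ] := separated_neq1 0 esP ees t01; rewrite expr0 mulr1.
  set u := \prod_(e <- es) (1 - e / g t) in nz *.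
  set w := \prod_(e <- es) _.
  by field; rewrite nz t0.
rewrite -prodfV -big_split/=; apply: eq_bigr => e _.
by rewrite mulr1 (qpochS q1 (e / g t)) invfM [e / g t * q]mulrAC; ring.
Qed.

Definition awint a b c d := wint [:: a; b; c; d] Wsym.

(** [wint_zero] with Z = 1/x, symmetrised under x -> 1/x, relates the integrals of 1 and of z = x +
    1/x (this is [key]). As (ax, a/x; q)_1 = 1 + a^2 - a z, that relation is a recurrence in a. *)
Lemma awint_step a b c d : separated [:: a; b; c; d] ->
  awint (a * q) b c d * (1 - a * b * c * d) =
  (1 - a * b) * (1 - a * c) * (1 - a * d) * awint a b c d.
Proof.
move=> esP; set es := [:: a; b; c; d].
pose G x := (1 - x ^+ 2) * (\prod_(e <- es) (1 - e / x)) * x ^+ 2 * x^-1.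
have linL e : isL (fun x : C => 1 - e / x).
  by apply: isL_sub; [exact: isL_cst|apply: isL_scale; exact: isL_V].
have GL : isL G.
  apply: isL_mul; last exact: isL_V.
  apply: isL_mul; last exact/isL_exp/isL_id.
  apply: isL_mul; last exact: isL_prod.
  by apply: isL_sub; [exact: isL_cst|exact/isL_exp/isL_id].
have G0 : wint es G = 0.
  apply: wint_zero => //; first exact: isL_V.
  by move=> x x0; field; rewrite q0 x0.
pose zW (x : C) := (x + x^-1) * Wsym x.
have WL := isL_Wsym R.
have zL : isL zW by apply: isL_mul => //; apply: isL_add; [exact: isL_id|exact: isL_V].
pose e1 := a + b + c + d.
pose e3 := a * b * c + a * b * d + a * c * d + b * c * d.
pose e4 := a * b * c * d.
have key : (1 - e4) * wint es zW + (e3 - e1) * wint es Wsym = 0.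
  have GVL := isL_comp_V GL.
  have : wint es (fun x => G x + G x^-1) = 0 by rewrite wintD// wintV// G0 addr0.
  rewrite -wintZ// -wint_lin//; last exact: isL_scale.
  move=> <-; apply: wint_ext => //.
    by apply: isL_add; exact: isL_scale.
  move=> x x0; rewrite /G /zW /Wsym /es !big_cons !big_nil /e1 /e3 /e4.
  by field.
have E : awint (a * q) b c d = (1 + a ^+ 2) * wint es Wsym - a * wint es zW.
  rewrite /awint -[q]expr1 wint_shift// -mulNr -!wintZ// -wintD//; try exact: isL_scale.
  apply: wint_ext => //; first by apply: isL_mul => //; exact: isL_symfac.
  by move=> x x0; rewrite /symfac /zW !fpochS !fpoch0 expr0; field.
rewrite E /awint -/es.
have -> : ((1 + a ^+ 2) * wint es Wsym - a * wint es zW) * (1 - a * b * c * d) =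
  (1 + a ^+ 2) * (1 - e4) * wint es Wsym - a * ((1 - e4) * wint es zW).
  by rewrite /e4; ring.
have -> : (1 - e4) * wint es zW = - ((e3 - e1) * wint es Wsym).
  by apply/eqP; rewrite -addr_eq0 key.
by rewrite /e1 /e3 /e4; ring.
Qed.

Lemma awint_shift n a b c d : separated [:: a; b; c; d] ->
  awint (a * q ^+ n) b c d * fpoch q n (a * b * c * d) =
  fpoch q n (a * b) * fpoch q n (a * c) * fpoch q n (a * d) * awint a b c d.
Proof.
move=> esP; elim: n => [|n ih]; first by rewrite !fpoch0 expr0 !mulr1 !mul1r.
have := awint_step (separated_shift (n := n) esP); rewrite -mulrA -exprSr => H.
rewrite !fpochS.
transitivity (awint (a * q ^+ n.+1) b c d * (1 - a * q ^+ n * b * c * d) * fpoch q n (a * b * c * d)).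
  by ring.
rewrite H.
transitivity ((1 - a * q ^+ n * b) * (1 - a * q ^+ n * c) * (1 - a * q ^+ n * d) *
  (awint (a * q ^+ n) b c d * fpoch q n (a * b * c * d))); first by ring.
by rewrite ih; ring.
Qed.

Lemma awint_perm a b c d a' b' c' d' : perm_eq [:: a; b; c; d] [:: a'; b'; c'; d'] ->
  awint a b c d = awint a' b' c' d'.
Proof. exact: wint_perm. Qed.

Lemma perm4_2 (a b c d : C) : perm_eq [:: a; b; c; d] [:: b; a; c; d].
Proof. by rewrite (perm_catCA [:: a] [:: b] [:: c; d]). Qed.
Lemma perm4_3 (a b c d : C) : perm_eq [:: a; b; c; d] [:: c; a; b; d].
Proof. by rewrite (perm_catCA [:: a; b] [:: c] [:: d]). Qed.
Lemma perm4_4 (a b c d : C) : perm_eq [:: a; b; c; d] [:: d; a; b; c].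
Proof. by rewrite (perm_catC [:: a; b; c] [:: d]). Qed.

Lemma awint_shift4 n a b c d : separated [:: a; b; c; d] ->
  awint (a * q ^+ n) (b * q ^+ n) (c * q ^+ n) (d * q ^+ n) * fpoch q (n + n + (n + n)) (a * b * c * d) =
  fpoch q (n + n) (a * b) * fpoch q (n + n) (a * c) * fpoch q (n + n) (a * d) *
  fpoch q (n + n) (b * c) * fpoch q (n + n) (b * d) * fpoch q (n + n) (c * d) * awint a b c d.
Proof.
move=> s1; have H1 := awint_shift n s1.
have s1' := separated_shift (n := n) s1.
have s2 := separated_perm (perm4_2 _ _ _ _) s1'; have H2 := awint_shift n s2.
have s2' := separated_shift (n := n) s2.
have s3 := separated_perm (perm4_3 _ _ _ _) s2'; have H3 := awint_shift n s3.
have s3' := separated_shift (n := n) s3.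
have s4 := separated_perm (perm4_4 _ _ _ _) s3'; have H4 := awint_shift n s4.
rewrite (awint_perm (a' := d * q ^+ n) (b' := c * q ^+ n) (c' := b * q ^+ n) (d' := a * q ^+ n)); last first.
  by rewrite -perm_rev.
rewrite -(awint_perm (perm4_2 (a * q ^+ n) b c d)) in H2.
rewrite -(awint_perm (perm4_3 (b * q ^+ n) (a * q ^+ n) c d)) in H3.
rewrite -(awint_perm (perm4_4 (c * q ^+ n) (b * q ^+ n) (a * q ^+ n) d)) in H4.
rewrite !fpochD exprD.
move: H1 H2 H3 H4; set Q := q ^+ n.
have -> : b * (a * Q) * c * d = a * b * c * d * Q by ring.
have -> : c * (b * Q) * (a * Q) * d = a * b * c * d * (Q * Q) by ring.
have -> : d * (c * Q) * (b * Q) * (a * Q) = a * b * c * d * (Q * Q) * Q by ring.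
have -> : b * (a * Q) = a * b * Q by ring.
have -> : c * (b * Q) = b * c * Q by ring.
have -> : c * (a * Q) = a * c * Q by ring.
have -> : d * (c * Q) = c * d * Q by ring.
have -> : d * (b * Q) = b * d * Q by ring.
have -> : d * (a * Q) = a * d * Q by ring.
move: (awint a b c d) (awint (a * Q) b c d) (awint (b * Q) (a * Q) c d).
move: (awint (c * Q) (b * Q) (a * Q) d) (awint (d * Q) (c * Q) (b * Q) (a * Q)).
move=> X3 X4 X0 X1 X2.
have regroup (f0 f1 f2 f3 : C) : X4 * (f0 * f1 * (f2 * f3)) = X4 * f3 * f2 * f1 * f0.
  by ring.
rewrite regroup => H1 H2 H3 ->.
rewrite -[X in X * _ * _]mulrA [X3 * _]mulrC.
transitivity (fpoch q n (c * d * Q) * fpoch q n (b * d * Q) * fpoch q n (a * d * Q) *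
  (X3 * fpoch q n (a * b * c * d * (Q * Q))) * fpoch q n (a * b * c * d * Q) *
  fpoch q n (a * b * c * d)); first by ring.
rewrite H3.
transitivity (fpoch q n (c * d * Q) * fpoch q n (b * d * Q) * fpoch q n (a * d * Q) *
  (fpoch q n (b * c * Q) * fpoch q n (a * c * Q) * fpoch q n (c * d)) *
  (X2 * fpoch q n (a * b * c * d * Q)) *
  fpoch q n (a * b * c * d)); first by ring.
rewrite H2.
transitivity (fpoch q n (c * d * Q) * fpoch q n (b * d * Q) * fpoch q n (a * d * Q) *
  (fpoch q n (b * c * Q) * fpoch q n (a * c * Q) * fpoch q n (c * d)) *
  (fpoch q n (a * b * Q) * fpoch q n (b * c) * fpoch q n (b * d)) *
  (X1 * fpoch q n (a * b * c * d))); first by ring.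
by rewrite H1; ring.
Qed.

Lemma wint_shift_all n es F : separated es -> isL F ->
  wint [seq e * q ^+ n | e <- es] F = wint es (fun x => \prod_(e <- es) symfac q n e x * F x).
Proof.
move=> esP FL; apply/esym; apply: wint_curve_ext => //.
  by apply: isL_mul => //; apply: isL_prod => e; exact: isL_symfac.
move=> t t01; rewrite /rho /psi big_map [LHS]mulrA -[X in X * F _ = _]mulrA.
congr (_ * _ * _); rewrite -big_split/=; apply: eq_big_seq => e ees.
have [f1 f2] := curve_fpoch_neq0 n esP ees t01.
rewrite !mulr1 /symfac (qpoch_fpoch q1 n (e * g t)) (qpoch_fpoch q1 n (e / g t)) !invfM.
rewrite [e * g t * q ^+ n]mulrAC [e / g t * q ^+ n]mulrAC.
set u := (qpoch _ _)^-1; set v := (qpoch _ _)^-1.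
by field; rewrite f1 f2.
Qed.

(* The two sides of [awint_shift4] are compared as n -> oo; on the left the
   weight tends to (q x^2, q x^-2; q)_oo. *)
Lemma askey_wilson a b c d : separated [:: a; b; c; d] ->
  awint a b c d * (qpoch q q * (qpoch (a * b) q * qpoch (a * c) q * qpoch (a * d) q *
    qpoch (b * c) q * qpoch (b * d) q * qpoch (c * d) q)) =
  2 * two_pi_i R * qpoch (a * b * c * d) q.
Proof.
move=> esP; set es := [:: a; b; c; d].
have [w wI wE] := CInt_base q1 q0 kq.
pose Phi n x := \prod_(e <- es) symfac q n e x.
have PhiWL n : isL (fun x => Phi n x * Wsym x).
  apply: isL_mul; last exact: isL_Wsym.
  by apply: isL_prod => e; exact: isL_symfac.
have I4 n : awint (a * q ^+ n) (b * q ^+ n) (c * q ^+ n) (d * q ^+ n) =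
    wint es (fun x => Phi n x * Wsym x).
  exact: (wint_shift_all n esP (isL_Wsym R)).
have Kb F : isL F -> exists Y, on_curve (fun x => normc (F x) <= Y).
  by move=> /isL_bounded[B _]; exists B.
have uPhi es' : ucb (fun n x => \prod_(e <- es') symfac q n e x)
    (fun x => \prod_(e <- es') (qpoch (e * x) q * qpoch (e / x) q)).
  elim: es' => [|e es' ih].
    by apply: ucb_eq (ucb_isL (isL_cst 1)) => [m t _|t _]; rewrite big_nil.
  have [Y1 H1] := Kb _ (isL_scale e (isL_id R)).
  have [Y2 H2] := Kb _ (isL_scale e (isL_V R)).
  apply: ucb_eq (ucbM (ucbM (ucb_fpoch q1 H1) (ucb_fpoch q1 H2)) ih) => [m t _|t _];
    by rewrite big_cons.
have urho : ucb (fun=> rho es) (rho es).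
  have [U [B B0 HB]] := ucb_psi q1 q0 0 esP q.
  exact: (ucb_cst (ucb_limit_bound U HB)).
have [U _] := ucbM (ucbM urho (ucbM (uPhi es) (ucb_isL (isL_Wsym R))))
  (ucb_isL (isL_V R)).
have [w' w'I vw'] := CInt_uconv gL (fun n => wintI esP (PhiWL n)) U.
have {w'I} ww' : w = w'.
  apply: (CInt_uniq gL wI); apply: CInt_ext w'I => t t01.
  have t0 := curve_neq0 t01; congr (_ / _).
  rewrite /rho /psi [LHS]mulrA -[X in X * Wsym _ = _]mulrA -big_split/=.
  rewrite big_seq big1 => [|e ees]; last first.
    have [f1 f2] := curve_qpoch_neq0 esP ees t01.
    by rewrite !mulr1; field; rewrite f1 f2.
  rewrite (qpochS q1 (g t ^+ 2)) [g t ^+ 2 * q]mulrC /Wsym expr1n !mulr1; ring.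
rewrite -{w'}ww' in vw'.
have cE := qpoch_conv q1 (a * b * c * d).
have nn2 n : (n <= n + n)%N by exact: leq_addr.
have nn4 n : (n <= n + n + (n + n))%N by rewrite -addnA leq_addr.
have lhs := cconvM vw' (cconv_sub nn4 cE).
have cs y := cconv_sub nn2 (qpoch_conv q1 y).
have rhs := cconvM (cconvM (cconvM (cconvM (cconvM (cconvM (cs (a * b)) (cs (a * c))) (cs (a * d)))
  (cs (b * c))) (cs (b * d))) (cs (c * d))) (cconv_cst (awint a b c d)).
have E n : wint es (fun x => Phi n x * Wsym x) * fpoch q (n + n + (n + n)) (a * b * c * d) =
  fpoch q (n + n) (a * b) * fpoch q (n + n) (a * c) * fpoch q (n + n) (a * d) *
  fpoch q (n + n) (b * c) * fpoch q (n + n) (b * d) * fpoch q (n + n) (c * d) * awint a b c d.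
  by rewrite -I4; exact: awint_shift4.
have := cconv_uniq (cconv_eq E lhs) rhs => H.
by rewrite -wE -[RHS]mulrAC H; ring.
Qed.

End AskeyWilsonIntegral.

(** * Norms for the symmetric form *)

Section SymmetricForm.
Variables (q k : C).
Hypothesis q1 : normc q < 1.
Hypothesis q0 : q != 0.
Hypothesis kq : k ^+ 2 = q.
Variables a b c d : C.
Local Notation es := [:: a; b; c; d].
Hypothesis esP : separated q es.
Local Notation E := (a * b * c * d).
Hypothesis E1 : forall j, E * q ^+ j != 1.
Hypothesis ab1 : forall j, a * b * q ^+ j != 1.
Hypothesis ac1 : forall j, a * c * q ^+ j != 1.
Hypothesis ad1 : forall j, a * d * q ^+ j != 1.

Definition sint (r : {poly C}) : C := wint q es (fun x => Wsym x * r.[x + x^-1]).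

Lemma sint_lin e p r : sint (e *: p + r) = e * sint p + sint r.
Proof.
rewrite /sint -(wint_lin q1 q0 e esP (isL_Wsympoly p) (isL_Wsympoly r)).
apply: (wint_ext q1 q0 esP); first exact: isL_Wsympoly.
by move=> x _; rewrite hornerD hornerZ; ring.
Qed.

Lemma sint_mom i j : sint (sympol q i a * sympol q j b) * fpoch q (i + j) E =
  fpoch q (i + j) (a * b) * fpoch q i (a * c) * fpoch q i (a * d) *
  fpoch q j (b * c) * fpoch q j (b * d) * sint 1.
Proof.
have sL n e := isL_symfac (R := R) q n e.
have W1L : isL (fun x : C => Wsym x * (1 : {poly C}).[x + x^-1]) by exact: isL_Wsympoly.
have s1 : sint 1 = awint q a b c d.
  apply: (wint_ext q1 q0 esP) => // x x0.
  by rewrite hornerC mulr1.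
have -> : sint (sympol q i a * sympol q j b) = awint q (b * q ^+ j) (a * q ^+ i) c d.
  have sa := separated_shift q0 (n := i) esP.
  have sb := separated_perm (perm4_2 _ _ _ _) sa.
  have L1 := isL_mul (sL j b) (isL_Wsym R).
  rewrite /awint (wint_shift q1 q0 j sb (isL_Wsym R)).
  rewrite -(wint_perm _ _ (perm4_2 _ _ _ _)) (wint_shift q1 q0 i esP L1).
  apply: (wint_ext q1 q0 esP); first exact: isL_Wsympoly.
  by move=> x x0; rewrite hornerM !sympolE//; ring.
have sa := separated_shift q0 (n := i) esP.
have sb := separated_perm (perm4_2 _ _ _ _) sa.
have := awint_shift q1 q0 i esP.
have := awint_shift q1 q0 j sb.
rewrite -(awint_perm q (perm4_2 (a * q ^+ i) b c d)) s1.
have -> : b * (a * q ^+ i) * c * d = E * q ^+ i by ring.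
have -> : b * (a * q ^+ i) = a * b * q ^+ i by ring.
rewrite !fpochD => H1 H2.
transitivity (awint q (b * q ^+ j) (a * q ^+ i) c d * fpoch q j (E * q ^+ i) * fpoch q i E).
  by ring.
rewrite H1.
transitivity (fpoch q j (a * b * q ^+ i) * fpoch q j (b * c) * fpoch q j (b * d) *
  (awint q (a * q ^+ i) b c d * fpoch q i E)); first by ring.
by rewrite H2; ring.
Qed.

(** [u] is abcd q^(n-1), given through u q so that n = 0 is covered without a truncated
    subtraction. *)
Lemma monic_norm n (p : {poly C}) u : p \is monic -> size p = n.+1 ->
  (forall r : {poly C}, (size r <= n)%N -> sint (p * r) = 0) -> u * q = E * q ^+ n ->
  sint (p * p) * (qpoch (q * q ^+ n) q * (qpoch (a * b * q ^+ n) q *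
    qpoch (a * c * q ^+ n) q * qpoch (a * d * q ^+ n) q * qpoch (b * c * q ^+ n) q *
    qpoch (b * d * q ^+ n) q * qpoch (c * d * q ^+ n) q) * fpoch q n u) =
  2 * two_pi_i R * qpoch (E * q ^+ (n + n)) q.
Proof.
move=> pm ps porth uE.
have [a0 _] := esP (mem_head _ _ : a \in es).
have b0 : b != 0 by have [] := @esP b ltac:(by rewrite !inE eqxx ?orbT).
have c0 : c != 0 by have [] := @esP c ltac:(by rewrite !inE eqxx ?orbT).
have d0 : d != 0 by have [] := @esP d ltac:(by rewrite !inE eqxx ?orbT).
have AW := askey_wilson q1 q0 kq esP.
have fE m : fpoch q m E != 0.
  by apply/prodf_neq0 => i _; rewrite subr_eq0 eq_sym.
have s1 : sint 1 = awint q a b c d.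
  apply: (wint_ext q1 q0 esP); first exact: isL_Wsympoly.
  by move=> x x0; rewrite hornerC mulr1.
have N : sint (p * p) * (fpoch q (n + n) E * fpoch q n u) =
  sint 1 * (fpoch q n q * (fpoch q n (a * b) * fpoch q n (a * c) *
    fpoch q n (a * d) * fpoch q n (b * c) * fpoch q n (b * d) * fpoch q n (c * d))).
  case: n ps porth uE => [|n] ps porth uE.
    have p1 : p = 1.
      have /eqP/size_poly1P[z z0 pz] := ps; move: pm; rewrite pz monicE lead_coefC => /eqP ->.
      by [].
    by rewrite p1 mulr1 !fpoch0 !mulr1.
  have -> : u = E * q ^+ n by apply: (mulIf q0); rewrite uE exprSr !mulrA.
  exact: (monic_orthogonal_norm q0 a0 b0 c0 d0 E1 ab1 ac1 ad1 sint_lin sint_mom pm ps porth).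
apply: (mulfI (fE (n + n)%N)); rewrite -s1 in AW.
transitivity (sint (p * p) * (fpoch q (n + n) E * fpoch q n u) * (qpoch (q * q ^+ n) q * (qpoch (a * b * q ^+ n) q *
    qpoch (a * c * q ^+ n) q * qpoch (a * d * q ^+ n) q * qpoch (b * c * q ^+ n) q *
    qpoch (b * d * q ^+ n) q * qpoch (c * d * q ^+ n) q))); first by ring.
rewrite N.
transitivity (2 * two_pi_i R * qpoch E q); last first.
  by rewrite (qpoch_fpoch q1 (n + n) E); ring.
rewrite -AW (qpoch_fpoch q1 n q) (qpoch_fpoch q1 n (a * b)) (qpoch_fpoch q1 n (a * c)).
rewrite (qpoch_fpoch q1 n (a * d)) (qpoch_fpoch q1 n (b * c)) (qpoch_fpoch q1 n (b * d)).
by rewrite (qpoch_fpoch q1 n (c * d)); ring.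
Qed.

End SymmetricForm.

(** * Biorthogonality and norms of the P_m *)

Section BiorthogonalForm.
Local Notation A := (laurent R).
Variable t : params R.
Local Notation q := (pq t).
Local Notation a := (pa t).
Local Notation b := (pb t).
Local Notation c := (pc t).
Local Notation d := (pd t).
Local Notation es := [:: a; b; c; d].
Hypothesis q1 : normc q < 1.
Hypothesis sq0 : sq t != 0.
Hypothesis tk0 : k0 t != 0.
Hypothesis tk1 : k1 t != 0.
Hypothesis tu0 : u0 t != 0.
Hypothesis tu1 : u1 t != 0.
Hypothesis esP : separated q es.
Hypothesis ab1 : a * b != 1.
Variables P P' : int -> A.
Hypothesis hP : forall m : int, isP t m (P m).
Hypothesis hP' : forall m : int, isP (inv_params t) m (P' m).

Let q0 : q != 0. Proof. by rewrite expf_neq0. Qed.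

(* On the curve the weight is [Delta]. *)
Definition dint (F : C -> C) : C :=
  wint q es (fun x => (1 - a / x) * (1 - b / x) * (1 - x ^+ 2) * F x).

Lemma isL_dint F : isL F -> isL (fun x => (1 - a / x) * (1 - b / x) * (1 - x ^+ 2) * F x).
Proof.
move=> FL; apply: isL_mul => //; apply: isL_mul; last first.
  by apply: isL_sub; [exact: isL_cst|exact/isL_exp/isL_id].
by apply: isL_mul; apply: isL_sub; try exact: isL_cst; apply: isL_scale; exact: isL_V.
Qed.

Lemma dint_ext F G : isL F -> (forall x, x != 0 -> F x = G x) -> dint F = dint G.
Proof.
move=> FL FG; apply: (wint_ext q1 q0 esP); first exact: isL_dint.
by move=> x x0; rewrite FG.
Qed.

Lemma dint_lin k F G : isL F -> isL G -> dint (fun x => k * F x + G x) = k * dint F + dint G.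
Proof.
move=> FL GL; rewrite -(wint_lin q1 q0 k esP (isL_dint FL) (isL_dint GL)).
apply: (wint_ext q1 q0 esP); last by move=> x _; ring.
by apply: isL_dint; apply: isL_add => //; exact: isL_scale.
Qed.

(** The defect of isometry is a multiple of [T1num] Z. Together with the factor (1 - a/x)(1 - b/x)(1
    - x^2) it is odd under x -> 1/x, so it integrates to 0. *)
Lemma dint_T1 (f p : laurent R) :
  dint (fun x => leval (T1 t f) x * leval (T1 (inv_params t) p) x^-1) =
  dint (fun x => leval f x * leval p x^-1).
Proof.
have fL := leval_isL f; have pL := isL_comp_V (leval_isL p).
have [D fD] := reflD_exists (oner_neq0 C) fL.
have [E pE] := reflD_exists (oner_neq0 C) pL.
have [|Z [ZL Zs ZE]] := demazure_isometry (oner_neq0 C) tk1 fL pL (isL_T1num t) fD pE.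
  by move=> x x0; rewrite /T1num /pa /pb; field; rewrite tu1 x0.
have nZL := isL_mul (isL_T1num t) ZL; have fpL := isL_mul fL pL.
rewrite (dint_ext (G := fun x => k1 t ^- 2 * (T1num t x * Z x) + leval f x * leval p x^-1)).
- rewrite dint_lin// (_ : dint _ = 0) ?mulr0 ?add0r//.
  apply: (wint_antisym q1 q0 esP); first exact: isL_dint.
  move=> x x0; have := Zs x x0; rewrite div1r => ->.
  by rewrite /T1num; field.
- by apply: isL_mul; [exact: leval_isL|exact/isL_comp_V/leval_isL].
- by move=> x x0; rewrite (T1_eval tk1 tu1 fD)// (T1_inv_eval tk1 tu1 pE)// ZE// addrC.
Qed.

(** [T0num] supplies x^2 (1 - c/x)(1 - d/x), which completes the factors for a and b in the weight
    to the product over all four parameters in [wint_zero]. *)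
Lemma dint_T0 (f p : laurent R) :
  dint (fun x => leval (T0 t f) x * leval (T0 (inv_params t) p) x^-1) =
  dint (fun x => leval f x * leval p x^-1).
Proof.
have fL := leval_isL f; have pL := isL_comp_V (leval_isL p).
have [D fD] := reflD_exists q0 fL.
have [E pE] := reflD_exists q0 pL.
have [|Z [ZL Zs ZE]] := demazure_isometry q0 tk0 fL pL (isL_T0num t) fD pE.
  by move=> x x0; rewrite /T0num /pc /pd /pq; field; rewrite tu0 x0 sq0.
have nZL := isL_mul (isL_T0num t) ZL; have fpL := isL_mul fL pL.
rewrite (dint_ext (G := fun x => k0 t ^- 2 * (T0num t x * Z x) + leval f x * leval p x^-1)).
- rewrite dint_lin// (_ : dint _ = 0) ?mulr0 ?add0r//.
  rewrite -(wint_zero q1 q0 esP ZL); last first.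
    by move=> x x0; rewrite Zs//; field; rewrite x0 q0.
  apply: (wint_ext q1 q0 esP); first exact: isL_dint.
  by move=> x x0; rewrite !big_cons big_nil /T0num; field.
- by apply: isL_mul; [exact: leval_isL|exact/isL_comp_V/leval_isL].
- by move=> x x0; rewrite (T0_eval sq0 tk0 tu0 fD)// (T0_inv_eval sq0 tk0 tu0 pE)// ZE// addrC.
Qed.

Lemma dint_Y (f p : laurent R) :
  dint (fun x => leval (Y t f) x * leval (Y (inv_params t) p) x^-1) =
  dint (fun x => leval f x * leval p x^-1).
Proof. by rewrite dint_T1 dint_T0. Qed.

Definition dform (f p : A) : C := dint (fun x => leval f x * leval p x^-1).

Lemma isL_form (f p : A) : isL (fun x => leval f x * leval p x^-1).
Proof. by apply: isL_mul; [exact: leval_isL|exact/isL_comp_V/leval_isL]. Qed.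

Lemma form_linl k f f' p : dform (k *: f + f') p = k * dform f p + dform f' p.
Proof.
rewrite /dform -dint_lin//; try exact: isL_form.
by apply: dint_ext; [exact: isL_form|move=> x _; rewrite levalP; ring].
Qed.

Lemma form_linr k f p p' : dform f (k *: p + p') = k * dform f p + dform f p'.
Proof.
rewrite /dform -dint_lin//; try exact: isL_form.
by apply: dint_ext; [exact: isL_form|move=> x _; rewrite levalP; ring].
Qed.

Lemma form0l p : dform 0 p = 0.
Proof. by have := form_linl (-1) 0 0 p; rewrite scaler0 add0r mulN1r addNr. Qed.

Lemma form0r f : dform f 0 = 0.
Proof. by have := form_linr (-1) f 0 0; rewrite scaler0 add0r mulN1r addNr. Qed.

Lemma formZl k f p : dform (k *: f) p = k * dform f p.
Proof. by have := form_linl k f 0 p; rewrite addr0 form0l addr0. Qed.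

Lemma formZr k f p : dform f (k *: p) = k * dform f p.
Proof. by have := form_linr k f p 0; rewrite addr0 form0r addr0. Qed.

Lemma gam_inv n : gam (inv_params t) n = (gam t n)^-1.
Proof.
rewrite /gam /= /pq /= exprVn exprz_inv -invr_expz.
have -> : (k0 t)^-1 * (k1 t)^-1 = (k0 t * k1 t)^-1 by rewrite invfM.
by rewrite [RHS]invfM; case: ifP.
Qed.

Lemma gam_neq0 n : gam t n != 0.
Proof.
rewrite /gam mulf_neq0 ?expfz_neq0 ?expf_neq0//.
by case: ifP => _; rewrite ?invr_eq0 mulf_neq0.
Qed.

Lemma biorthogonal m n : m != n -> dform (P m) (P' n) = 0.
Proof.
move=> mn; have gmn := gam_neq sq0 hP mn.
have [[_ PY] _] := hP m; have [[_ P'Y] _] := hP' n.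
have : dform (Y t (P m)) (Y (inv_params t) (P' n)) = dform (P m) (P' n).
  exact: dint_Y.
rewrite PY P'Y formZl formZr gam_inv mulrA => /eqP.
rewrite -subr_eq0 -[X in _ - X]mul1r -mulrBl mulf_eq0 => /orP[|/eqP//].
by rewrite subr_eq0 -(divff (gam_neq0 n)) (inj_eq (mulIf _)) ?invr_eq0 ?gam_neq0// (negbTE gmn).
Qed.

(** The P'_n are triangular for the monomial order, so their multiples strip off leading terms while
    biorthogonality kills each one. *)
Lemma form_lower_r m (f : A) : (forall n, (mono_rank m <= mono_rank n)%N -> f n = 0) ->
  dform (P m) f = 0.
Proof.
suff H r : (r <= mono_rank m)%N -> forall f : A,
    (forall n, (r <= mono_rank n)%N -> f n = 0) -> dform (P m) f = 0 by exact: H.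
elim: r => [_|r ih rm] {}f f0.
  have -> : f = 0; last exact: form0r.
  by apply: val_inj; apply/funext => n; rewrite /= f0.
have [n nr] := mono_rank_surj r; have [[[Pn Plow] _] _] := hP' n.
pose h := - f n *: P' n + f.
have -> : f = f n *: P' n + h by rewrite /h scaleNr addrA subrr add0r.
rewrite form_linr (ih (ltnW rm) h) ?addr0; last first.
- move=> j; rewrite leq_eqVlt => /orP[/eqP rj|rj].
    have -> : j = n by apply: mono_rank_inj; rewrite nr rj.
    by change (- f n * P' n n + f n = 0); rewrite Pn mulr1 addNr.
  by change (- f n * P' n j + f j = 0); rewrite Plow ?nr// mulr0 add0r f0.
by rewrite biorthogonal ?mulr0//; apply/eqP => mn; move: rm; rewrite mn nr ltnn.
Qed.

Let a0 : a != 0. Proof. by rewrite mulf_neq0. Qed.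
Let b0 : b != 0. Proof. by rewrite oppr_eq0 mulf_neq0 ?invr_eq0. Qed.
Let ab0 : 1 - a * b != 0. Proof. by rewrite subr_eq0 eq_sym. Qed.
Let two0 : 2 != 0 :> C. Proof. by rewrite pnatr_eq0. Qed.

Let paV : pa (inv_params t) = a^-1. Proof. by rewrite /pa /= invfM. Qed.
Let pbV : pb (inv_params t) = b^-1. Proof. by rewrite /pb /= invrN !invfM !invrK. Qed.

Local Notation sint0 := (sint q a b c d).
Local Notation sint1 := (sint q (a * q) (b * q) c d).

Lemma separated1 : separated q [:: a * q; b * q; c; d].
Proof.
have s1 := separated_shift q0 (n := 1) esP; rewrite expr1 in s1.
have s2 := separated_shift q0 (n := 1) (separated_perm (perm4_2 _ _ _ _) s1).
by rewrite expr1 in s2; exact: (separated_perm (perm4_2 _ _ _ _) s2).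
Qed.

Lemma sint1E (r : {poly C}) : sint1 r = wint q [:: a; b; c; d]
  (fun x => symfac q 1 a x * symfac q 1 b x * (Wsym x * r.[x + x^-1])).
Proof.
have sL n e := isL_symfac (R := R) q n e.
have s1 := separated_shift q0 (n := 1) esP.
have WL := isL_Wsympoly r.
have L1 := isL_mul (sL 1%N b) WL.
have -> : sint1 r = wint q [:: b * q ^+ 1; a * q ^+ 1; c; d] (fun x => Wsym x * r.[x + x^-1]).
  by rewrite !expr1 (wint_perm _ _ (perm4_2 (b * q) (a * q) c d)).
rewrite (wint_shift q1 q0 1 (separated_perm (perm4_2 _ _ _ _) s1) WL).
rewrite (wint_perm _ _ (perm4_2 b (a * q ^+ 1) c d)) (wint_shift q1 q0 1 esP L1).
apply: (wint_ext q1 q0 esP); first exact: isL_mul.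
by move=> x _; ring.
Qed.

Lemma form_decomp (f h : A) p s p' s' :
  (forall x, x != 0 -> leval f x = p.[x + x^-1] + antifac a b x * s.[x + x^-1]) ->
  (forall x, x != 0 -> leval h x^-1 = p'.[x + x^-1] + (a * b)^-1 * antifac a b x * s'.[x + x^-1]) ->
  dform f h = (1 - a * b) / 2 * sint0 (p * p') - (1 - a * b) / (2 * (a * b)) * sint1 (s * s').
Proof.
move=> fE hE; rewrite sint1E /sint.
have sL n e := isL_symfac (R := R) q n e.
have L0 := isL_Wsympoly (p * p').
have L1 := isL_mul (isL_mul (sL 1%N a) (sL 1%N b)) (isL_Wsympoly (s * s')).
move: L0 L1; set F0 := fun x => _ * (p * p').[_].
set F1 := fun x => _ * (_ * (s * s').[_]) => L0 L1.
set k1 := (1 - a * b) / 2; set k2 := - ((1 - a * b) / (2 * (a * b))).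
have -> : k1 * wint q [:: a; b; c; d] F0 -
    (1 - a * b) / (2 * (a * b)) * wint q [:: a; b; c; d] F1 =
    wint q [:: a; b; c; d] (fun x => k1 * F0 x + k2 * F1 x).
  rewrite (wint_lin q1 q0 _ esP L0 (isL_scale k2 L1)).
  by rewrite (wintZ q1 q0 _ esP L1) [k2 * _]mulNr.
rewrite /dform /dint; set G := fun x => _.
have GL : isL G by apply: isL_dint; exact: isL_form.
have -> : wint q [:: a; b; c; d] G = 2^-1 * wint q [:: a; b; c; d] (fun x => G x + G x^-1).
  have -> := wintD q1 q0 esP GL (isL_comp_V GL).
  by rewrite (wintV q1 q0 esP GL); move: (wint _ _ _) => w; field.
have GVL := isL_comp_V GL.
rewrite -(wintZ q1 q0 _ esP); last exact: isL_add.
apply: (wint_ext q1 q0 esP); first by apply: isL_scale; exact: isL_add.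
move=> x x0; have x0' : x^-1 != 0 by rewrite invr_eq0.
rewrite /G /F0 /F1 /k1 /k2 !fE// !hE// invrK (addrC x^-1) /antifac /symfac /fpoch !big_ord1 !expr0 !mulr1 !hornerM /Wsym.
set u := p.[_]; set v := s.[_]; set u' := p'.[_]; set v' := s'.[_].
by field; rewrite x0 a0 b0.
Qed.

(** With inverse parameters [antifac] at 1/x is 1/(ab) times the original [antifac] at x. *)
Lemma dual_decomp (f : A) m : (forall n : int, (m < `|n|)%N -> f n = 0) ->
  exists p s : {poly C}, [/\ (size p <= m.+1)%N, (size s <= m)%N,
    (forall x, x != 0 -> leval f x^-1 = p.[x + x^-1] + (a * b)^-1 * antifac a b x * s.[x + x^-1]) &
    (0 < m)%N -> p`_m + (a * b)^-1 * s`_m.-1 = f m%:Z /\ p`_m + s`_m.-1 = f (- m%:Z)].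
Proof.
move=> fm; have ab1' : a^-1 * b^-1 != 1 by rewrite -invfM invr_eq1.
have [p [s [ps ss E co]]] := laurent_decomp ab1' fm.
exists p, s; split => // [x x0|m0]; last by rewrite invfM; exact: co.
rewrite E ?invr_eq0// invrK (addrC x^-1) /antifac; congr (_ + _ * _).
by field; rewrite x0 a0 b0.
Qed.

(** Together with [antisym_test]: enough test functions to turn orthogonality of Laurent polynomials
    into orthogonality for each of the two symmetric functionals. *)
Lemma sym_test m (r : {poly C}) : (size r <= m.+1)%N -> exists2 f : A,
  forall x, x != 0 -> leval f x^-1 = r.[x + x^-1] &
  forall n : int, (m < `|n|)%N -> f n = 0.
Proof.
move=> rm; have [Q Qm QE] := sympoly_clear rm.
have [f fE f0] := laurent_of_poly Qm; exists f => // x x0.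
have x0' : x^-1 != 0 by rewrite invr_eq0.
by apply: (mulIf (expf_neq0 m x0')); rewrite fE// -QE// invrK addrC.
Qed.

Lemma antisym_test m (r : {poly C}) : (size r <= m)%N -> exists2 f : A,
  forall x, x != 0 -> leval f x^-1 = (a * b)^-1 * antifac a b x * r.[x + x^-1] &
  forall n : int, (m < `|n|)%N -> f n = 0.
Proof.
case: m => [|m] rm.
  exists 0 => // x x0; move: rm; rewrite leqn0 size_poly_eq0 => /eqP ->.
  by rewrite leval0 horner0 mulr0.
have [Q Qm QE] := sympoly_clear rm.
pose F : {poly C} := (1 - a^-1 *: 'X) * (1 - b^-1 *: 'X).
have sF : (size F <= 3)%N.
  have s2 (e : C) : (size (1 - e *: 'X : {poly C})%R <= 2)%N.
    rewrite (leq_trans (size_polyD _ _))// geq_max size_poly1/= size_polyN.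
    by rewrite (leq_trans (size_scale_leq _ _))// size_polyX.
  rewrite (leq_trans (size_polyMleq _ _))//.
  by rewrite -subn1 leq_subLR (leq_trans (leq_add (s2 _) (s2 _))).
have [|f fE f0] := @laurent_of_poly _ (F * Q) m.+1.
  exact: size_polyM_double.
exists f => // x x0; have x0' : x^-1 != 0 by rewrite invr_eq0.
have FE : F.[x^-1] = (1 - a^-1 * x^-1) * (1 - b^-1 * x^-1).
  by rewrite /F hornerM !(hornerD, hornerN, hornerZ, hornerX, hornerC).
apply: (mulIf (expf_neq0 m.+1 x0')); rewrite fE// hornerM -QE// invrK (addrC x^-1) FE /antifac.
rewrite [x^-1 ^+ m.+1]exprS; move: (r.[_]) (x^-1 ^+ m) => v w.
by field; rewrite x0 a0 b0.
Qed.

Lemma orth_tests m (f : A) p s : (0 < m)%N ->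
  (forall h : A, (forall n : int, (m <= `|n|)%N -> h n = 0) -> dform f h = 0) ->
  (forall x, x != 0 -> leval f x = p.[x + x^-1] + antifac a b x * s.[x + x^-1]) ->
  (forall r : {poly C}, (size r <= m)%N -> sint0 (p * r) = 0) /\
  (forall r : {poly C}, (size r <= m.-1)%N -> sint1 (s * r) = 0).
Proof.
case: m => // m _ fo fE; split=> r rm.
  have [h hE h0] := sym_test rm.
  have := fo h h0; rewrite (@form_decomp f h p s r 0)//; last first.
    by move=> x x0; rewrite hE// horner0 mulr0 addr0.
  rewrite mulr0 (_ : sint1 0 = 0); last first.
    have := sint_lin q1 q0 separated1 (-1) 0 0.
    by rewrite scaler0 addr0 mulN1r addNr.
  rewrite mulr0 subr0 => /eqP; rewrite !mulf_eq0 (negbTE ab0) invr_eq0 (negbTE two0).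
  by move/eqP.
have [h hE h0] := antisym_test rm.
have := fo h h0; rewrite (@form_decomp f h p s 0 r)//; last first.
  by move=> x x0; rewrite hE// horner0 add0r.
rewrite mulr0 (_ : sint0 0 = 0); last first.
  have := sint_lin q1 q0 esP (-1) 0 0.
  by rewrite scaler0 addr0 mulN1r addNr.
have k0 : (1 - a * b) / (2 * (a * b)) != 0.
  by rewrite mulf_neq0// invr_eq0 mulf_neq0// mulf_neq0.
by rewrite mulr0 sub0r => /eqP; rewrite oppr_eq0 mulf_eq0 (negbTE k0) => /eqP.
Qed.

Lemma P_orth_lower m (j : int) (h : A) : (0 < m)%N -> (`|j| = m)%N ->
  (forall n : int, (m <= `|n|)%N -> h n = 0) -> dform (P j) h = 0.
Proof.
move=> m0 jm h0.
apply: form_lower_r => n jn.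
by apply: h0; rewrite -jm; exact: mono_rank_le_abs.
Qed.

(** * The polynomials of degree m >= 1 *)

Section PositiveDegree.
Variable n : nat.
Local Notation m := n.+1.
Variables Pp Pm Pm' : A.
Hypothesis hPp : isPplus t P m Pp.
Hypothesis hPm : isPminus t P m Pm.
Hypothesis hPm' : isPminus (inv_params t) P' m Pm'.

Lemma span_orth_lower (f h : A) : in_span2 (P m%:Z) (P (- m%:Z)) f ->
  (forall n : int, (m <= `|n|)%N -> h n = 0) -> dform f h = 0.
Proof.
move=> [x1 [x2 ->]] h0.
rewrite form_linl formZl.
by rewrite !(@P_orth_lower m)// !mulr0 addr0.
Qed.

Lemma Pplus_poly : exists p : {poly C}, [/\ p \is monic, size p = m.+1,
  forall x, x != 0 -> leval Pp x = p.[x + x^-1] &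
  forall r : {poly C}, (size r <= m)%N -> sint0 (p * r) = 0].
Proof.
have [[spn lead TP] _] := hPp.
have [p [s [ps ss E co]]] := laurent_decomp ab1 (leading_supp lead).
have s0 := T1_plus tk1 tu1 ab1 E TP.
have [c1 _] := co isT; rewrite s0 coef0 mulr0 addr0 in c1.
have [Pm1 _] := lead; rewrite Pm1 in c1.
have sp : size p = m.+1.
  apply/eqP; rewrite eqn_leq ps ltnNge; apply/negP => /leq_sizeP/(_ m (leqnn _)).
  by rewrite c1 => /eqP; rewrite oner_eq0.
exists p; split => //.
- by rewrite monicE lead_coefE sp c1.
- by move=> x x0; rewrite E// s0 horner0 mulr0 addr0.
- have fo h := span_orth_lower (h := h) spn.
  by have [] := orth_tests (ltn0Sn n) fo E.
Qed.

(** The coefficient of x^m in [antifac] times s is ab times the top coefficient of s, hence the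
    factor 1/(ab) in front of the monic polynomial. *)
Lemma Pminus_poly : exists s : {poly C}, [/\ s \is monic, size s = m,
  forall x, x != 0 -> leval Pm x = antifac a b x * ((a * b)^-1 *: s).[x + x^-1] &
  forall r : {poly C}, (size r <= n)%N -> sint1 (s * r) = 0].
Proof.
have [[spn lead TP] _] := hPm.
have [p [s [ps ss E co]]] := laurent_decomp ab1 (leading_supp lead).
have p0 := T1_minus tk1 tu1 ab1 E TP.
have [c1 _] := co isT; rewrite p0 coef0 add0r in c1.
have [Pm1 _] := lead; rewrite Pm1 /= in c1.
have abn : a * b != 0 by rewrite mulf_neq0.
have sE : s = (a * b)^-1 *: ((a * b) *: s) by rewrite scalerA mulVf// scale1r.
have sp : size ((a * b) *: s) = m.
  apply/eqP; rewrite eqn_leq size_scale// ss/= ltnNge; apply/negP => /leq_sizeP/(_ n (leqnn _)).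
  by move=> sn; move: c1; rewrite sn mulr0 => /esym/eqP; rewrite oner_eq0.
exists ((a * b) *: s); split => //.
- by rewrite monicE lead_coefE sp coefZ c1.
- by move=> x x0; rewrite E// p0 horner0 add0r -sE.
- have fo h := span_orth_lower (h := h) spn.
  have [_ H] := orth_tests (ltn0Sn n) fo E.
  move=> r rn; have := sint_lin q1 q0 separated1 (a * b) (s * r) 0.
  rewrite addr0 scalerAl => ->; rewrite H// mulr0 add0r.
  have := sint_lin q1 q0 separated1 (-1) 0 0.
  by rewrite scaler0 addr0 mulN1r addNr.
Qed.

Variables p s : {poly C}.
Hypothesis pM : p \is monic.
Hypothesis sp : size p = m.+1.
Hypothesis po : forall r : {poly C}, (size r <= m)%N -> sint0 (p * r) = 0.
Hypothesis sM : s \is monic.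
Hypothesis ss : size s = m.
Hypothesis so : forall r : {poly C}, (size r <= n)%N -> sint1 (s * r) = 0.
Local Notation h := (sint0 (p * p)).
Local Notation h1 := (sint1 (s * s)).

Let pn : p`_m = 1. Proof. by have /monicP := pM; rewrite lead_coefE sp. Qed.
Let sn : s`_n = 1. Proof. by have /monicP := sM; rewrite lead_coefE ss. Qed.

Lemma form_top (f k : A) (p1 s1 p2 s2 : {poly C}) :
  (forall h : A, (forall n : int, (m <= `|n|)%N -> h n = 0) -> dform f h = 0) ->
  (size p1 <= m.+1)%N -> (size s1 <= m)%N -> (size p2 <= m.+1)%N -> (size s2 <= m)%N ->
  (forall x, x != 0 -> leval f x = p1.[x + x^-1] + antifac a b x * s1.[x + x^-1]) ->
  (forall x, x != 0 -> leval k x^-1 = p2.[x + x^-1] + (a * b)^-1 * antifac a b x * s2.[x + x^-1]) ->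
  dform f k = (1 - a * b) / 2 * (p1`_m * p2`_m * h) -
             (1 - a * b) / (2 * (a * b)) * (s1`_n * s2`_n * h1).
Proof.
move=> fo sp1 ss1 sp2 ss2 fE kE.
have [po1 so1] := orth_tests (ltn0Sn n) fo fE.
rewrite (form_decomp fE kE).
rewrite (orth_expand (sint_lin q1 q0 esP) sp1 sp2 _ pn po1 po) ?sp//.
by rewrite (orth_expand (sint_lin q1 q0 separated1) ss1 ss2 _ sn so1 so) ?ss.
Qed.

(** The top coefficients of the two antisymmetric parts are 1/(ab) and ab, so they cancel in the
    pairing. *)
Lemma form_Pminus : (forall x, x != 0 -> leval Pm x = antifac a b x * ((a * b)^-1 *: s).[x + x^-1]) ->
  dform Pm Pm' = (a * b - 1) / (2 * (a * b)) * h1.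
Proof.
move=> sE; have abn : a * b != 0 by rewrite mulf_neq0.
have [[spn lead TP] _] := hPm.
have [[spn' lead' TP'] _] := hPm'.
have [p2 [s2 [sp2 ss2 E2 co2]]] := dual_decomp (leading_supp lead').
have ab1' : pa (inv_params t) * pb (inv_params t) != 1.
  by rewrite paV pbV -invfM invr_eq1.
have E2' x : x != 0 -> leval Pm' x = p2.[x + x^-1] +
    antifac (pa (inv_params t)) (pb (inv_params t)) x * s2.[x + x^-1].
  move=> x0; have := E2 x^-1; rewrite invr_eq0 invrK => /(_ x0) ->.
  rewrite (addrC x^-1) paV pbV /antifac; congr (_ + _ * _).
  by field; rewrite x0 a0 b0.
have tk1' : k1 (inv_params t) != 0 by rewrite invr_eq0.
have tu1' : u1 (inv_params t) != 0 by rewrite invr_eq0.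
have p20 := T1_minus tk1' tu1' ab1' E2' TP'.
have [c1 _] := co2 isT; rewrite p20 coef0 add0r in c1.
have [Pm1 _] := lead'; rewrite Pm1 /= in c1.
have s2n : s2`_n = a * b by rewrite -[RHS]mulr1 -c1 mulVKf.
rewrite (@form_top Pm Pm' 0 ((a * b)^-1 *: s) p2 s2)//.
- rewrite coef0 !mul0r mulr0 sub0r coefZ sn s2n.
  by field; rewrite a0 b0.
- by move=> k; exact: span_orth_lower.
- by rewrite size_poly0.
- by rewrite size_scale ?invr_eq0// ss.
- by move=> x x0; rewrite sE// horner0 add0r.
Qed.

Lemma form_PP : h1 - a * b * h != 0 ->
  dform (P (- m%:Z)) (P' (- m%:Z)) = (h1 - a * b * h) / (2 * (1 - a * b)) /\
  dform (P m%:Z) (P' m%:Z) = (1 - a * b) / 2 * (h * h1 / (h1 - a * b * h)).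
Proof.
move=> D0.
have [[l1 _] _] := hP m%:Z; have [[l2 _] _] := hP (- m%:Z).
have [[l1' _] _] := hP' m%:Z; have [[l2' _] _] := hP' (- m%:Z).
have [z2 sup2] := leadingN_supp (ltn0Sn n) l2; have [z2' sup2'] := leadingN_supp (ltn0Sn n) l2'.
have [p1 [s1 [sp1 ss1 E1 co1]]] := laurent_decomp ab1 (leading_supp l1).
have [p2 [s2 [sp2 ss2 E2 co2]]] := laurent_decomp ab1 sup2.
have [p1' [s1' [sp1' ss1' E1' co1']]] := dual_decomp (leading_supp l1').
have [p2' [s2' [sp2' ss2' E2' co2']]] := dual_decomp sup2'.
have o1 (k : A) : (forall n : int, (m <= `|n|)%N -> k n = 0) -> dform (P m%:Z) k = 0.
  exact: (@P_orth_lower m).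
have o2 (k : A) : (forall n : int, (m <= `|n|)%N -> k n = 0) -> dform (P (- m%:Z)) k = 0.
  exact: (@P_orth_lower m).
have f22 := form_top o2 sp2 ss2 sp2' ss2' E2 E2'.
have f11 := form_top o1 sp1 ss1 sp1' ss1' E1 E1'.
have f12 := form_top o1 sp1 ss1 sp2' ss2' E1 E2'.
have f21 := form_top o2 sp2 ss2 sp1' ss1' E2 E1'.
have bi := biorthogonal.
have mN : m%:Z != - m%:Z by [].
rewrite (bi _ _ mN) in f12; rewrite eq_sym in mN; rewrite (bi _ _ mN) in f21.
have [c1 _] := co1 isT; have [c2 c3] := co2 isT.
have [c1' _] := co1' isT; have [c2' c3'] := co2' isT.
rewrite (proj1 l1) /= in c1; rewrite z2 /= in c2; rewrite (proj1 l2) /= in c3.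
rewrite (proj1 l1') /= in c1'; rewrite z2' /= in c2'; rewrite (proj1 l2') /= in c3'.
rewrite f22 f11; have abn := mulf_neq0 a0 b0; split.
  exact: (pairing_bottom _ _ two0 abn ab0 c2 c3 c2' c3').
exact: (pairing_top two0 abn ab0 c1 c2 c3 c1' c2' c3' D0).
Qed.

End PositiveDegree.

Lemma Delta_plus_rho x : Delta_plus t x = rho q [:: a; b; c; d] x * Wsym x.
Proof.
rewrite /Delta_plus /qpochs /rho /psi /Wsym !big_cons !big_nil.
rewrite (qpochS q1 (x ^+ 2)) (qpochS q1 (x ^- 2)) expr1n !mulr1 !(mulrC q).
by rewrite !invfM; ring.
Qed.

Lemma is_form_Delta_plus (f h : A) (r : {poly C}) :
  (forall x, x != 0 -> leval f x * leval h x^-1 = r.[x + x^-1]) ->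
  is_form (Delta_plus t) g f h ((two_pi_i R)^-1 * sint q a b c d r).
Proof.
move=> fh; exists (sint q a b c d r) => //.
apply: CInt_ext (wintI q1 q0 esP (isL_Wsympoly r)) => s s01.
by rewrite fh ?curve_neq0// Delta_plus_rho; congr (_ / _); ring.
Qed.

Lemma is_form_Delta (f h : A) : is_form (Delta t) g f h ((two_pi_i R)^-1 * dform f h).
Proof.
exists (dform f h) => //.
apply: CInt_ext (wintI q1 q0 esP (isL_dint (isL_form f h))) => s s01.
congr (_ / _); rewrite /Delta Delta_plus_rho /Wsym; have s0 := curve_neq0 s01.
(* The curve may pass through 1 or -1, where [Delta] divides by zero and so has value 0; there the
   factor 1 - x^2 of [dint] vanishes as well. *)
have [s1|s1] := eqVneq (1 - g s ^- 2) 0.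
  have -> : 1 - g s ^+ 2 = 0.
    transitivity (- g s ^+ 2 * (1 - g s ^- 2)); first by field.
    by rewrite s1 mulr0.
  by rewrite s1 !mul0r !mulr0 mul0r !mulr0.
move: (rho _ _ _) (leval f _) (leval h _) => u v w.
set k := (_ - g s ^- 2) in s1 *.
by field; rewrite s0 s1.
Qed.

End BiorthogonalForm.

End CurveIntegral.

(** * Consequences of genericity and admissibility *)

Section Setup.
Variable R : realType.
Local Notation C := R[i].
Variables (g : R -> C) (t : params R).
Hypothesis ht : generic_params t.
Hypothesis hg : admissible t g.
Local Notation q := (pq t).
Local Notation es := [:: pa t; pb t; pc t; pd t].

Lemma generic_normc : normc q < 1.
Proof. by have [/andP[_]] := ht; rewrite normcE ltcR. Qed.

Lemma generic_sq_neq0 : sq t != 0.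
Proof.
have [/andP[q0 _] _ _ _] := ht; apply: contraL q0 => /eqP s0.
by rewrite /pq s0 expr0n normr0 ltxx.
Qed.

Lemma generic_pair_neq1 e f j : e \in es -> f \in es -> e * f * q ^+ j != 1.
Proof.
move=> ee ef; have [_ _ _ /(_ e f ee ef (- j%:Z))] := ht; apply: contra_neq => H.
have qj : q ^+ j != 0 by rewrite !expf_neq0// generic_sq_neq0.
by apply: (mulIf qj); rewrite H -exprnN mulVf.
Qed.

Lemma rectifiable_normc : rectifiable g -> exists L : R, forall s : seq R, itv_partition 0 1 s ->
  \sum_(i < size s) normc (g (nth 0 s i) - g (nth 0 (0 :: s) i)) <= L.
Proof.
move=> [L gL]; exists L => s /gL; under eq_bigr do rewrite normcE.
by rewrite -rmorph_sum lecR.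
Qed.

Section Curve.
Variable L : R.
Hypothesis gL : forall s : seq R, itv_partition 0 1 s ->
  \sum_(i < size s) normc (g (nth 0 s i) - g (nth 0 (0 :: s) i)) <= L.

(** 0 is a limit of the interior points a q^k. If d bounds the distance from 0 to the curve and |a
    q^N| <= d/3, the curve stays 2d/3 away from a q^N while 0 is within half of that, so both points
    have the same winding number. *)
Lemma admissible_wind0 : is_contour_integral g (fun x => x^-1) (two_pi_i R).
Proof.
have [[gc g01 _] _ cc K0 ie] := hg; have [d d0 Hd] := curve_dist gc K0.
have [N HN] := geometric_small generic_normc (normc (pa t)) (divr_gt0 d0 (ltr0n R 3)).
have {HN} := HN N (leqnn _); rewrite -normcX -normcM => aN.
have [iN _] := ie (pa t) (mem_head _ _) N.
have d20 : 0 < d / 3 *+ 2 by rewrite mulrn_wgt0// divr_gt0.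
have : is_contour_integral g (fun x => (x - 0)^-1) (two_pi_i R).
  apply: (CInt_inv_near gc g01 gL (z0 := pa t * q ^+ N)) d20 _ _ (cc _ iN).
    move=> s s01; have := Hd s s01; have := ler_normc_dist (pa t * q ^+ N) (g s) 0.
    rewrite !subr0; move: aN; lra.
  by rewrite sub0r normcN; move: aN; lra.
by under eq_fun do rewrite subr0.
Qed.

Lemma admissible_separated : (forall e, e \in es -> e != 0) -> separated g q es.
Proof.
have [[gc g01 _] _ cc K0 ie] := hg; move=> es0 e ee; split; first exact: es0.
move=> k; have [ik ek] := ie e ee k; split.
- by case: ik.
- by case: ek.
- exact: cc.
- exact: (CInt_inv_exterior gc g01 gL).
Qed.

End Curve.
End Setup.

(** * Evaluation of the forms *)

Section Values.
Variable R : realType.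
Local Notation C := R[i].
Local Notation A := (laurent R).
Variables (g : R -> C) (t : params R) (L : R).
Hypothesis ht : generic_params t.
Hypothesis hg : admissible t g.
Hypothesis gL : forall s : seq R, itv_partition 0 1 s ->
  \sum_(i < size s) normc (g (nth 0 s i) - g (nth 0 (0 :: s) i)) <= L.
Variables P P' : int -> A.
Hypothesis hP : forall m : int, isP t m (P m).
Hypothesis hP' : forall m : int, isP (inv_params t) m (P' m).

Local Notation q := (pq t).
Local Notation a := (pa t).
Local Notation b := (pb t).
Local Notation c := (pc t).
Local Notation d := (pd t).
Local Notation es := [:: a; b; c; d].
Local Notation E := (a * b * c * d).
Local Notation Q y := (qpoch y q).
Local Notation form := (dform g t).
Local Notation sint0 := (sint g q a b c d).
Local Notation sint1 := (sint g q (a * q) (b * q) c d).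
Local Notation K := (two_pi_i R).
Local Notation plus_norm m :=
  (2 * qpochs [:: q ^ (2 * m%:Z - 1) * E; q ^ (2 * m%:Z) * E] q /
   qpochs [:: q ^ (m%:Z + 1); q ^ m%:Z * a * b; q ^ m%:Z * a * c;
              q ^ m%:Z * a * d; q ^ m%:Z * b * c; q ^ m%:Z * b * d;
              q ^ m%:Z * c * d; q ^ (m%:Z - 1) * E] q).
Local Notation top_norm m :=
  (qpochs [:: q ^ (2 * m%:Z) * E; q ^ (2 * m%:Z) * E] q /
   qpochs [:: q ^ (m%:Z + 1); q ^ (m%:Z + 1) * a * b; q ^ m%:Z * a * c;
              q ^ m%:Z * a * d; q ^ m%:Z * b * c; q ^ m%:Z * b * d;
              q ^ m%:Z * c * d; q ^ m%:Z * E] q).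

Let gc : {within `[0, 1], continuous g}. Proof. by have [[]] := hg. Qed.
Let g01 : g 0 = g 1. Proof. by have [[]] := hg. Qed.
Let K0 : ~ curve_image g 0. Proof. by have [] := hg. Qed.
Let wind0 := admissible_wind0 ht hg gL.
Let q1 := generic_normc ht.
Let sq0 := generic_sq_neq0 ht.
Let q0 : q != 0. Proof. by rewrite expf_neq0. Qed.
Let tk0 : k0 t != 0. Proof. by have [_ [] ] := ht. Qed.
Let tk1 : k1 t != 0. Proof. by have [_ [] ] := ht. Qed.
Let tu0 : u0 t != 0. Proof. by have [_ [] ] := ht. Qed.
Let tu1 : u1 t != 0. Proof. by have [_ [] ] := ht. Qed.

Let es0 e : e \in es -> e != 0.
Proof.
by rewrite !inE => /or4P[] /eqP ->; rewrite ?oppr_eq0 !(mulf_neq0, invr_eq0).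
Qed.
Let esP : separated g q es. Proof. exact: (admissible_separated hg gL es0). Qed.

Let ina : a \in es. Proof. by rewrite !inE eqxx. Qed.
Let inb : b \in es. Proof. by rewrite !inE eqxx orbT. Qed.
Let inc : c \in es. Proof. by rewrite !inE eqxx !orbT. Qed.
Let ind : d \in es. Proof. by rewrite !inE eqxx !orbT. Qed.

Let pair1 := generic_pair_neq1 ht.
Let E1 j : E * q ^+ j != 1. Proof. exact: (abcd_neq sq0 hP). Qed.
Let ab1 : a * b != 1. Proof. by have := pair1 0 ina inb; rewrite expr0 mulr1. Qed.
Let a0 : a != 0 := es0 ina.
Let b0 : b != 0 := es0 inb.
Let two0 : (2 : C) != 0. Proof. by rewrite pnatr_eq0. Qed.

Let K0' : K != 0.
Proof.
rewrite /two_pi_i !mulf_neq0 ?neq0Ci// eq_complex/= negb_and gt_eqF ?pi_gt0//.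
Qed.

Let sub1 (x : C) : x != 1 -> 1 - x != 0. Proof. by rewrite subr_eq0 eq_sym. Qed.

Let QpairN e f n : e \in es -> f \in es -> Q (e * f * q ^+ n) != 0.
Proof.
move=> ee ef; apply: qpoch_neq0 => // j.
by rewrite -mulrA -exprD; exact: pair1.
Qed.

Let QE n : Q (E * q ^+ n) != 0.
Proof. by apply: qpoch_neq0 => // j; rewrite -mulrA -exprD; exact: E1. Qed.

Let qn1 n : q ^+ n.+1 != 1.
Proof.
have [/andP[_ nq1] _ _ _] := ht; apply/eqP => qn.
have := exprn_ilt1 n.+1 (normr_ge0 q) nq1.
by rewrite -normrX qn normr1 ltxx.
Qed.

Let Qq n : Q (q * q ^+ n) != 0.
Proof. by apply: qpoch_neq0 => // j; rewrite -exprS -exprD addSn. Qed.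

Let QS x y : x * q = y -> Q x = (1 - x) * Q y.
Proof. by move=> <-; exact: qpochS. Qed.

Section PositiveDegree.
Variable n : nat.
Local Notation m := n.+1.
Variables Pp Pm Pm' : A.
Hypothesis hPp : isPplus t P m Pp.
Hypothesis hPm : isPminus t P m Pm.
Hypothesis hPm' : isPminus (inv_params t) P' m Pm'.

Local Notation e := (a * b).
Local Notation f := (c * d).
Local Notation r := (q ^+ m).
Local Notation w := (q ^+ n).
Local Notation X := (Q (q * q ^+ m)).
Local Notation B := (Q (a * b * q ^+ m.+1)).
Local Notation S := (Q (a * c * r) * Q (a * d * r) * Q (b * c * r) * Q (b * d * r)).
Local Notation Cd := (Q (c * d * r)).
Local Notation Ee := (Q (E * r)).
Local Notation V := (Q (E * q ^+ (m + m))).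

Let r1 : 1 - r != 0. Proof. exact: sub1. Qed.
Let er1 : 1 - e * r != 0. Proof. by apply: sub1; exact: pair1. Qed.
Let fw1 : 1 - f * w != 0. Proof. by apply: sub1; exact: pair1. Qed.
Let efw1 : 1 - e * f * w != 0. Proof. by apply: sub1; rewrite mulrA; exact: E1. Qed.
Let efrw1 : 1 - e * f * r * w != 0.
Proof. by apply: sub1; rewrite mulrA -mulrA -exprD; exact: E1. Qed.
Let S0 : S != 0. Proof. by rewrite !mulf_neq0 ?QpairN. Qed.

Let phiE u k l v : u * q ^+ l * q = v -> Q u = k ->
  fpoch q l u * ((1 - u * q ^+ l) * Q v) = k.
Proof. by move=> <- <-; rewrite -(qpochS q1) -(qpoch_fpoch q1). Qed.

(** The existentials hide integrals and finite factorials behind variables; what remains visible has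
    the shape of the hypotheses of the [norm_ratio] lemmas. *)
Lemma form_values : exists h h1 phi phi1 : C, exists2 p : {poly C},
  [/\ forall x, x != 0 -> leval Pp x = p.[x + x^-1], sint0 (p * p) = h,
    form Pm Pm' = (e - 1) / (2 * e) * h1 & (h1 - e * h != 0 ->
    form (P (- m%:Z)) (P' (- m%:Z)) = (h1 - e * h) / (2 * (1 - e)) /\
    form (P m%:Z) (P' m%:Z) = (1 - e) / 2 * (h * h1 / (h1 - e * h)))] &
  [/\ phi * ((1 - e * f * r * w) * V) = (1 - e * f * w) * Ee,
    phi1 * ((1 - e * f * r * w) * V) = Ee,
    h * (X * ((1 - e * r) * B * S * Cd) * phi) = 2 * K * V &
    h1 * ((1 - r) * X * (B * S * ((1 - f * w) * Cd)) * phi1) = 2 * K * V].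
Proof.
have [p [pM sp pE po]] := Pplus_poly gc g01 gL K0 wind0 q1 sq0 tk0 tk1 tu0 tu1 esP ab1 hP hP' hPp.
have [s [sM ss sE so]] := Pminus_poly gc g01 gL K0 wind0 q1 sq0 tk0 tk1 tu0 tu1 esP ab1 hP hP' hPm.
exists (sint0 (p * p)), (sint1 (s * s)), (fpoch q m (E * w)), (fpoch q n (E * r)), p.
  split=> //.
    exact: (form_Pminus gc g01 gL K0 wind0 q1 sq0 tk0 tk1 tu0 tu1 esP ab1 hP hP' hPm hPm' pM sp po sM ss so sE).
  exact: (form_PP gc g01 gL K0 wind0 q1 sq0 tk0 tk1 tu0 tu1 esP ab1 hP hP' pM sp po sM ss so).
split.
- rewrite (_ : 1 - _ = 1 - E * w * q ^+ m); last by ring.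
  apply: phiE; last first.
    by rewrite (QS (x := E * w) (y := E * r)); [congr (_ * _)|rewrite exprSr]; ring.
  by rewrite exprD !exprS; ring.
- rewrite (_ : 1 - _ = 1 - E * r * q ^+ n); last by ring.
  by apply: phiE => //; rewrite exprD !exprS; ring.
- have uE : E * w * q = E * q ^+ m by rewrite exprSr mulrA.
  rewrite -(monic_norm gc g01 gL K0 wind0 q1 q0 (erefl q) esP E1 _ _ _ pM sp po uE) => [|j|j|j]; try exact: pair1.
  rewrite (QS (x := e * r) (y := e * q ^+ m.+1)); last by rewrite -mulrA -exprSr.
  by ring.
(* For the antisymmetric part the product of the parameters is abcd q^2 and the degree is m - 1, so
   the [u] of [monic_norm] is abcd q^m. *)
- have uE : E * r * q = a * q * (b * q) * c * d * w by rewrite !exprS; ring.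
  have esP1 := separated1 sq0 esP.
  have mE : w * q = r by rewrite exprSr.
  have aqc x : a * q * x * w = a * x * r by rewrite -mE; ring.
  have bqc x : b * q * x * w = b * x * r by rewrite -mE; ring.
  have abq : a * q * (b * q) * w = e * q ^+ m.+1 by rewrite [q ^+ m.+1]exprSr -mE; ring.
  have Eq : a * q * (b * q) * c * d * q ^+ (n + n) = E * q ^+ (m + m).
    by rewrite !exprD -mE; ring.
  have E1' j : a * q * (b * q) * c * d * q ^+ j != 1.
    by rewrite (_ : _ * q ^+ j = E * q ^+ j.+2) ?E1// !exprS; ring.
  have ab' j : a * q * (b * q) * q ^+ j != 1.
    by rewrite (_ : _ * q ^+ j = e * q ^+ j.+2) ?pair1// !exprS; ring.
  have ac' x j : x \in es -> a * q * x * q ^+ j != 1.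
    by move=> xe; rewrite (_ : _ * q ^+ j = a * x * q ^+ j.+1) ?pair1// !exprS; ring.
  have N := monic_norm gc g01 gL K0 wind0 q1 q0 (erefl q) esP1 E1' ab' (ac' c ^~ inc)
    (ac' d ^~ ind) sM ss so uE.
  rewrite abq !aqc !bqc Eq (QS (x := q * w) (y := q * r)) in N; last by rewrite -mE; ring.
  rewrite (QS (x := f * w) (y := f * r)) in N; last by rewrite -mE; ring.
  by rewrite -N -[q * w]exprS; ring.
Qed.

Lemma is_form_values_pos :
  [/\ is_form (Delta_plus t) g Pp Pp
        (plus_norm m),
      is_form (Delta t) g (P m%:Z) (P' m%:Z)
        (top_norm m),
      is_form (Delta t) g (P (- m%:Z)) (P' (- m%:Z))
        (qpochs [:: q ^ (2 * m%:Z - 1) * E; q ^ (2 * m%:Z - 1) * E] q /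
         qpochs [:: q ^ m%:Z; q ^ m%:Z * a * b; q ^ m%:Z * a * c;
                    q ^ m%:Z * a * d; q ^ m%:Z * b * c; q ^ m%:Z * b * d;
                    q ^ (m%:Z - 1) * c * d; q ^ (m%:Z - 1) * E] q)
    & is_form (Delta t) g Pm Pm'
        ((a * b - 1) / (a * b) *
         (qpochs [:: q ^ (2 * m%:Z - 1) * E; q ^ (2 * m%:Z) * E] q /
          qpochs [:: q ^ m%:Z; q ^ (m%:Z + 1) * a * b; q ^ m%:Z * a * c;
                     q ^ m%:Z * a * d; q ^ m%:Z * b * c; q ^ m%:Z * b * d;
                     q ^ (m%:Z - 1) * c * d; q ^ m%:Z * E] q))].
Proof.
have [h [h1 [phi [phi1 [p [pE ph hm hPP] [p1 p2 hE h1E]]]]]] := form_values.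
have X0 := Qq m.
have B0 : B != 0 by rewrite QpairN.
have Cd0 : Cd != 0 by rewrite QpairN.
have Ee0 := QE m.
have V0 := QE (m + m).
have e1 := sub1 ab1.
rewrite exprz_double_pred exprz_double exprz_succ exprz_pred -exprnP /qpochs !big_cons !big_nil !mulr1.
have s2 (x y z : C) : x * y * z = y * z * x by rewrite -mulrA mulrC.
have QV : Q (w * r * E) = (1 - e * f * r * w) * V.
  rewrite (QS (y := E * q ^+ (m + m))); last by rewrite exprD exprSr; ring.
  by congr (_ * _); ring.
have QV' : Q (q ^+ (m + m) * E) = V by rewrite mulrC.
have QX : Q (q ^+ m.+1) = X by rewrite exprS.
have QX' : Q r = (1 - r) * X by rewrite (QS (y := q * r))// mulrC.
have QB : Q (q ^+ m.+1 * a * b) = B by rewrite s2.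
have QB' : Q (r * a * b) = (1 - e * r) * B by rewrite s2 (QS (y := e * q ^+ m.+1))// [q ^+ m.+1]exprSr mulrA.
have QC : Q (w * c * d) = (1 - f * w) * Cd by rewrite s2 (QS (y := f * r))// exprSr mulrA.
have QEe : Q (w * E) = (1 - e * f * w) * Ee.
  by rewrite mulrC (QS (y := E * r)) ?exprSr ?mulrA.
have QEe' : Q (r * E) = Ee by rewrite mulrC.
rewrite QV QV' QX QX' QB QB' QC QEe QEe' !(s2 r).
split.
- rewrite [X in is_form _ _ _ _ X](_ : _ = K^-1 * h).
    rewrite -ph; apply: (is_form_Delta_plus gc g01 gL K0 wind0 q1 sq0 esP) => x x0.
    by rewrite hornerM pE// pE ?invr_eq0// invrK (addrC x^-1).
  rewrite (norm_ratio_plusK K0' X0 B0 S0 Cd0 Ee0 er1 efw1 p1 hE).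
  by congr (_ / _); ring.
- rewrite [X in is_form _ _ _ _ X](_ : _ = K^-1 * form (P m%:Z) (P' m%:Z)).
    exact: (is_form_Delta gc g01 gL K0 wind0 q1 sq0 esP).
  have D0 := norm_ratio_diff_neq0 two0 K0' X0 B0 S0 Cd0 Ee0 V0 r1 e1 er1 fw1 efw1 efrw1 p1 p2 hE h1E.
  have [_ ->] := hPP D0.
  rewrite (norm_ratio_top two0 K0' X0 B0 S0 Cd0 Ee0 V0 r1 e1 er1 fw1 efw1 efrw1 p1 p2 hE h1E).
  by congr (_ / _); ring.
- rewrite [X in is_form _ _ _ _ X](_ : _ = K^-1 * form (P (- m%:Z)) (P' (- m%:Z))).
    exact: (is_form_Delta gc g01 gL K0 wind0 q1 sq0 esP).
  have D0 := norm_ratio_diff_neq0 two0 K0' X0 B0 S0 Cd0 Ee0 V0 r1 e1 er1 fw1 efw1 efrw1 p1 p2 hE h1E.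
  have [-> _] := hPP D0.
  rewrite (norm_ratio_bottom two0 K0' X0 B0 S0 Cd0 Ee0 r1 e1 er1 fw1 efw1 p1 p2 hE h1E).
  by congr (_ / _); ring.
- rewrite [X in is_form _ _ _ _ X](_ : _ = K^-1 * form Pm Pm').
    exact: (is_form_Delta gc g01 gL K0 wind0 q1 sq0 esP).
  rewrite hm (norm_ratio_minusK _ _ _ _ _ _ _ _ _ p2 h1E)//; last exact: mulf_neq0.
  by congr (_ * (_ / _)); ring.
Qed.

End PositiveDegree.

(** * Degree zero *)

Section ZeroDegree.

Lemma leval_leading0 (f : A) x : leading 0 f -> leval f x = 1.
Proof.
move=> fl; have [f1 _] := fl; have f0 := leading_supp (m := 0) fl.
rewrite (@leval_fset _ _ [fset 0%Z]%fset) ?big_seq_fset1 ?f1 ?expr0z ?mul1r// => n.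
by rewrite inE => n0; apply: f0; rewrite absz_gt0.
Qed.

Local Notation S4 := (Q (a * c) * Q (a * d) * Q (b * c) * Q (b * d)).

Lemma sint_one : sint0 1 * (Q q * (Q (a * b) * S4 * Q (c * d))) = 2 * K * Q E.
Proof.
have uE : E / q * q = E * q ^+ 0 by rewrite divfK// mulr1.
have := monic_norm gc g01 gL K0 wind0 q1 q0 (erefl q) esP E1 _ _ _ (monic1 _) (size_poly1 _) _ uE.
rewrite mulr1 !expr0 !mulr1 fpoch0 mulr1 => <- => [|j|j|j|u]; try exact: pair1.
  by ring.
rewrite leqn0 size_poly_eq0 => /eqP ->; rewrite mulr0.
have := sint_lin gc g01 gL K0 wind0 q1 q0 esP (-1) 0 0.
by rewrite scaler0 addr0 mulN1r addNr.
Qed.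

Let Qpair0 e f : e \in es -> f \in es -> Q (e * f) != 0.
Proof. by move=> ee ef; have := QpairN 0 ee ef; rewrite expr0 mulr1. Qed.

Let Qq0 : Q q != 0. Proof. by have := Qq 0; rewrite expr0 mulr1. Qed.

Let QE0 : Q E != 0. Proof. by have := QE 0; rewrite expr0 mulr1. Qed.

Let sint_oneE : sint0 1 = 2 * K * Q E / (Q q * (Q (a * b) * S4 * Q (c * d))).
Proof. by rewrite -sint_one mulfK// !mulf_neq0 ?Qq0 ?Qpair0. Qed.

(** For m = 0 the product (abcd/q; q)_oo occurs in numerator and denominator. It can be cancelled
    unless abcd = q, the other zeros being excluded by [abcd_neq]. *)
Lemma is_form_plus0 (f : A) : leading 0 f -> E <> q -> is_form (Delta_plus t) g f f
  (plus_norm 0).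
Proof.
move=> fl Eq; have Z0 : Q (q ^ (-1) * E) != 0.
  apply: qpoch_neq0 => // -[|j]; rewrite exprN1.
    rewrite mulr1; apply/eqP => H; apply: Eq.
    by rewrite -[LHS](mulVKf q0) H mulr1.
  have -> : q^-1 * E * q ^+ j.+1 = E * q ^+ j by rewrite exprS; field.
  exact: E1.
rewrite [X in is_form _ _ _ _ X](_ : _ = K^-1 * sint0 1).
  apply: (is_form_Delta_plus gc g01 gL K0 wind0 q1 sq0 esP) => x x0.
  by rewrite !leval_leading0// hornerC mulr1.
rewrite sint_oneE mulr0 !sub0r add0r expr1z expr0z !mul1r /qpochs !big_cons !big_nil !mulr1.
by field; rewrite K0' Z0 Qq0 !Qpair0.
Qed.

Lemma is_form_zero (f h : A) : leading 0 f -> leading 0 h -> is_form (Delta t) g f h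
  (top_norm 0).
Proof.
move=> fl hl; have Qab : Q (q * a * b) != 0.
  by have := QpairN 1 ina inb; rewrite expr1 mulrC mulrA.
have QabE : Q (a * b) = (1 - a * b) * Q (q * a * b).
  by apply: QS; rewrite mulrC mulrA.
rewrite [X in is_form _ _ _ _ X](_ : _ = K^-1 * form f h).
  exact: (is_form_Delta gc g01 gL K0 wind0 q1 sq0 esP).
(* Both functions are the constant 1, with symmetric part 1 and antisymmetric part 0. *)
have -> : form f h = (1 - a * b) / 2 * sint0 (1 * 1) - (1 - a * b) / (2 * (a * b)) * sint1 (0 * 0).
  apply: (form_decomp gc g01 gL K0 wind0 q1 sq0 tk1 tu1 esP) => x x0;
    by rewrite leval_leading0// hornerC horner0 mulr0 addr0.
have sl10 : sint1 0 = 0.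
  have := sint_lin gc g01 gL K0 wind0 q1 q0 (separated1 sq0 esP) (-1) 0 0.
  by rewrite scaler0 addr0 mulN1r addNr.
rewrite !mulr1 [X in sint1 X]mulr0 sl10 [_ * 0 in LHS]mulr0 sint_oneE QabE.
rewrite mulr0 add0r expr1z expr0z !mul1r /qpochs !big_cons !big_nil !mulr1.
have e1 := sub1 ab1.
by field; rewrite e1 K0' Qab QE0 Qq0 !Qpair0.
Qed.

End ZeroDegree.

End Values.

Theorem mainTheorem13 (R : realType) (t : params R)
  (P P' : int -> laurent R) (Pplus Pminus Pminus' : nat -> laurent R)
  (g : R -> R[i])
  (ht : generic_params t)
  (hP : forall m : int, isP t m (P m))
  (hP' : forall m : int, isP (inv_params t) m (P' m))
  (hPplus : forall m : nat, isPplus t P m (Pplus m))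
  (hPminus : forall m : nat, (0 < m)%N -> isPminus t P m (Pminus m))
  (hPminus' : forall m : nat, (0 < m)%N ->
     isPminus (inv_params t) P' m (Pminus' m))
  (hg : admissible t g) :
  let q := pq t in
  let a := pa t in let b := pb t in let c := pc t in let d := pd t in
  let abcd := a * b * c * d in
  (* the right-hand side is 0/0 when m = 0 and abcd = q *)
  [/\ forall m : nat, (m = 0%N -> abcd <> q) ->
        is_form (Delta_plus t) g (Pplus m) (Pplus m)
          (2 * qpochs [:: q ^ (2 * m%:Z - 1) * abcd; q ^ (2 * m%:Z) * abcd] q /
           qpochs [:: q ^ (m%:Z + 1); q ^ m%:Z * a * b; q ^ m%:Z * a * c;
                      q ^ m%:Z * a * d; q ^ m%:Z * b * c; q ^ m%:Z * b * d;
                      q ^ m%:Z * c * d; q ^ (m%:Z - 1) * abcd] q),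
      forall m : nat,
        is_form (Delta t) g (P m%:Z) (P' m%:Z)
          (qpochs [:: q ^ (2 * m%:Z) * abcd; q ^ (2 * m%:Z) * abcd] q /
           qpochs [:: q ^ (m%:Z + 1); q ^ (m%:Z + 1) * a * b; q ^ m%:Z * a * c;
                      q ^ m%:Z * a * d; q ^ m%:Z * b * c; q ^ m%:Z * b * d;
                      q ^ m%:Z * c * d; q ^ m%:Z * abcd] q),
      forall m : nat, (0 < m)%N ->
        is_form (Delta t) g (P (- m%:Z)) (P' (- m%:Z))
          (qpochs [:: q ^ (2 * m%:Z - 1) * abcd; q ^ (2 * m%:Z - 1) * abcd] q /
           qpochs [:: q ^ m%:Z; q ^ m%:Z * a * b; q ^ m%:Z * a * c;
                      q ^ m%:Z * a * d; q ^ m%:Z * b * c; q ^ m%:Z * b * d;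
                      q ^ (m%:Z - 1) * c * d; q ^ (m%:Z - 1) * abcd] q)
    & forall m : nat, (0 < m)%N ->
        is_form (Delta t) g (Pminus m) (Pminus' m)
          ((a * b - 1) / (a * b) *
           (qpochs [:: q ^ (2 * m%:Z - 1) * abcd; q ^ (2 * m%:Z) * abcd] q /
            qpochs [:: q ^ m%:Z; q ^ (m%:Z + 1) * a * b; q ^ m%:Z * a * c;
                       q ^ m%:Z * a * d; q ^ m%:Z * b * c; q ^ m%:Z * b * d;
                       q ^ (m%:Z - 1) * c * d; q ^ m%:Z * abcd] q))].
Proof.
have [L gL] := let: And5 _ rg _ _ _ := hg in rectifiable_normc rg.
move=> q a b c d abcd.
have pos n := is_form_values_pos ht hg gL hP hP' (hPplus n.+1) (hPminus n.+1 isT) (hPminus' n.+1 isT).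
have P0 : leading 0 (P 0) by have [[]] := hP 0.
have P0' : leading 0 (P' 0) by have [[]] := hP' 0.
have Pp0 : leading 0 (Pplus 0) by have [[]] := hPplus 0.
split.
- by case=> [Eq|n _]; [exact: (is_form_plus0 ht hg gL hP Pp0 (Eq erefl))|have [] := pos n].
- by case=> [|n]; [exact: (is_form_zero ht hg gL hP P0 P0')|have [] := pos n].
- by case=> // n _; have [] := pos n.
- by case=> // n _; have [] := pos n.
Qed.
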